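(* Let $(U_\varepsilon,W_\varepsilon)\in L^2(\Omega;\mathbb{R}^2)\times L^2(\Omega;\mathbb{R}^2)$ be a family satisfying $\sup_{\varepsilon>0}J_\varepsilon^{(0)}[U_\varepsilon,W_\varepsilon]\le C_0$ for some constant $C_0$. Then there exist $v_u,v_w\in H^1(\Omega)$ such that, up to extraction of a subsequence (not relabelled), $$\left(\mathbf{1}_{\Omega_\varepsilon}U_\varepsilon,\ \mathbf{1}_{\Omega_\varepsilon}W_\varepsilon\right)\rightharpoonup(\nabla v_u,\nabla v_w)\quad\text{weakly in }L^2\text{ as }\varepsilon\to0 .$$
   Context: $\Omega\subset\mathbb{R}^2$ is bounded, open and simply connected, with Lipschitz boundary. $d_1,\dots,d_N\in\Omega$ ($N\ge1$) are distinct points, and $b_u^i,b_w^i\in\mathbb{R}$ ($i=1,\dots,N$). $C,R,K\in\mathbb{R}$ satisfy $C,K>0$ and $CK>R^2$. $B_\rho(d)=\{z\in\mathbb{R}^2:|z-d|\le\rho\}$. The parameter $\varepsilon$ ranges over $(0,\varepsilon_0)$ with $\varepsilon_0<1$ so small that the balls $B_{\varepsilon_0}(d_i)$ are pairwise disjoint and contained in $\Omega$ (suprema over $\varepsilon>0$ are over this range). $\Omega_\varepsilon=\Omega\setminus\bigcup_{i=1}^N B_\varepsilon(d_i)$, and $\mathbf{1}_{\Omega_\varepsilon}$ is its indicator function. $\nabla\times f=\partial_xf_y-\partial_yf_x$. The set $H_0^\varepsilon$ consists of pairs $(f,g)$ with $f,g\in L^2(\Omega_\varepsilon;\mathbb{R}^2)$,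 $\nabla\times f=\nabla\times g=0$ in $\Omega_\varepsilon$, and $\int_{\partial B_\varepsilon(d_i)}f\cdot t\,ds=b_u^i$, $\int_{\partial B_\varepsilon(d_i)}g\cdot t\,ds=b_w^i$ for all $i$, where $t$ is the counterclockwise unit tangent and $f\cdot t,g\cdot t$ are tangential traces (well defined for $L^2$ curl-free fields). $J_\varepsilon^{(0)}:L^2(\Omega;\mathbb{R}^2)\times L^2(\Omega;\mathbb{R}^2)\to[0,\infty]$ is defined by $$J_\varepsilon^{(0)}[f,g]=\int_{\Omega_\varepsilon}\tfrac12\left(C|f|^2+K|g|^2+2R\,f\cdot g\right)dx\,dy$$ if $(f,g)=\left(|\ln\varepsilon|^{-1/2}\tilde f,\ |\ln\varepsilon|^{-1/2}\tilde g\right)$ on $\Omega_\varepsilon$ for some $(\tilde f,\tilde g)\in H_0^\varepsilon$, and $J_\varepsilon^{(0)}[f,g]=\infty$ otherwise. *)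

(* Defs.v *)
From mathcomp Require Import all_boot all_order all_algebra.
From mathcomp Require Import all_classical all_reals all_analysis.

Set Implicit Arguments.
Unset Strict Implicit.
Unset Printing Implicit Defensive.

Import Order.TTheory GRing.Theory Num.Theory.
Import numFieldNormedType.Exports.

Local Open Scope classical_set_scope.
Local Open Scope ring_scope.

(* [plane R] is convertible to [R * R]; it is spelled with [measurableTypeR] so
   that the product sigma-algebra is the one on which the product
   [lebesgue_measure \x lebesgue_measure] is a measure.  Its topology is the
   product one.  The library norm on a product is the sup norm, so the Euclidean
   structure is given by [dot] and [enorm]. *)
Definition plane (R : realType) := (measurableTypeR R * measurableTypeR R)%type.

Section Plane.
Context {R : realType}.
Implicit Types (D Omega : set (R * R)) (phi v : R * R -> R).
Implicit Types (f g : R * R -> R * R).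

Definition mu2 : {measure set (plane R) -> \bar R} :=
  (@lebesgue_measure R \x @lebesgue_measure R)%E.

Definition dot (u w : R * R) : R := u.1 * w.1 + u.2 * w.2.

Definition enorm (u : R * R) : R := Num.sqrt (dot u u).

Definition eball (d : R * R) (rho : R) : set (R * R) :=
  [set z | enorm (z - d) <= rho].

Definition ecircle (d : R * R) (rho : R) : set (R * R) :=
  [set z | enorm (z - d) = rho].

Definition frontier (D : set (R * R)) : set (R * R) :=
  closure D `\` interior D.

(* Near each boundary point, in coordinates [s], [t] obtained by a rotation,
   [Omega] is the part lying above the graph of a Lipschitz function. *)
Definition lipschitz_boundary (Omega : set (R * R)) : Prop :=
  forall p, frontier Omega p ->
  exists (r L a b : R) (gamma : R -> R),
    [/\ 0 < r, a ^+ 2 + b ^+ 2 = 1,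
        forall s s', `|gamma s - gamma s'| <= L * `|s - s'| &
        forall z, enorm (z - p) < r ->
          (Omega z <-> gamma (a * z.1 + b * z.2) < - b * z.1 + a * z.2)].

Definition simply_connected (Omega : set (R * R)) : Prop :=
  (forall p q, Omega p -> Omega q -> exists c : R -> R * R,
     [/\ {within `[0, 1], continuous c}, c 0 = p, c 1 = q &
         forall t, t \in `[0, 1] -> Omega (c t)]) /\
  (forall c : R -> R * R, {within `[0, 1], continuous c} ->
     (forall t, t \in `[0, 1] -> Omega (c t)) -> c 0 = c 1 ->
   exists h : R * R -> R * R,
     [/\ {within `[0, 1] `*` `[0, 1], continuous h},
         forall s t, s \in `[0, 1] -> t \in `[0, 1] -> Omega (h (s, t)),
         forall t, t \in `[0, 1] -> h (0, t) = c t,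
         forall t, t \in `[0, 1] -> h (1, t) = c 0 &
         forall s, s \in `[0, 1] -> h (s, 0) = c 0 /\ h (s, 1) = c 0]).

Definition dx phi : R * R -> R := 'D_((1, 0) : R * R) phi.
Definition dy phi : R * R -> R := 'D_((0, 1) : R * R) phi.

(* Iterated partial derivative along a word of directions (true for [dx]). *)
Definition iter_partial (w : seq bool) phi : R * R -> R :=
  foldr (fun i psi => if i then dx psi else dy psi) phi w.

Definition smooth phi : Prop := forall w : seq bool,
  continuous (iter_partial w phi) /\
  forall z, derivable (iter_partial w phi) z ((1, 0) : R * R) /\
            derivable (iter_partial w phi) z ((0, 1) : R * R).

Definition test_function D phi : Prop :=
  [/\ smooth phi, compact (closure [set z | phi z != 0]) &
      closure [set z | phi z != 0] `<=` D].

Definition L2 D v : Prop :=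
  measurable_fun (D : set (plane R)) (v : plane R -> R) /\
  (\int[mu2]_(z in D) ((v z) ^+ 2)%:E < +oo)%E.

Definition L2vec D f : Prop :=
  L2 D (fun z => (f z).1) /\ L2 D (fun z => (f z).2).

Definition weak_gradient D v f : Prop :=
  forall phi, test_function D phi ->
    (\int[mu2]_(z in D) (v z * dx phi z)) =
      - (\int[mu2]_(z in D) ((f z).1 * phi z)) /\
    (\int[mu2]_(z in D) (v z * dy phi z)) =
      - (\int[mu2]_(z in D) ((f z).2 * phi z)).

(* [v] belongs to H^1(D), and its weak gradient is (the class of) [f]. *)
Definition H1_with_gradient D v f : Prop :=
  [/\ L2 D v, L2vec D f & weak_gradient D v f].

Definition weak_cvg_L2 D (F : nat -> R * R -> R * R) f : Prop :=
  [/\ forall n, L2vec D (F n), L2vec D f &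
      forall g, L2vec D g ->
        (\int[mu2]_(z in D) dot (F n z) (g z)) @[n --> \oo] -->
        (\int[mu2]_(z in D) dot (f z) (g z) : R)].

(* For smooth [f] this is [\int_D (d_x f_y - d_y f_x) phi] when [phi] has
   compact support in [D].  In general Green's formula adds to it the boundary
   term [\int_{\partial D} (f . t) phi ds], with [t] the unit tangent having [D]
   on its right; this is counterclockwise around the holes of [D]. *)
Definition curl_pairing D f phi : R :=
  \int[mu2]_(z in D) ((f z).1 * dy phi z - (f z).2 * dx phi z).

(* The curl vanishes in the sense of distributions. *)
Definition curl_free D f : Prop :=
  forall phi, test_function D phi -> curl_pairing D f phi = 0.

Section Cores.
Variables (Omega : set (R * R)) (N : nat) (d : 'I_N -> R * R).

Definition perforated (e : R) : set (R * R) :=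
  Omega `\` \bigcup_(i : 'I_N) eball (d i) e.

(* For a curl-free field of class L^2 the tangential trace is the functional on
   boundary values given by Green's formula.  The circulation along the circle
   around [d i] is its value at the boundary datum that is 1 on this circle and
   0 on the other components of the boundary. *)
Definition circulation (e : R) f (i : 'I_N) (b : R) : Prop :=
  forall phi, test_function setT phi ->
    (forall z, ecircle (d i) e z -> phi z = 1) ->
    (forall j z, j != i -> ecircle (d j) e z -> phi z = 0) ->
    (forall z, frontier Omega z -> phi z = 0) ->
    curl_pairing (perforated e) f phi = b.

Variables bu bw : 'I_N -> R.

Definition H0 (e : R) f g : Prop :=
  [/\ L2vec (perforated e) f, L2vec (perforated e) g,
      curl_free (perforated e) f, curl_free (perforated e) g &
      forall i, circulation e f i (bu i) /\ circulation e g i (bw i)].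

Definition admissible (e : R) f g : Prop :=
  exists ft gt, H0 e ft gt /\
    {ae mu2, forall z, perforated e z ->
       f z = (`|ln e| `^ (- 2^-1)) *: ft z /\
       g z = (`|ln e| `^ (- 2^-1)) *: gt z}.

Definition J0 (C K Rc e : R) f g : \bar R :=
  if `[< admissible e f g >] then
    (\int[mu2]_(z in perforated e)
       (2^-1 * (C * dot (f z) (f z) + K * dot (g z) (g z)
                + 2 * Rc * dot (f z) (g z)))%:E)%E
  else +oo%E.

End Cores.
End Plane.

(* Main.v *)
(** By coercivity of the quadratic form the truncated fields are bounded in L^2,
    hence converge weakly along a subsequence.  A test function supported away
    from the points [d i] is supported in the perforated domain as soon as the
    holes are small, so the limit is curl-free in the domain without these
    points; points have zero capacity in the plane, so the limit is curl-free
    in the whole domain.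

    It remains to find an H^1 potential of a curl-free L^2 field F on a simply
    connected Lipschitz domain.  The increments of a potential of the mollified
    field form a cocycle which is additive on squares in the domain, and simple
    connectedness yields potentials [w_j] of the mollified fields on an
    exhaustion by compact sets.  Their translates satisfy
    |w_j(. + y) - w_j|^2 <= C |y|^2 |F|^2 in L^2, as long as the segments of
    translation stay in the compact set.  Hence a bound of [w_j - kappa_j] in
    L^2 near one point is propagated along chains of balls, and up to the
    boundary by translation in the direction transversal to the Lipschitz
    graph.  A weak limit of [w_j - kappa_j] is the potential. *)

Require Import Defs.
From HB Require Import structures.
From mathcomp Require Import all_boot all_order all_algebra.
From mathcomp Require Import all_classical all_reals all_analysis.
From mathcomp Require Import measurable_realfun ring lra.

Set Implicit Arguments.
Unset Strict Implicit.
Unset Printing Implicit Defensive.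

Import Order.TTheory GRing.Theory Num.Theory.
Import numFieldNormedType.Exports.

Local Open Scope classical_set_scope.
Local Open Scope ring_scope.

(** * Lebesgue measure on the plane *)

Section PlaneMeasure.
Context {R : realType}.
Local Notation leb := (@lebesgue_measure R).

(** The potentials are not obtained by integrating along curves. The underlying mollifier is a
    product of two copies of the derivative [kd] of a smoothed step [th]; putting [th] for one
    factor integrates the mollified field explicitly in one variable, and a difference quotient of
    [th] is again a probability density. Hence the increment [Inc] has an L^2 bound by Jensen's
    inequality, uniform in the width, and its additivity on rectangles is the curl condition tested
    with a product of step differences.

    The obstacle is that additivity holds only for widths small compared with the distance to the
    boundary, so no single width serves all of [Omega]. The cocycle argument is therefore carried
    out with identities that hold eventually along a filter; on a compact set the potential is
    rebuilt from finitely many base values, so that only finitely many identities have to hold at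
    once.

    No strong compactness is used: a translation that tends to zero moves the increment of the
    potential to the test function, where weak convergence suffices. *)

Lemma mu2X (A B : set (measurableTypeR R)) : measurable A -> measurable B ->
  (mu2 (A `*` B : set (plane R)) = leb A * leb B)%E.
Proof. by move=> mA mB; exact: product_measure1E. Qed.

Lemma mu2_sigma_finite : sigma_finite setT (@mu2 R).
Proof.
have /sigma_finiteP[F [TF ndF mF]] := @sigma_finiteT _ _ _ leb.
exists (fun n => F n `*` F n).
  apply/esym; rewrite -subTset => -[x y] _.
  have [n _ nx] : (\bigcup_i F i) x by rewrite -TF.
  have [m _ my] : (\bigcup_i F i) y by rewrite -TF.
  exists (maxn n m) => //; split.
    by apply: (subsetPset _ _ (ndF _ _ (leq_maxl n m))).
  by apply: (subsetPset _ _ (ndF _ _ (leq_maxr n m))).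
move=> n; have [m1 m2] := mF n; split; first exact: measurableX.
by rewrite mu2X// lte_mul_pinfty// ge0_fin_numE.
Qed.

(* [mu2] is a packed measure; this unpacked copy carries the sigma-finite
   structure that the Fubini theorems ask for. *)
Definition mu2_fun : set (plane R) -> \bar R := mu2.
HB.instance Definition _ := Measure.copy mu2_fun (@mu2 R).
HB.instance Definition _ :=
  Measure_isSigmaFinite.Build _ _ _ mu2_fun mu2_sigma_finite.
Definition mu2s : {sigma_finite_measure set (plane R) -> \bar R} := mu2_fun.

Lemma mu2_fubini_tonelli (f : plane R * plane R -> \bar R) :
  measurable_fun setT f -> (forall z, 0 <= f z)%E ->
  (\int[mu2]_x \int[mu2]_y f (x, y) = \int[mu2]_y \int[mu2]_x f (x, y))%E.
Proof. exact: (@fubini_tonelli _ _ _ _ _ mu2s mu2s). Qed.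

Lemma mu2_measurable_tonelli (f : plane R * plane R -> \bar R) :
  measurable_fun setT f -> (forall z, 0 <= f z)%E ->
  measurable_fun setT (fun x => \int[mu2]_y f (x, y))%E.
Proof. exact: (@measurable_fun_fubini_tonelli_F _ _ _ _ _ mu2s). Qed.

Lemma mu2_tonelli1 (f : plane R -> \bar R) : measurable_fun setT f ->
  (forall z, 0 <= f z)%E ->
  (\int[mu2]_z f z = \int[leb]_x \int[leb]_y f (x, y))%E.
Proof. exact: (@fubini_tonelli1 _ _ _ _ _ leb leb). Qed.

Lemma ball_planeE (z w : R * R) (e : R) :
  ball z e w <-> `|w.1 - z.1| < e /\ `|w.2 - z.2| < e.
Proof.
rewrite ![`|w.1 - _|]distrC ![`|w.2 - _|]distrC.
by split=> -[H1 H2]; split; move: H1 H2; rewrite -!ball_normE.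
Qed.

Lemma measurable_ball_plane (z : R * R) (e : R) :
  measurable (ball z e : set (plane R)).
Proof.
have -> : (ball z e : set (plane R)) =
   (ball z.1 e : set (measurableTypeR R)) `*` (ball z.2 e : set (measurableTypeR R)).
  by [].
by apply: measurableX; exact: measurable_ball.
Qed.

Lemma mu2_ball_lty (z : R * R) (e : R) : (mu2 (ball z e : set (plane R)) < +oo)%E.
Proof.
have -> : (ball z e : set (plane R)) =
   (ball z.1 e : set (measurableTypeR R)) `*` (ball z.2 e : set (measurableTypeR R)).
  by [].
have fin (x : R) : (leb (ball x e) < +oo)%E.
  have [e0|e0] := leP 0 e; first by rewrite lebesgue_measure_ball// ltry.
  by rewrite (ball0 _ _).2 ?measure0 ?ltry// ltW.
by rewrite mu2X; [rewrite lte_mul_pinfty// ge0_fin_numE| exact: measurable_ball..].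
Qed.

(** The sigma-algebra of [plane] is the product one, so open sets enter through a countable base:
    the sup-norm balls with rational centre and radius [1/(n+1)] contained in [U]. *)
Lemma open_measurable_plane (U : set (R * R)) :
  open U -> measurable (U : set (plane R)).
Proof.
move=> oU.
pose V (q : rat * rat * nat) : set (plane R) :=
  let B := ball ((ratr q.1.1, ratr q.1.2) : R * R) (q.2.+1%:R^-1) in
  if `[< B `<=` U >] then B else set0.
have -> : (U : set (plane R)) = \bigcup_q V q.
  apply/seteqP; split=> [z Uz|z [q _]]; last first.
    by rewrite /V; case: asboolP => // BU /BU.
  have /nbhs_ballP[e /= e0 eU] : nbhs (z : R * R) U by exact: open_nbhs_nbhs.
  (* With [c = 1/(n+1)], the rational centre found below is within [c] of [z], so the ball of radius
     [c] about it stays within [2 * c < e] of [z]. *)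
  have [n ne] : exists n : nat, n.+1%:R^-1 < e / 2.
    have := @near_infty_natSinv_lt R (PosNum (divr_gt0 e0 (ltr0Sn R 1))).
    by move=> [n _ /(_ _ (leqnn n))]; exists n.
  have n0 : 0 < n.+1%:R^-1 :> R by rewrite invr_gt0.
  set c := n.+1%:R^-1 in ne n0.
  have ratb (x : R) : exists q : rat, `|ratr q - x| < c.
    have : x - c < x + c by lra.
    move=> /rat_in_itvoo[q]; rewrite in_itv/= => /andP[q1 q2].
    by exists q; rewrite ltr_norml ltrBrDr addrC q1/= ltrBlDl.
  have [[q1 h1] [q2 h2]] := (ratb z.1, ratb z.2).
  exists (q1, q2, n) => //; rewrite /V /=.
  case: asboolP => [_|[]].
    by apply/ball_planeE => /=; rewrite distrC h1 distrC h2.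
  move=> w /ball_planeE[/=]; rewrite -/c => w1 w2; apply: eU; apply/ball_planeE.
  move: h1 h2 w1 w2; rewrite !ltr_norml => /andP[? ?] /andP[? ?] /andP[? ?] /andP[? ?].
  by split; apply/andP; split; lra.
apply: countable_bigcupT_measurable => [|q]; first exact: countableP.
by rewrite /V; case: ifP => _; [exact: measurable_ball_plane|exact: measurable0].
Qed.

Lemma closed_measurable_plane (U : set (R * R)) :
  closed U -> measurable (U : set (plane R)).
Proof.
move=> cU; rewrite -[U]setCK; apply: measurableC.
by apply: open_measurable_plane; exact: closed_openC.
Qed.

Lemma continuous_measurable_plane (f : R * R -> R) :
  continuous f -> measurable_fun setT (f : plane R -> R).
Proof.
move=> /continuousP cf; apply: (measurability _ (RGenOpens.measurableE R)).
move=> _ [_ [a [b ->] <-]]; rewrite setTI.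
by apply: open_measurable_plane; apply: cf; exact: interval_open.
Qed.

(** Lebesgue measure is determined by its values on half-open intervals, and translation preserves
    their length. *)
Lemma leb_shift (y : R) (A : set (measurableTypeR R)) : measurable A ->
  pushforward leb (fun x : measurableTypeR R => x + y : measurableTypeR R) A = leb A.
Proof.
have ms : measurable_fun setT (fun x : measurableTypeR R => x + y : measurableTypeR R).
  exact: measurable_funD.
move=> mA; apply/esym.
apply: lebesgue_measure_unique => //= _ [[a b]] _ <-.
rewrite /pushforward.
have -> : (fun x => x + y) @^-1` `]a, b] = `]a - y, b - y]%classic.
  by apply/seteqP; split=> x /=; rewrite !in_itv/= ltrBlDr lerBrDr.
rewrite !lebesgue_measure_itv/= !lte_fin ltrD2r; case: ifPn => // _.
by congr EFin; ring.
Qed.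

Lemma leb_ge0_integral_shift (f : R -> \bar R) (y : R) :
  measurable_fun setT f -> (forall r, 0 <= f r)%E ->
  (\int[leb]_r f (r + y)%R = \int[leb]_r f r)%E.
Proof.
move=> mf f0.
have ms : measurable_fun setT (fun x : measurableTypeR R => x + y : measurableTypeR R).
  exact: measurable_funD.
have := @ge0_integral_pushforward _ _ _ _ R _ ms leb setT f measurableT mf (fun y _ => f0 y).
rewrite preimage_setT => <-.
by apply: eq_measure_integral => A mA _; exact: leb_shift.
Qed.

Lemma leb_ge0_integral_opp (f : R -> \bar R) :
  measurable_fun setT f -> (forall r, 0 <= f r)%E ->
  (\int[leb]_r f (- r)%R = \int[leb]_r f r)%E.
Proof.
move=> mf f0.
have ms : measurable_fun setT (-%R : measurableTypeR R -> measurableTypeR R).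
  exact: oppr_measurable.
have := @ge0_integral_pushforward _ _ _ _ R _ ms leb setT f measurableT mf (fun y _ => f0 y).
rewrite preimage_setT => <-.
by apply: eq_measure_integral => A mA _; exact: lebesgue_measureN.
Qed.

Lemma measurable_shift_plane (y : R * R) :
  measurable_fun setT (fun z : plane R => (z + y)%R : plane R).
Proof.
apply/measurable_fun_pairP; split.
  exact: (measurable_funD (@measurable_fst _ _ (measurableTypeR R) (measurableTypeR R)) (measurable_cst _)).
exact: (measurable_funD (@measurable_snd _ _ (measurableTypeR R) (measurableTypeR R)) (measurable_cst _)).
Qed.

Lemma mu2_ge0_integral_shift (f : plane R -> \bar R) (y : R * R) :
  measurable_fun setT f -> (forall r, 0 <= f r)%E ->
  (\int[mu2]_z f (z + y)%R = \int[mu2]_z f z)%E.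
Proof.
move=> mf f0; rewrite [RHS](mu2_tonelli1 mf f0) mu2_tonelli1; last 2 first.
- exact: (measurableT_comp mf (measurable_shift_plane _)).
- by move=> z; exact: f0.
rewrite -[RHS](leb_ge0_integral_shift y.1); last 2 first.
- exact: (@measurable_fun_fubini_tonelli_F _ _ _ _ _ leb).
- by move=> r; exact: integral_ge0.
apply: eq_integral => x _ /=.
rewrite -[RHS](leb_ge0_integral_shift y.2)//.
exact: measurableT_comp.
Qed.

Lemma mu2_ge0_integral_opp (f : plane R -> \bar R) :
  measurable_fun setT f -> (forall r, 0 <= f r)%E ->
  (\int[mu2]_z f (- z)%R = \int[mu2]_z f z)%E.
Proof.
move=> mf f0; rewrite [RHS](mu2_tonelli1 mf f0) mu2_tonelli1; last 2 first.
- apply: (measurableT_comp mf); apply/measurable_fun_pairP; split.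
    exact: (measurableT_comp (@oppr_measurable R setT) (@measurable_fst _ _ (measurableTypeR R) (measurableTypeR R))).
  exact: (measurableT_comp (@oppr_measurable R setT) (@measurable_snd _ _ (measurableTypeR R) (measurableTypeR R))).
- by move=> z; exact: f0.
rewrite -[RHS]leb_ge0_integral_opp; last 2 first.
- exact: (@measurable_fun_fubini_tonelli_F _ _ _ _ _ leb).
- by move=> r; exact: integral_ge0.
apply: eq_integral => x _ /=.
rewrite -[RHS]leb_ge0_integral_opp//.
exact: measurableT_comp.
Qed.

Lemma mu2_Rintegral_shift (f : plane R -> R) (y : R * R) :
  measurable_fun setT f -> \int[mu2]_z f (z + y) = \int[mu2]_z f z.
Proof.
move=> mf; have mf' : measurable_fun setT (EFin \o f) by exact/measurable_EFinP.
rewrite /Rintegral integralE [in RHS]integralE; congr (fine (_ - _)%E).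
  rewrite -[RHS](mu2_ge0_integral_shift y (measurable_funepos mf'))//.
  by apply: eq_integral => z _; rewrite !funeposE.
rewrite -[RHS](mu2_ge0_integral_shift y (measurable_funeneg mf'))//.
by apply: eq_integral => z _; rewrite !funenegE.
Qed.

End PlaneMeasure.

(** * Weak compactness *)

Section Subsequences.
Context {R : realType}.

(** The segment is compact, so [u] has a cluster point along [G]; for an ultrafilter a cluster point
    is a limit. *)
Lemma bounded_ultrafilter_cvg (G : set_system nat) (u : nat -> R) (M : R) :
  UltraFilter G -> (forall n, `|u n| <= M) -> exists l : R, u n @[n --> G] --> l.
Proof.
move=> GU uM.
have FU : ProperFilter (u @ G) by exact: fmap_proper_filter.
have [|l [_ ul]] := @segment_compact R (- M) M _ FU.
  apply: (@filterS _ G _ setT) => [n _ /=|]; last exact: filterT.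
  by rewrite in_itv/= -ler_norml.
exists l => A lA; have [//|nA] := in_ultra_setVsetC (u @^-1` A) GU.
by have [x []] := ul (~` A) A nA lA.
Qed.

(** Diagonal choice: the [k]-th index lies beyond the previous one and brings the first [k + 1]
    sequences within [1/(k+1)] of their limits. Such indices exist beyond any bound because [G]
    contains the cofinite sets. *)
Lemma ultrafilter_subsequence (G : set_system nat) (u : nat -> nat -> R)
    (l : nat -> R) : UltraFilter G -> \oo `<=` G ->
  (forall m, u m n @[n --> G] --> l m) ->
  exists sigma : nat -> nat, (forall m n, (m < n)%N -> (sigma m < sigma n)%N) /\
    forall m, u m (sigma n) @[n --> \oo] --> l m.
Proof.
move=> GU ooG ul.
have pickP k N : exists n, (N <= n)%N /\
    forall m, (m <= k)%N -> `|l m - u m n| < k.+1%:R^-1.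
  have : G [set n | (N <= n)%N /\ forall m, (m <= k)%N -> `|l m - u m n| < k.+1%:R^-1].
    apply: filterI; first by apply: ooG; exact: nbhs_infty_ge.
    elim: {1}k => [|j IH].
      have /cvgr_dist_lt/(_ (k.+1%:R^-1)) := ul 0%N.
      by rewrite invr_gt0 ltr0n => /(_ isT); apply: filterS => n un m; rewrite leqn0 => /eqP ->.
    have /cvgr_dist_lt/(_ (k.+1%:R^-1)) := ul j.+1.
    rewrite invr_gt0 ltr0n => /(_ isT) Hj.
    apply: filterS (filterI IH Hj) => n [h1 h2] m.
    by rewrite leq_eqVlt => /orP[/eqP ->//|]; rewrite ltnS; exact: h1.
  by move=> /filter_ex[n]; exists n.
have /choice[f fP] : forall kN : nat * nat, exists n, (kN.2 <= n)%N /\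
    forall m, (m <= kN.1)%N -> `|l m - u m n| < kN.1.+1%:R^-1.
  by move=> [k N]; exact: pickP.
pose sigma := fix s k := match k with 0 => f (0, 0)%N | k'.+1 => f (k'.+1, (s k').+1) end.
have sS k : (sigma k < sigma k.+1)%N by have [] := fP (k.+1, (sigma k).+1).
have sP k m : (m <= k)%N -> `|l m - u m (sigma k)| < k.+1%:R^-1.
  by case: k => [|k]; [have [_] := fP (0,0)%N|have [_] := fP (k.+1, (sigma k).+1)]; apply.
exists sigma; split.
  exact: (homo_ltn ltn_trans sS).
move=> m; apply/cvgrPdist_lt => e e0.
have := @near_infty_natSinv_lt R (PosNum e0) => -[K _ KP].
exists (maxn m K) => // n /=; rewrite geq_max => /andP[mn Kn].
by apply: lt_trans (sP _ _ mn) _; exact: KP.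
Qed.

End Subsequences.

(** * Weak sequential compactness for a complete semi-inner product *)

Section WeakCompactness.
Context {R : realType} {E : lmodType R}.
Variables (V : set E) (B : E -> E -> R).
Hypothesis V0 : V 0.
Hypothesis VZD : forall a x y, V x -> V y -> V (a *: x + y).
Hypothesis BC : forall x y, V x -> V y -> B x y = B y x.
Hypothesis BZD : forall a x y z, V x -> V y -> V z ->
  B (a *: x + y) z = a * B x z + B y z.
Hypothesis B_ge0 : forall x, V x -> 0 <= B x x.

Let BZDr a x y z : V x -> V y -> V z -> B z (a *: x + y) = a * B z x + B z y.
Proof.
by move=> Vx Vy Vz; rewrite BC ?BZD// 1?(BC Vx)// 1?(BC Vy)//; exact: VZD.
Qed.

Lemma discriminant_le (a b c : R) : 0 <= a ->
  (forall t, 0 <= t ^+ 2 * a + 2 * t * b + c) -> b ^+ 2 <= a * c.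
Proof.
move=> a0 H; have [a1|a1] := ltP 0 a.
  have := H (- b / a).
  have -> : (- b / a) ^+ 2 * a + 2 * (- b / a) * b + c = (a * c - b ^+ 2) / a.
    by field; rewrite gt_eqF.
  by rewrite pmulr_lge0 ?invr_gt0// subr_ge0.
have a00 : a = 0 by apply/eqP; rewrite eq_le a1.
have [->|b0] := eqVneq b 0; first by rewrite a00 expr0n/= mul0r.
(* For [a = 0] the polynomial is affine in [t]; this [t] gives it the value [-1]. *)
have := H (- (c + 1) / (2 * b)); rewrite a00 mulr0 add0r.
have -> : 2 * (- (c + 1) / (2 * b)) * b + c = -1 by field.
by rewrite ler0N1.
Qed.

Let Bquad t x y : V x -> V y ->
  B (t *: x + y) (t *: x + y) = t ^+ 2 * B x x + 2 * t * B x y + B y y.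
Proof.
move=> Vx Vy; rewrite BZD//; last exact: VZD.
by rewrite !BZDr// (BC Vy Vx); ring.
Qed.

Lemma form_cauchy_schwarz x y : V x -> V y -> B x y ^+ 2 <= B x x * B y y.
Proof.
move=> Vx Vy; apply: discriminant_le => [|t]; first exact: B_ge0.
by rewrite -Bquad//; apply: B_ge0; exact: VZD.
Qed.

(* Near-minimizers of [B s s - 2 * l s] on [S] almost represent [l]. *)
Lemma almost_riesz (S : set E) (l : E -> R) (M e : R) :
  S `<=` V -> S 0 -> (forall a x y, S x -> S y -> S (a *: x + y)) ->
  (forall a x y, S x -> S y -> l (a *: x + y) = a * l x + l y) ->
  (forall x, S x -> l x ^+ 2 <= M * B x x) -> 0 <= M -> 0 < e ->
  exists2 s, S s & forall x, S x -> (B s x - l x) ^+ 2 <= e * B x x.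
Proof.
move=> SV S0 SZD lZD lM M0 e0.
pose Phi s := B s s - 2 * l s.
have Phi_lb s : S s -> - M <= Phi s.
  move=> Ss; have Bs := B_ge0 (SV _ Ss); have := lM _ Ss => h.
  rewrite /Phi; set b := B s s in Bs h *; set m := l s in h *.
  have [l0|l0] := leP m 0; first by lra.
  (* [m ^+ 2 <= M * b] and [4 * M * b <= (M + b) ^+ 2] give [2 * m <= M + b]. *)
  have : (2 * m) ^+ 2 <= (M + b) ^+ 2 by have := sqr_ge0 (M - b); nra.
  by rewrite ler_sqr ?nnegrE; lra.
pose A := Phi @` S.
have hA : has_inf A.
  by split; [exists (Phi 0); exists 0|exists (- M) => _ [s Ss <-]; exact: Phi_lb].
have [_ [s Ss <-] sinf] := inf_adherent e0 hA.
exists s => // x Sx.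
(* Moving [s] by [t *: x] changes [Phi] by [t ^+ 2 * B x x + 2 * t * (B s x - l x)], which is at
   least [- e] for every [t] since [Phi s] is within [e] of the infimum. *)
rewrite mulrC; apply: discriminant_le => [|t]; first exact/B_ge0/SV.
have : inf A <= Phi (t *: x + s).
  by apply: ge_inf; [exact: hA.2|exists (t *: x + s) => //; exact: SZD].
rewrite {1}/Phi Bquad ?lZD//; [|exact: SV..].
rewrite (BC (SV _ Sx) (SV _ Ss)); move: sinf; rewrite /Phi; nra.
Qed.

Hypothesis complete : forall u : nat -> E, (forall n, V (u n)) ->
  (forall e, 0 < e -> exists N, forall m n, (N <= m)%N -> (N <= n)%N ->
     B (u m - u n) (u m - u n) <= e) ->
  exists2 l, V l & forall e, 0 < e -> exists N, forall n, (N <= n)%N ->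
     B (u n - l) (u n - l) <= e.

Let subE (x y : E) : x - y = (-1) *: y + x.
Proof. by rewrite scaleN1r addrC. Qed.

Let VB x y : V x -> V y -> V (x - y).
Proof. by move=> Vx Vy; rewrite subE; exact: VZD. Qed.

Let BBl x y z : V x -> V y -> V z -> B (x - y) z = B x z - B y z.
Proof. by move=> *; rewrite subE BZD// mulN1r addrC. Qed.

(** Approximate representatives with error [1/(n+1)] form a Cauchy sequence: their two defining
    inequalities, tested on the difference [u m - u n] itself, bound its energy. *)
Lemma riesz (l : E -> R) (M : R) :
  (forall a x y, V x -> V y -> l (a *: x + y) = a * l x + l y) ->
  (forall x, V x -> l x ^+ 2 <= M * B x x) -> 0 <= M ->
  exists2 r, V r & forall x, V x -> B r x = l x.
Proof.
move=> lZD lM M0.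
have /choice[u uP] n : exists s, V s /\ forall x, V x ->
    (B s x - l x) ^+ 2 <= n.+1%:R^-1 * B x x.
  have n0 : 0 < n.+1%:R^-1 :> R by rewrite invr_gt0.
  by have [s Vs sP] := almost_riesz (@subset_refl _ V) V0 VZD lZD lM M0 n0; exists s.
have uV n : V (u n) by have [] := uP n.
have small (e : R) : 0 < e -> exists N, forall n, (N <= n)%N -> n.+1%:R^-1 < e.
  move=> e0; have := @near_infty_natSinv_lt R (PosNum e0) => -[N _ NP].
  by exists N => n; exact: NP.
have [|r Vr ur] := complete uV.
  (* Since [bb = p - q] and [(p - q) ^+ 2 <= 2 * p ^+ 2 + 2 * q ^+ 2], errors of size [e / 4] give
     [bb ^+ 2 <= e * bb]. *)
  move=> e e0; have e4 : 0 < e / 4 by lra.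
  have [N NP] := small _ e4; exists N => m n /NP em /NP en.
  set x := u m - u n; have Vx : V x by exact: VB.
  have Bx := B_ge0 Vx.
  have hm := (uP m).2 _ Vx; have hn := (uP n).2 _ Vx.
  have xE : B x x = (B (u m) x - l x) - (B (u n) x - l x) by rewrite {1}/x BBl//; ring.
  set p := B (u m) x - l x in hm xE; set q := B (u n) x - l x in hn xE.
  set bb := B x x in Bx hm hn xE *.
  have h1 : p ^+ 2 <= e / 4 * bb by apply: le_trans hm _; rewrite ler_wpM2r// ltW.
  have h2 : q ^+ 2 <= e / 4 * bb by apply: le_trans hn _; rewrite ler_wpM2r// ltW.
  have h3 : bb ^+ 2 <= e * bb by rewrite {1}xE; nra.
  have [b0|b0] := ltP 0 bb; last by lra.
  by move: h3; rewrite expr2 ler_pM2r.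
exists r => // x Vx; apply/eqP; rewrite -subr_eq0 -sqrf_eq0 eq_le sqr_ge0 andbT.
apply/ler_addgt0Pl => e e0; rewrite addr0.
(* Two squares of size [e' * B x x] contribute at most [4 * (e' * B x x) <= e]; the [+ 1] covers
   [B x x = 0]. *)
pose e' := e / (4 * (B x x + 1)).
have Bx := B_ge0 Vx.
have e'0 : 0 < e' by rewrite divr_gt0//; lra.
have [N1 h1] := small _ e'0; have [N2 h2] := ur _ e'0.
pose n := maxn N1 N2.
have /h1 {}h1 : (N1 <= n)%N by rewrite leq_maxl.
have /h2 {}h2 : (N2 <= n)%N by rewrite leq_maxr.
have hn := (uP n).2 _ Vx.
have cs := form_cauchy_schwarz (VB (uV n) Vr) Vx.
rewrite BBl// in cs.
have -> : B r x - l x = (B (u n) x - l x) - (B (u n) x - B r x) by ring.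
set p := _ - l x in hn *; set q := _ - B r x in cs *.
have h3 : p ^+ 2 <= e' * B x x by apply: le_trans hn _; rewrite ler_wpM2r// ltW.
have h4 : q ^+ 2 <= e' * B x x by apply: le_trans cs _; rewrite ler_wpM2r.
have h5 : 4 * (e' * B x x) <= e.
  have -> : e = 4 * (e' * (B x x + 1)) by rewrite /e'; field; lra.
  by rewrite ler_pM2l// ler_pM2l//; lra.
by nra.
Qed.

(* An ultrafilter makes all the scalar products converge at once, which avoids
   separability; only afterwards is a subsequence extracted. *)
Theorem weak_compactness (x : nat -> E) (M : R) : (forall n, V (x n)) ->
  (forall n, B (x n) (x n) <= M) ->
  exists sigma : nat -> nat, exists2 l, V l &
    (forall m n, (m < n)%N -> (sigma m < sigma n)%N) /\
    forall g, V g -> B (x (sigma n)) g @[n --> \oo] --> B l g.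
Proof.
move=> Vx xM.
have M0 : 0 <= M by apply: le_trans (xM 0%N); exact: B_ge0.
have [G [GU ooG]] := @ultraFilterLemma nat \oo _.
have bnd n g : V g -> B (x n) g ^+ 2 <= M * B g g.
  move=> Vg; apply: le_trans (form_cauchy_schwarz _ _) _ => //.
  by rewrite ler_wpM2r//; exact: B_ge0.
have /choice[L LP] g : exists l : R, V g -> B (x n) g @[n --> G] --> l.
  have [Vg|nVg] := pselect (V g); last by exists 0.
  have [|l] := @bounded_ultrafilter_cvg R G (fun n => B (x n) g) (M * B g g + 1) GU; last by exists l.
  move=> n; have := bnd n _ Vg; set b := B _ g => h.
  by rewrite ler_norml; have := B_ge0 Vg; nra.
have [l Vl lP] : exists2 l, V l & forall g, V g -> B l g = L g.
  apply: (@riesz L M) => // [a y z Vy Vz|y Vy].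
    apply: (@cvg_unique _ _ ((fun n => B (x n) (a *: y + z)) @ G)) => //.
      by apply: LP; exact: VZD.
    rewrite (_ : (fun n => _) = (fun n => a * B (x n) y + B (x n) z)); last first.
      by apply/funext => n; rewrite BZDr.
    by apply: cvgD; [apply: cvgMr; exact: LP|exact: LP].
  have h : B (x n) y ^+ 2 @[n --> G] --> L y ^+ 2.
    by rewrite !expr2; apply: cvgM; exact: LP.
  apply: (cvgr_to_le h).
  by apply: (@filterS _ G _ setT) => [n _ /=|]; [exact: bnd|exact: filterT].
(* The countable family on which the subsequence is made to converge: the weak limit [l] at index
   [0] and the vectors [x m'] at index [m'.+1]. *)
pose u m n := B (x n) (if m is m'.+1 then x m' else l).
have [|sigma [sincr sP]] := @ultrafilter_subsequence R G u
    (fun m => B l (if m is m'.+1 then x m' else l)) GU ooG.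
  by case=> [|m]; rewrite /u lP//; exact: LP.
exists sigma, l => //; split=> // g Vg.
pose y n := x (sigma n) - l; have Vy n : V (y n) by exact: VB.
have By n z : V z -> B (y n) z = B (x (sigma n)) z - B l z by move=> Vz; rewrite BBl.
pose S := [set s | V s /\ B (y n) s @[n --> \oo] --> (0 : R)].
have SV : S `<=` V by move=> s [].
have Sx m : S (if m is m'.+1 then x m' else l).
  split; first by case: m.
  have := sP m; rewrite -subr_cvg0; apply: cvg_trans; apply: near_eq_cvg.
  by apply: nearW => n; rewrite By//; case: m.
have SZD a s t : S s -> S t -> S (a *: s + t).
  move=> [Vs s0] [Vt t0]; split; first exact: VZD.
  rewrite (_ : (fun n => _) = (fun n => a * B (y n) s + B (y n) t)).
    rewrite (_ : 0 = a * 0 + 0); last by rewrite mulr0 addr0.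
    by apply: cvgD; [apply: cvgMr; exact: s0|exact: t0].
  by apply/funext => n; rewrite BZDr.
have S0 : S 0.
  have -> : (0 : E) = (-1) *: l + l by rewrite scaleN1r addNr.
  by apply: SZD; exact: (Sx 0%N).
have Sy n : S (y n) by rewrite /y subE; apply: SZD; [exact: (Sx 0%N)|exact: (Sx _.+1)].
(* From [0 <= B (x + l) (x + l)]: the energy of a difference is at most twice the sum of the
   energies. *)
pose M' := 2 * M + 2 * B l l.
have yM n : B (y n) (y n) <= M'.
  have := Bquad 1 (Vx (sigma n)) Vl.
  have := B_ge0 (VZD 1 (Vx (sigma n)) Vl).
  have := Bquad (-1) Vl (Vx (sigma n)); rewrite -subE -/(y n) => ->.
  move=> /[swap] ->; rewrite (BC (Vx _) Vl).
  by have := xM (sigma n); rewrite /M'; lra.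
rewrite -subr_cvg0; apply/cvgr0Pnorm_le => e e0.
have M'0 : 0 <= M' by apply: le_trans (yM 0%N); exact: B_ge0.
pose e' := (e / 2) ^+ 2 / (M' + 1).
have e'0 : 0 < e' by rewrite divr_gt0 ?exprn_gt0//; lra.
have lZD a s t : S s -> S t -> B g (a *: s + t) = a * B g s + B g t.
  by move=> Ss St; rewrite BZDr//; exact: SV.
have lS s : S s -> B g s ^+ 2 <= B g g * B s s.
  by move=> Ss; apply: form_cauchy_schwarz => //; exact: SV.
(* [s] is nearly the orthogonal projection of [g] on [S]. The vectors [y n] lie in [S], so replacing
   [g] by [s] costs at most [e / 2] uniformly in [n], and [B (y n) s] tends to zero by definition of
   [S]. *)
have [s Ss sP'] := almost_riesz SV S0 SZD lZD lS (B_ge0 Vg) e'0.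
have e20 : 0 < e / 2 by lra.
have /cvgr0Pnorm_le/(_ _ e20) := Ss.2; apply: filterS => n /= h.
rewrite -By//.
have h1 := sP' _ (Sy n).
have h2 : (B (y n) s - B (y n) g) ^+ 2 <= (e / 2) ^+ 2.
  rewrite (BC (Vy n) Vg) (BC (Vy n) (SV _ Ss)); apply: le_trans h1 _.
  have -> : (e / 2) ^+ 2 = e' * (M' + 1) by rewrite /e'; field; lra.
  by rewrite ler_pM2l//; have := yM n; lra.
have {}h2 : `|B (y n) s - B (y n) g| <= e / 2.
  by rewrite -ler_sqr ?nnegrE ?normr_ge0 ?real_normK ?num_real//; lra.
have -> : B (y n) g = B (y n) s - (B (y n) s - B (y n) g) by ring.
by apply: le_trans (ler_normB _ _) _; lra.
Qed.

End WeakCompactness.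

(** * Square integrable functions *)

Section SquareIntegrable.
Context d (T : measurableType d) (R : realType).
Variable mu : {measure set T -> \bar R}.
Implicit Types f g h : T -> R.

Definition sqint f := measurable_fun setT f /\
  (\int[mu]_x (f x ^+ 2)%:E < +oo)%E.

Definition ip f g : R := \int[mu]_x (f x * g x).

Lemma sqint_integrable_sqr f : sqint f -> mu.-integrable setT (fun x => (f x ^+ 2)%:E).
Proof.
move=> [mf foo]; apply/integrableP; split.
  by apply/measurable_EFinP; apply: measurable_funX.
under eq_integral => x _ do rewrite gee0_abs ?lee_fin ?sqr_ge0//.
exact: foo.
Qed.

Lemma sqint_integrableM f g : sqint f -> sqint g ->
  mu.-integrable setT (fun x => (f x * g x)%:E).
Proof.
move=> Lf Lg; apply: (@le_integrable _ _ _ mu _ measurableT _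
    (fun x => (f x ^+ 2)%:E + (g x ^+ 2)%:E)%E).
- by apply/measurable_EFinP; apply: measurable_funM; [exact: Lf.1|exact: Lg.1].
- move=> x _; rewrite -EFinD !abse_EFin lee_fin normrM [leRHS]ger0_norm; last first.
    by rewrite addr_ge0// sqr_ge0.
  by rewrite -[f x ^+ 2]real_normK ?num_real// -[g x ^+ 2]real_normK ?num_real//; nra.
- by apply: integrableD => //; exact: sqint_integrable_sqr.
Qed.

Lemma sqint_ipE f : sqint f -> (\int[mu]_x (f x ^+ 2)%:E = (ip f f)%:E)%E.
Proof.
move=> Lf; rewrite /ip /Rintegral fineK; last first.
  exact: integrable_fin_num (sqint_integrableM Lf Lf).
by apply: eq_integral => x _; rewrite expr2.
Qed.

Lemma sqint0 : sqint (fun=> 0).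
Proof.
by split; [exact: measurable_cst|under eq_integral do rewrite expr0n/=; rewrite integral0 ltry].
Qed.

Lemma sqint_lin (a : R) f g : sqint f -> sqint g -> sqint (fun x => a * f x + g x).
Proof.
move=> Lf Lg; split.
  by apply: measurable_funD; [apply: measurable_funM => //; exact: Lf.1|exact: Lg.1].
apply: (@le_lt_trans _ _ (\int[mu]_x ((2 * a ^+ 2)%:E * (f x ^+ 2)%:E + 2%:E * (g x ^+ 2)%:E))%E).
  apply: ge0_le_integral => //.
  - by move=> x _; rewrite lee_fin sqr_ge0.
  - apply/measurable_EFinP; apply: measurable_funX; apply: measurable_funD; last exact: Lg.1.
    by apply: measurable_funM => //; exact: Lf.1.
  - by apply: emeasurable_funD; apply: emeasurable_funM => //; apply/measurable_EFinP;
      apply: measurable_funX; [exact: Lf.1|exact: Lg.1].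
  - move=> x _; rewrite -!EFinM -EFinD lee_fin.
    by have := sqr_ge0 (a * f x - g x); nra.
apply: integrable_lty => //; apply: integrableD => //; apply: integrableZl => //;
  exact: sqint_integrable_sqr.
Qed.

Lemma ipC f g : ip f g = ip g f.
Proof. by apply: eq_Rintegral => x _; rewrite mulrC. Qed.

Lemma ip_lin (a : R) f g h : sqint f -> sqint g -> sqint h ->
  ip (fun x => a * f x + g x) h = a * ip f h + ip g h.
Proof.
move=> Lf Lg Lh; rewrite /ip -RintegralZl//; last exact: sqint_integrableM.
rewrite -RintegralD//; last 2 first.
- exact: (integrableZl measurableT a (sqint_integrableM Lf Lh)).
- exact: sqint_integrableM.
by apply: eq_Rintegral => x _; ring.
Qed.

Lemma ip_ge0 f : 0 <= ip f f.
Proof. by apply: Rintegral_ge0 => x _; rewrite -expr2 sqr_ge0. Qed.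

Lemma ip_cauchy_schwarz f g : sqint f -> sqint g -> ip f g ^+ 2 <= ip f f * ip g g.
Proof.
move=> Lf Lg.
apply: (@form_cauchy_schwarz R (T -> R) sqint ip) => //.
- by move=> a u v Lu Lv; exact: sqint_lin.
- by move=> u v _ _; exact: ipC.
- by move=> a u v w Lu Lv Lw; exact: ip_lin.
- by move=> u _; exact: ip_ge0.
Qed.

Lemma sqint_sub f g : sqint f -> sqint g -> sqint (fun x => f x - g x).
Proof.
move=> Lf Lg; have := sqint_lin (-1) Lg Lf.
by under eq_fun do rewrite mulN1r addrC.
Qed.

(** The Riesz-Fischer argument: along a subsequence whose squared increments have integral at most
    [8^-k], the series [S] is integrable, so the subsequence converges almost everywhere, and
    Fatou's lemma turns the Cauchy condition into convergence in L^2. *)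
Lemma sqint_complete (u : nat -> T -> R) : (forall n, sqint (u n)) ->
  (forall e, 0 < e -> exists N, forall m n, (N <= m)%N -> (N <= n)%N ->
     ip (fun x => u m x - u n x) (fun x => u m x - u n x) <= e) ->
  exists2 l, sqint l & forall e, 0 < e -> exists N, forall n, (N <= n)%N ->
     ip (fun x => u n x - l x) (fun x => u n x - l x) <= e.
Proof.
move=> Lu cu.
have /choice[N0 N0P] k : exists N, forall m n, (N <= m)%N -> (N <= n)%N ->
    ip (fun x => u m x - u n x) (fun x => u m x - u n x) <= (8^-1) ^+ k.
  by apply: cu; rewrite exprn_gt0// invr_gt0.
(* Partial sums of the successors make [N] strictly increasing and at least [N0]. *)
pose N k := (\sum_(i < k.+1) (N0 i).+1)%N.
have NS k : (N k < N k.+1)%N by rewrite /N [in X in (_ < X)%N]big_ord_recr/= -ltn_subLR ?subnn// leqnn.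
have N0N k : (N0 k <= N k)%N by rewrite /N big_ord_recr/= (leq_trans (leqnSn _))// leq_addl.
have Nmono : {homo N : i j / (i <= j)%N >-> (i <= j)%N}.
  exact: (homo_leq leqnn (fun y x z => @leq_trans y x z) (fun k => ltnW (NS k))).
have kN k : (k <= N k)%N by elim: k => // k IH; exact: (leq_ltn_trans IH (NS k)).
pose w k x := u (N k) x.
pose dd k x := w k.+1 x - w k x.
have Ldd k : sqint (dd k) := sqint_sub (Lu (N k.+1)) (Lu (N k)).
have ddle k : (\int[mu]_x (dd k x ^+ 2)%:E <= ((8^-1) ^+ k)%:E)%E.
  rewrite sqint_ipE// lee_fin; apply: N0P; last exact: N0N.
  by rewrite (leq_trans (N0N k))// Nmono.
(* The weight [4 ^+ k] leaves [2^-k] from the bound [8^-k] on the integrals, and where [S] is finite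
   it forces increments of order [2^-k]. *)
pose S x := (\sum_(0 <= k <oo) (4 ^+ k * dd k x ^+ 2)%:E)%E.
have mS : measurable_fun setT S.
  apply: ge0_emeasurable_sum => [k x _ _|k _]; first by rewrite lee_fin mulr_ge0// sqr_ge0.
  by apply/measurable_EFinP; apply: measurable_funM => //; apply: measurable_funX; exact: (Ldd k).1.
have S0 x : (0 <= S x)%E by apply: nneseries_ge0 => k _ _; rewrite lee_fin mulr_ge0// sqr_ge0.
have intS : (\int[mu]_x S x < +oo)%E.
  rewrite integral_nneseries//; last 2 first.
  - by move=> k; apply/measurable_EFinP; apply: measurable_funM => //; apply: measurable_funX; exact: (Ldd k).1.
  - by move=> k x _; rewrite lee_fin mulr_ge0// sqr_ge0.
  apply: (@le_lt_trans _ _ (\sum_(0 <= k <oo) (2^-1 ^+ k)%:E)%E).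
    apply: lee_nneseries => [k _ _|k _].
      by apply: integral_ge0 => x _; rewrite lee_fin mulr_ge0// sqr_ge0.
    under eq_integral do rewrite EFinM.
    rewrite ge0_integralZl//; last 2 first.
    - by apply/measurable_EFinP; apply: measurable_funX; exact: (Ldd k).1.
    - by move=> x _; rewrite lee_fin sqr_ge0.
    apply: (le_trans (lee_wpmul2l _ (ddle k))); first by rewrite lee_fin.
    by rewrite -EFinM -exprMn lee_fin; apply: lerXn2r; rewrite ?nnegrE//; lra.
  apply: (@le_lt_trans _ _ 2%:E); last exact: ltry.
  apply: lime_le.
    by apply: is_cvg_nneseries => k _ _; rewrite lee_fin exprn_ge0// invr_ge0.
  apply: nearW => n; rewrite sumEFin lee_fin.
  suff : \sum_(0 <= i < n) (2^-1 : R) ^+ i + 2 * (2^-1 ^+ n) <= 2.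
    by apply: le_trans; rewrite lerDl mulr_ge0// exprn_ge0// invr_ge0.
  elim: n => [|n]; first by rewrite big_geq// expr0; lra.
  by rewrite big_nat_recr//= exprS; lra.
pose A := [set x | (S x < +oo)%E].
have mA : measurable A.
  rewrite -[A]setTI (_ : A = S @^-1` [set` `]-oo, +oo%E[]); last first.
    by apply/seteqP; split=> x; rewrite /A/= in_itv.
  by apply: mS => //; exact: emeasurable_itv.
have Sfin x : A x -> S x \is a fin_num by move=> Ax; rewrite ge0_fin_numE.
have muA : mu (~` A) = 0.
  have iS : mu.-integrable setT S.
    by apply/integrableP; split => //; under eq_integral do rewrite gee0_abs//.
  apply/negligibleP; first exact: measurableC.
  apply: negligibleS (integrable_ae measurableT iS) => x /= nAx h; apply: nAx.
  by rewrite /A/= -ge0_fin_numE//; exact: h.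
(* Cut off by [A], the sequence converges at every point, so its limit is measurable. *)
pose v k x := w k x * \1_A x.
have mv k : measurable_fun setT (v k).
  by apply: measurable_funM; [exact: (Lu (N k)).1|exact: measurable_indic].
have cv x : cvgn (v ^~ x).
  have [Ax|nAx] := pselect (A x); last first.
    rewrite (_ : v^~ x = fun=> 0); first exact: is_cvg_cst.
    by apply/funext => k; rewrite /v indicE memNset// mulr0.
  rewrite (_ : v^~ x = w^~ x); last first.
    by apply/funext => k; rewrite /v indicE mem_set// mulr1.
  pose s := fine (S x).
  have s0 : 0 <= s by rewrite fine_ge0.
  have ddb k : `|dd k x| <= (1 + s) * 2^-1 ^+ k.
    have : ((4 ^+ k * dd k x ^+ 2)%:E <= S x)%E.
      apply: le_trans (@nneseries_lim_ge _ _ xpredT 0%N k.+1 _); last first.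
        by move=> n _ _; rewrite lee_fin mulr_ge0// sqr_ge0.
      rewrite big_nat_recr//= leeDr// sume_ge0// => n _.
      by rewrite lee_fin mulr_ge0// sqr_ge0.
    rewrite -(fineK (Sfin _ Ax)) lee_fin -/s => h.
    have b0 : 0 <= (1 + s) * 2^-1 ^+ k.
      by apply: mulr_ge0; [exact: addr_ge0|apply: exprn_ge0; rewrite invr_ge0].
    rewrite -(ler_sqr (normr_ge0 _) b0) real_normK ?num_real// exprMn.
    have -> : (2^-1 ^+ k) ^+ 2 = (4 ^+ k)^-1 :> R.
      by rewrite -exprM mulnC exprM -exprVn; congr (_ ^+ _); field.
    rewrite -ler_pdivrMr ?invr_gt0 ?exprn_gt0// invrK mulrC.
    by apply: le_trans h _; nra.
  have cd : cvgn (series (dd ^~ x)).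
    apply: normed_cvg; apply: (@series_le_cvg _ _ (geometric (1 + s) 2^-1)) => //.
    - by move=> n /=; exact: normr_ge0.
    - by move=> n /=; apply: mulr_ge0; [exact: addr_ge0|apply: exprn_ge0; rewrite invr_ge0].
    - by apply: is_cvg_geometric_series; rewrite ger0_norm ?invr_ge0//; lra.
  rewrite (_ : w ^~ x = (fun k => w 0%N x + series (telescope (w ^~ x)) k)); last first.
    by apply/funext => k; rewrite -eq_sum_telescope.
  by apply: is_cvgD; [exact: is_cvg_cst|exact: cd].
pose l x := limn (v ^~ x).
have ml : measurable_fun setT l.
  by apply: (measurable_fun_cvg mv) => x _; exact: cv.
(* Fatou's lemma in [k] for the squares of [u n - v k]; [v k] equals [u (N k)] almost everywhere,
   and [N k] is eventually at least [n]. *)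
have fatou_bound n e : (forall m, (n <= m)%N ->
     ip (fun x => u m x - u n x) (fun x => u m x - u n x) <= e) ->
   (\int[mu]_x ((u n x - l x) ^+ 2)%:E <= e%:E)%E.
  move=> H; pose F k x := ((u n x - v k x) ^+ 2)%:E.
  have mF k : measurable_fun setT (F k).
    apply/measurable_EFinP; apply: measurable_funX; apply: measurable_funB => //.
    exact: (Lu n).1.
  have F0 k x : (0 <= F k x)%E by rewrite lee_fin sqr_ge0.
  have -> : (\int[mu]_x ((u n x - l x) ^+ 2)%:E = \int[mu]_x limn_einf (F ^~ x))%E.
    apply: eq_integral => x _; apply/esym.
    have -> // := (@cvg_limn_einf_sup _ (F ^~ x) ((u n x - l x) ^+ 2)%:E _).1.
    apply: cvg_EFin; first by apply: nearW.
    rewrite !expr2; apply: cvgM; apply: cvgB => //; try exact: cvg_cst; exact: cv.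
  apply: le_trans (fatou mu measurableT mF (fun k x _ => F0 k x)) _.
  rewrite limn_einf_lim; apply: lime_le; first exact: is_cvg_einfs.
  near=> k; apply: (@le_trans _ _ (\int[mu]_x F k x)%E).
    by apply: ereal_inf_lbound; exists k => /=.
  have -> : (\int[mu]_x F k x = \int[mu]_x ((u (N k) x - u n x) ^+ 2)%:E)%E.
    apply: ge0_ae_eq_integral => //.
    - apply/measurable_EFinP; apply: measurable_funX; apply: measurable_funB => //.
        exact: (Lu _).1.
      exact: (Lu _).1.
    - by move=> x _; rewrite lee_fin sqr_ge0.
    - exists (~` A); split => //; first exact: measurableC.
      move=> x /= h Ax; apply: h => _.
      by rewrite /F /v indicE mem_set// mulr1 -sqrrN opprB.
  rewrite sqint_ipE ?lee_fin; last exact: (sqint_sub (Lu (N k)) (Lu n)).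
  by apply: H; near: k; exists n => // k /= nk; exact: (leq_trans nk (kN k)).
have Ll : sqint l.
  have [N1 N1P] := cu 1 ltr01.
  have h := fatou_bound N1 1 (fun m Nm => N1P m N1 Nm (leqnn _)).
  have Lf : sqint (fun x => u N1 x - l x).
    split; first by apply: measurable_funB => //; exact: (Lu _).1.
    by apply: le_lt_trans h _; exact: ltry.
  have := sqint_sub (Lu N1) Lf.
  by under eq_fun do rewrite subKr.
exists l => // e e0; have [N1 N1P] := cu e e0; exists N1 => n Nn.
rewrite -lee_fin -sqint_ipE; last exact: sqint_sub.
by apply: fatou_bound => m nm; apply: N1P => //; exact: leq_trans nm.
Unshelve. all: by end_near. Qed.

Theorem sqint_weak_compactness (u : nat -> T -> R) (M : R) :
  (forall n, sqint (u n)) -> (forall n, ip (u n) (u n) <= M) ->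
  exists sigma : nat -> nat, exists2 l, sqint l &
    (forall m n, (m < n)%N -> (sigma m < sigma n)%N) /\
    forall g, sqint g -> ip (u (sigma n)) g @[n --> \oo] --> ip l g.
Proof.
apply: (@weak_compactness R (T -> R) sqint ip) => //.
- exact: sqint0.
- by move=> a f g Lf Lg; exact: sqint_lin.
- by move=> f g _ _; exact: ipC.
- by move=> a f g h Lf Lg Lh; exact: ip_lin.
- by move=> f _; exact: ip_ge0.
- by move=> v Lv; exact: sqint_complete.
Qed.

End SquareIntegrable.

(** * Smooth functions and test functions *)

Section DifferentiabilityClass.
Context {R : realType} {V : normedModType R}.
Variable vs : set V.
Implicit Types (f g : V -> R) (n : nat).

(** Only derivatives along the directions in [vs] are required, so the same closure properties serve
    functions on the line, with [vs] equal to [[set 1]], and on the plane, with the two coordinate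
    directions; [smoothP] makes the link with [smooth]. *)
Fixpoint Cn n f : Prop := continuous f /\
  match n with
  | 0 => True
  | n'.+1 => forall v, vs v -> (forall z, derivable f z v) /\ Cn n' ('D_v f)
  end.

Lemma Cn_continuous n f : Cn n f -> continuous f.
Proof. by case: n => [|n] []. Qed.

Lemma CnS n f : Cn n.+1 f -> Cn n f.
Proof.
elim: n f => [|n IH] f /=; first by case.
move=> [cf H]; split=> // v /H[df [cdf H']]; split=> //.
by apply: IH; split.
Qed.

Lemma Cn_cst n (c : R) : Cn n (fun=> c).
Proof.
elim: n c => [|n IH] c /=; first by split=> // z; exact: cvg_cst.
split=> [z|v _]; first exact: cvg_cst.
split=> [z|]; first exact: derivable_cst.
rewrite (_ : 'D_v _ = fun=> 0); first exact: IH.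
by apply/funext => z; exact: derive_cst.
Qed.

Lemma CnD n f g : Cn n f -> Cn n g -> Cn n (fun z => f z + g z).
Proof.
elim: n f g => [|n IH] f g /= [cf Hf] [cg Hg].
  by split=> // z; apply: cvgD; [exact: cf|exact: cg].
split=> [z|v vv]; first by apply: cvgD; [exact: cf|exact: cg].
have [df Cf] := Hf _ vv; have [dg Cg] := Hg _ vv.
split=> [z|]; first exact: (derivableD (df z) (dg z)).
rewrite (_ : 'D_v _ = fun z => 'D_v f z + 'D_v g z); first exact: IH.
by apply/funext => z; exact: (deriveD (df z) (dg z)).
Qed.

Lemma CnM n f g : Cn n f -> Cn n g -> Cn n (fun z => f z * g z).
Proof.
elim: n f g => [|n IH] f g Hf Hg.
  by split=> // z; apply: cvgM; [exact: (Cn_continuous Hf)|exact: (Cn_continuous Hg)].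
split=> [z|v vv].
  by apply: cvgM; [exact: (Cn_continuous Hf)|exact: (Cn_continuous Hg)].
have [df Cf] := Hf.2 _ vv; have [dg Cg] := Hg.2 _ vv.
split=> [z|]; first exact: (derivableM (df z) (dg z)).
rewrite (_ : 'D_v _ = fun z => f z * 'D_v g z + g z * 'D_v f z).
  by apply: CnD; apply: IH => //; exact: CnS.
by apply/funext => z; exact: (deriveM (df z) (dg z)).
Qed.

Lemma CnV n f : (forall z, f z != 0) -> Cn n f -> Cn n (fun z => (f z)^-1).
Proof.
move=> f0; elim: n => [|n IH] Hf.
  by split=> // z; apply: cvgV => //; exact: (Cn_continuous Hf).
split=> [z|v vv]; first by apply: cvgV => //; exact: (Cn_continuous Hf).
have [df Cf] := Hf.2 _ vv.
split=> [z|]; first exact: derivableV.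
rewrite (_ : 'D_v _ = fun z => -1 * ((f z)^-1 * (f z)^-1 * 'D_v f z)); last first.
  by apply/funext => z; rewrite deriveV// -exprVn expr2 scaleNr mulN1r.
apply: CnM; first exact: Cn_cst.
by do 2 apply: CnM => //; apply: IH; exact: CnS.
Qed.

End DifferentiabilityClass.

Section Composition.
Context {R : realType}.

Lemma is_derive_direction (a : R -> R) (x c da : R) :
  is_derive x 1 a da -> is_derive x c a (c * da).
Proof.
move=> [dax <-]; have dfx : differentiable a x by exact/derivable1_diffP.
apply: DeriveDef; first exact: diff_derivable.
by rewrite !deriveE// -[c in LHS]mulr1 -[_ * 1]/(c *: 1) linearZ.
Qed.

(** Along [h *: v] the affine map [p] moves by [h * l v], so the difference quotient of [a \o p] in
    the direction [v] is that of [a] in the direction [l v]. *)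
Lemma is_derive_comp_affine {V : normedModType R} (a : R -> R) (p l : V -> R)
    (z v : V) (da : R) : (forall h v z, p (h *: v + z) = h * l v + p z) ->
  is_derive (p z) 1 a da -> is_derive z v (a \o p) (l v * da).
Proof.
move=> pl /(is_derive_direction (l v))[h1 h2].
have E : (fun h : R => h^-1 *: (((a \o p) \o shift z) (h *: v) - (a \o p) z)) =
    (fun h => h^-1 *: ((a \o shift (p z)) (h *: l v) - a (p z))).
  by apply/funext => h /=; rewrite pl.
by apply: DeriveDef; [rewrite /derivable E|rewrite /derive E].
Qed.

Lemma Cn_comp_affine {V : normedModType R} (vs : set V) n (a : R -> R)
    (p l : V -> R) : continuous p -> (forall h v z, p (h *: v + z) = h * l v + p z) ->
  Cn [set (1 : R)] n a -> Cn vs n (a \o p).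
Proof.
move=> cp pl; elim: n a => [|n IH] a Ca.
  by split=> // z; apply: continuous_comp; [exact: cp|exact: (Cn_continuous Ca)].
split=> [z|v vv].
  by apply: continuous_comp; [exact: cp|exact: (Cn_continuous Ca)].
have [da Cda] := Ca.2 (1 : R) erefl.
have H z : is_derive z v (a \o p) (l v * 'D_1 a (p z)).
  by apply: is_derive_comp_affine => //; exact: DeriveDef.
split=> [z|]; first by case: (H z).
rewrite (_ : 'D_v _ = fun z => l v * ('D_1 a \o p) z).
  by apply: CnM; [exact: Cn_cst|exact: IH].
by apply/funext => z; case: (H z).
Qed.

(** Concatenation of words makes every iterated derivative of a smooth function smooth, which gives
    the induction on [n]. Conversely a word of length [m] costs [m] orders, and one more order
    yields the partial derivatives of the result. *)
Lemma smoothP (phi : R * R -> R) :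
  smooth phi <-> forall n, Cn [set ((1, 0) : R * R); ((0, 1) : R * R)] n phi.
Proof.
split=> [H n|H w].
  have {}H w : smooth (iter_partial w phi).
    move=> w'; have -> : iter_partial w' (iter_partial w phi) = iter_partial (w' ++ w) phi.
      by rewrite /iter_partial foldr_cat.
    exact: H.
  have G psi : smooth psi -> Cn [set ((1, 0) : R * R); ((0, 1) : R * R)] n psi.
    elim: n psi => [|n IH] psi Hp; first by split=> //; exact: (Hp [::]).1.
    split=> [|v]; first exact: (Hp [::]).1.
    have Hs b : smooth (iter_partial [:: b] psi).
      move=> w'; have -> : iter_partial w' (iter_partial [:: b] psi) = iter_partial (rcons w' b) psi.
        by rewrite /iter_partial foldr_rcons.
      exact: Hp.
    case=> ->; split.
    - by move=> z; exact: ((Hp [::]).2 z).1.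
    - exact: IH (Hs true).
    - by move=> z; exact: ((Hp [::]).2 z).2.
    - exact: IH (Hs false).
  exact: (G _ (H [::])).
have : Cn [set ((1, 0) : R * R); ((0, 1) : R * R)] 1 (iter_partial w phi).
  rewrite -(add0n 1%N); elim: w 1%N H => [|b w IH] k H; first exact: H.
  have [_ h] := IH k.+1 H.
  by case: b; [apply: (h _ _).2; left|apply: (h _ _).2; right].
move=> [c h]; split=> // z.
by split; [apply: (h _ _).1; left|apply: (h _ _).1; right].
Qed.

End Composition.

(** * A smooth step function *)

Section SmoothStep.
Context {R : realType}.

(* The derivatives of [expR (- x^-1)] extended by [0] are combinations of these. *)
Definition flat (k : nat) (x : R) : R :=
  if 0 < x then x ^- k * expR (- x^-1) else 0.

(** In the exponential series of [x^-1] the term of order [k + 2] absorbs [x ^- k] and leaves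
    [x ^+ 2]. A quadratic bound makes the difference quotient at [0] vanish. *)
Lemma flat_le k x : 0 <= flat k x <= (k.+2)`!%:R * x ^+ 2.
Proof.
rewrite /flat; case: ifPn => x0; last by rewrite lexx mulr_ge0// sqr_ge0.
rewrite mulr_ge0 ?expR_ge0 ?invr_ge0 ?exprn_ge0 ?(ltW x0)//=.
have := @expR_ge1Dxn R x^-1 k.+1; rewrite invr_ge0 (ltW x0) => /(_ isT) h.
have e0 := expR_gt0 x^-1.
rewrite expRN ler_pdivrMr// mulrC.
have : x^-1 ^+ k.+2 / k.+2`!%:R <= expR x^-1 by apply: le_trans h; rewrite lerDr.
rewrite ler_pdivrMr ?ltr0n ?fact_gt0// => h'.
have -> : x ^- k = x^-1 ^+ k.+2 * x ^+ 2.
  by rewrite -addn2 exprD -exprVn -mulrA -exprMn mulVf ?gt_eqF// expr1n mulr1.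
by rewrite [leRHS]mulrA; apply: ler_wpM2r => //; exact: sqr_ge0.
Qed.

(** The span of the functions [flat k] is closed under derivation, which is why the powers [x ^- k]
    are carried along; smoothness then follows by induction. *)
Lemma is_derive_flat (k : nat) (x : R) : is_derive x (1 : R) (flat k) (- k%:R * flat k.+1 x + flat k.+2 x).
Proof.
have [x0|x0|x0] := ltgtP 0 x.
- apply: (@near_eq_is_derive R R R (fun y : R => y ^- k * expR (- y^-1)) (flat k) x 1).
    by near=> y; rewrite /flat ifT//; near: y; exact: lt_nbhsr.
  rewrite /flat x0.
  have dV : is_derive x 1 (fun y : R => y^-1) (- x ^- 2).
    have [di diE] := is_derive_id x (1 : R).
    have xn : id x != 0 by rewrite gt_eqF.
    apply: DeriveDef; first exact: (derivableV xn di).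
    by rewrite (deriveV xn di) diE; exact: mulr1.
  have dE : is_derive x 1 (expR \o (fun y : R => - y^-1)) (expR (- x^-1) * x ^- 2).
    apply: is_derive1_comp; rewrite -[x ^- 2]opprK.
    exact: (is_deriveN dV).
  have dP : is_derive x 1 (fun y : R => y ^- k) (- k%:R * x ^- k.+1).
    elim: k => [|k IH].
      under eq_fun do rewrite expr0 invr1.
      by rewrite oppr0 mul0r; exact: is_derive_cst.
    have := is_deriveM IH dV.
    have -> : (fun y : R => y ^- k) * (fun y => y^-1) = (fun y : R => y ^- k.+1).
      by apply/funext => y; rewrite /= exprSr invfM.
    move=> H; apply: (is_derive_eq H); clear H.
    change (x ^- k * (- x ^- 2) + x^-1 * (- k%:R * x ^- k.+1) = - k.+1%:R * x ^- k.+2).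
    rewrite !exprS expr0 -natr1.
    by field; rewrite expf_neq0 gt_eqF.
  apply: (is_derive_eq (is_deriveM dP dE)).
  change (x ^- k * (expR (- x^-1) * x ^- 2) + expR (- x^-1) * (- k%:R * x ^- k.+1) =
    - k%:R * (x ^- k.+1 * expR (- x^-1)) + x ^- k.+2 * expR (- x^-1)).
  rewrite !exprS expr0.
  by field; rewrite expf_neq0 gt_eqF.
- apply: (@near_eq_is_derive R R R (fun=> 0) (flat k) x 1).
    by near=> y; rewrite /flat ifF//; apply/negbTE; rewrite -leNgt ltW//; near: y; exact: lt_nbhsl.
  rewrite /flat ifF; last by apply/negbTE; rewrite -leNgt ltW.
  rewrite ifF; last by apply/negbTE; rewrite -leNgt ltW.
  by rewrite mulr0 addr0; exact: is_derive_cst.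
- have f0 j : flat j 0 = 0 by rewrite /flat ltxx.
  rewrite -x0 !f0 mulr0 addr0.
  set q := fun h : R => h^-1 *: ((flat k \o shift 0) (h *: 1) - flat k 0).
  suff q0 : q h @[h --> 0^'] --> 0 by apply: DeriveDef; [exact: cvgP q0|exact: cvg_lim q0].
  pose M : R := (k.+2)`!%:R.
  have M0 : 0 < M by rewrite ltr0n fact_gt0.
  apply/cvgr0Pnorm_le => e e0; near=> h.
  have h0 : h != 0 by near: h; exact: nbhs_dnbhs_neq.
  have hN : 0 < `|h| by rewrite normr_gt0.
  rewrite /q f0 subr0 /= addr0 [h *: 1]mulr1 [_ *: _]/(_ * _) normrM normfV.
  rewrite mulrC ler_pdivrMr//.
  have /andP[a1 a2] := flat_le k h; rewrite ger0_norm//.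
  apply: le_trans a2 _; rewrite -/M -real_normK ?num_real// expr2 mulrA ler_pM2r//.
  rewrite mulrC -ler_pdivlMr//.
  near: h; apply: dnbhs0_le; exact: divr_gt0.
Unshelve. all: by end_near. Qed.

Lemma Cn_flat n k : Cn [set (1:R)] n (flat k).
Proof.
have cf j : continuous (flat j).
  move=> x; apply/differentiable_continuous/derivable1_diffP.
  by case: (is_derive_flat j x).
elim: n k => [|n IH] k; first by split.
split=> // _ ->; split=> [z|]; first by case: (is_derive_flat k z).
rewrite (_ : 'D_(1 : R) _ = fun x : R => - k%:R * flat k.+1 x + flat k.+2 x).
  by apply: CnD => //; apply: CnM => //; exact: Cn_cst.
by apply/funext => z; case: (is_derive_flat k z).
Qed.

(** The standard smooth transition from [0] on the left of [-1] to [1] on the right of [1]; the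
    denominator is positive since [1 + x] and [1 - x] are never both nonpositive. *)
Definition step (x : R) : R :=
  flat 0 (1 + x) * (flat 0 (1 + x) + flat 0 (1 - x))^-1.

Let flat_gt0 k (x : R) : 0 < x -> 0 < flat k x.
Proof.
by move=> x0; rewrite /flat x0 mulr_gt0 ?expR_gt0// invr_gt0 exprn_gt0.
Qed.

Let den_gt0 (x : R) : 0 < flat 0 (1 + x) + flat 0 (1 - x).
Proof.
have a j y : 0 <= flat j y by case/andP: (flat_le j y).
have [x0|x0] := ltP 0 (1 + x).
  by apply: ltr_wpDr => //; exact: flat_gt0.
by apply: ltr_wpDl => //; apply: flat_gt0; lra.
Qed.

Lemma step0 x : x <= -1 -> step x = 0.
Proof.
move=> x1; rewrite /step {1}/flat ifF ?mul0r//.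
by apply/negbTE; rewrite -leNgt; lra.
Qed.

Lemma step1 x : 1 <= x -> step x = 1.
Proof.
move=> x1; rewrite /step [flat 0 (1 - x)]/flat ifF ?addr0 ?divff//.
  by apply/lt0r_neq0/flat_gt0; lra.
by apply/negbTE; rewrite -leNgt; lra.
Qed.

Let flat_homo : {homo flat 0 : x y / x <= y}.
Proof.
move=> x y xy; rewrite /flat; case: ifPn => x0; last first.
  by case: ifPn => y0 //; rewrite expr0 invr1 mul1r expR_ge0.
rewrite (lt_le_trans x0 xy) !expr0 invr1 !mul1r ler_expR lerN2 lef_pV2//.
exact: lt_le_trans xy.
Qed.

Lemma step_homo : {homo step : x y / x <= y}.
Proof.
move=> x y xy; rewrite /step.
have a : flat 0 (1 + x) <= flat 0 (1 + y) by apply: flat_homo; lra.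
have b : flat 0 (1 - y) <= flat 0 (1 - x) by apply: flat_homo; lra.
have a0 : 0 <= flat 0 (1 + x) by case/andP: (flat_le 0 (1 + x)).
have b0 : 0 <= flat 0 (1 - y) by case/andP: (flat_le 0 (1 - y)).
rewrite ler_pdivrMr ?den_gt0// mulrAC ler_pdivlMr ?den_gt0//.
by nra.
Qed.

Lemma step_ge0 x : 0 <= step x.
Proof.
have [x1|x1] := leP x (-1); first by rewrite step0.
by rewrite -(step0 (lexx (-1))); apply: step_homo; exact: ltW.
Qed.

Lemma step_le1 x : step x <= 1.
Proof.
have [x1|x1] := leP 1 x; first by rewrite step1.
by rewrite -(step1 (lexx 1)); apply: step_homo; exact: ltW.
Qed.

Lemma Cn_step n : Cn [set (1 : R)] n step.
Proof.
have C1 : Cn [set (1 : R)] n (fun x => flat 0 (1 + x)).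
  apply: (@Cn_comp_affine R R [set (1 : R)] n (flat 0) (fun x => 1 + x) id); last exact: Cn_flat.
    by move=> x; apply: cvgD; [exact: cvg_cst|exact: cvg_id].
  by move=> h v z; change (1 + (h * v + z) = h * v + (1 + z)); ring.
have C2 : Cn [set (1 : R)] n (fun x => flat 0 (1 - x)).
  apply: (@Cn_comp_affine R R [set (1 : R)] n (flat 0) (fun x => 1 - x) -%R); last exact: Cn_flat.
    by move=> x; apply: cvgB; [exact: cvg_cst|exact: cvg_id].
  by move=> h v z; change (1 - (h * v + z) = h * - v + (1 - z)); ring.
apply: CnM => //; apply: CnV; last exact: CnD.
by move=> x; rewrite gt_eqF.
Qed.

End SmoothStep.

(** * Test functions: supports, Lipschitz and Taylor bounds *)

Section TestFunctions.
Context {R : realType}.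
Implicit Types (phi : R * R -> R) (D : set (R * R)).

Lemma continuous_fst_plane : continuous (fst : R * R -> R).
Proof. by move=> z; exact: cvg_fst. Qed.

Lemma continuous_snd_plane : continuous (snd : R * R -> R).
Proof. by move=> z; exact: cvg_snd. Qed.

Lemma fst_affine (h : R) (v z : R * R) : (h *: v + z).1 = h * v.1 + z.1.
Proof. by []. Qed.

Lemma snd_affine (h : R) (v z : R * R) : (h *: v + z).2 = h * v.2 + z.2.
Proof. by []. Qed.

Lemma smooth_tensor (a b : R -> R) :
  (forall n, Cn [set (1 : R)] n a) -> (forall n, Cn [set (1 : R)] n b) ->
  smooth (fun z : R * R => a z.1 * b z.2).
Proof.
move=> Ca Cb; apply/smoothP => n; apply: CnM.
  exact: (Cn_comp_affine _ continuous_fst_plane fst_affine (Ca n)).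
exact: (Cn_comp_affine _ continuous_snd_plane snd_affine (Cb n)).
Qed.

Lemma is_derive_tensor (a b : R -> R) (z v : R * R) (da db : R) :
  is_derive z.1 1 a da -> is_derive z.2 1 b db ->
  is_derive z v (fun z : R * R => a z.1 * b z.2)
    (v.1 * (da * b z.2) + v.2 * (a z.1 * db)).
Proof.
move=> Da Db.
apply: (is_derive_eq (is_deriveM (is_derive_comp_affine v fst_affine Da)
  (is_derive_comp_affine v snd_affine Db))).
change (a z.1 * (v.2 * db) + b z.2 * (v.1 * da) =
  v.1 * (da * b z.2) + v.2 * (a z.1 * db)).
by ring.
Qed.

Lemma smooth_dx phi : smooth phi -> smooth (dx phi).
Proof.
move=> H w; have -> : iter_partial w (dx phi) = iter_partial (rcons w true) phi.
  by rewrite /iter_partial foldr_rcons.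
exact: H.
Qed.

Lemma smooth_dy phi : smooth phi -> smooth (dy phi).
Proof.
move=> H w; have -> : iter_partial w (dy phi) = iter_partial (rcons w false) phi.
  by rewrite /iter_partial foldr_rcons.
exact: H.
Qed.

Lemma smooth_continuous phi : smooth phi -> continuous phi.
Proof. by move=> H; exact: (H [::]).1. Qed.

Lemma smooth_is_derive_dx phi z : smooth phi ->
  is_derive z ((1, 0) : R * R) phi (dx phi z).
Proof. by move=> H; exact: (DeriveDef ((H [::]).2 z).1). Qed.

Lemma smooth_is_derive_dy phi z : smooth phi ->
  is_derive z ((0, 1) : R * R) phi (dy phi z).
Proof. by move=> H; exact: (DeriveDef ((H [::]).2 z).2). Qed.

Lemma derive_supp phi v :
  [set z | 'D_v phi z != 0] `<=` closure [set z | phi z != 0].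
Proof.
move=> z Dz; apply: contrapT => nz; move/eqP: Dz; apply.
rewrite -(derive_cst (0 : R) z v); apply: near_eq_derive.
have : open (~` closure [set z | phi z != 0]) by apply: closed_openC; exact: closed_closure.
rewrite openE => /(_ z nz); apply: filterS => y ny.
by apply/eqP; apply: contrapT => /negP h; apply: ny; exact: subset_closure.
Qed.

Let test_sub D phi psi : test_function D phi -> smooth psi ->
  [set z | psi z != 0] `<=` closure [set z | phi z != 0] -> test_function D psi.
Proof.
move=> [sp cp pD] sp' pp.
have h : closure [set z | psi z != 0] `<=` closure [set z | phi z != 0].
  by rewrite closureE => z; apply; split => //; exact: closed_closure.
split=> //; last exact: subset_trans pD.
by apply: subclosed_compact h => //; exact: closed_closure.
Qed.

Lemma test_dx D phi : test_function D phi -> test_function D (dx phi).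
Proof.
move=> T; apply: (test_sub T); first by apply: smooth_dx; case: T.
exact: derive_supp.
Qed.

Lemma test_dy D phi : test_function D phi -> test_function D (dy phi).
Proof.
move=> T; apply: (test_sub T); first by apply: smooth_dy; case: T.
exact: derive_supp.
Qed.

Lemma testM D phi psi : test_function D phi -> smooth psi ->
  test_function D (fun z => phi z * psi z).
Proof.
move=> T sp; apply: (test_sub T).
  have sphi : smooth phi by case: T.
  by apply/smoothP => n; exact: CnM ((smoothP phi).1 sphi n) ((smoothP psi).1 sp n).
move=> z /=; rewrite mulf_eq0 negb_or => /andP[h _].
exact: subset_closure.
Qed.

Lemma testS D D' phi : D `<=` D' -> test_function D phi -> test_function D' phi.
Proof. by move=> DD [sp cp pD]; split => //; exact: subset_trans DD. Qed.

Lemma test_supp D phi z : test_function D phi -> ~ D z -> phi z = 0.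
Proof.
move=> [_ _ pD] nz; apply/eqP; apply: contrapT => /negP h; apply: nz.
by apply: pD; exact: subset_closure.
Qed.

Lemma test_bounded D phi : test_function D phi ->
  exists2 C, 0 <= C & forall z, `|phi z| <= C.
Proof.
move=> [sp cp _].
have cK : compact (phi @` closure [set z | phi z != 0]).
  by apply: continuous_compact => //; exact: continuous_subspaceT (smooth_continuous sp).
have [M [_ MP]] := compact_bounded cK.
exists (`|M| + 1) => [|z]; first exact: addr_ge0.
have [/eqP->|z0] := boolP (phi z == 0); first by rewrite normr0 addr_ge0.
apply: (MP (`|M| + 1)).
  by apply: le_lt_trans (ler_norm _) _; rewrite ltrDl.
by exists z => //; exact: subset_closure.
Qed.

Lemma is_derive_line phi (z v : R * R) (t d : R) :
  is_derive (z + t *: v) v phi d -> is_derive t 1 (fun s => phi (z + s *: v)) d.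
Proof.
move=> [h1 h2].
have E : (fun h : R => h^-1 *: (((fun s => phi (z + s *: v)) \o shift t) (h *: 1) - phi (z + t *: v))) =
    (fun h => h^-1 *: ((phi \o shift (z + t *: v)) (h *: v) - phi (z + t *: v))).
  apply/funext => h /=; congr (_ *: (phi _ - _)).
  by rewrite [h *: 1]mulr1 scalerDl addrCA.
by apply: DeriveDef; [rewrite /derivable E|rewrite /derive E].
Qed.

Lemma derive_lip (g dg : R -> R) (C s t : R) : (forall x : R, is_derive x (1 : R) g (dg x)) ->
  (forall x, `|dg x| <= C) -> `|g t - g s| <= C * `|t - s|.
Proof.
move=> Dg dgC.
have cg : continuous g.
  by move=> x; apply/differentiable_continuous/derivable1_diffP; case: (Dg x).
have H a b : a < b -> `|g b - g a| <= C * `|b - a|.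
  move=> ab; have [|c _ ->] := @MVT R g dg a b ab (fun x _ => Dg x).
    exact: continuous_subspaceT.
  by rewrite normrM ler_wpM2r.
have [st|st|->] := ltgtP s t; first exact: H.
  by rewrite distrC (distrC t); exact: H.
by rewrite !subrr normr0 mulr0.
Qed.

(** The increment is split into a horizontal and a vertical move, each controlled by a bounded
    partial derivative. *)
Lemma test_lip phi : test_function setT phi ->
  exists2 C, 0 <= C & forall z u, `|phi (z + u) - phi z| <= C * (`|u.1| + `|u.2|).
Proof.
move=> T; have sp : smooth phi by case: T.
have [C1 C10 h1] := test_bounded (test_dx T).
have [C2 C20 h2] := test_bounded (test_dy T).
exists (C1 + C2) => [|z u]; first exact: addr_ge0.
have A w t : `|phi (w + t *: (1, 0)) - phi w| <= C1 * `|t|.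
  pose g s := phi (w + s *: (1, 0)).
  have Dg s : is_derive s (1 : R) g (dx phi (w + s *: (1, 0))).
    exact: (is_derive_line (smooth_is_derive_dx _ sp)).
  have := derive_lip 0 t Dg (fun s => h1 _).
  by rewrite /g scale0r addr0 subr0.
have B w t : `|phi (w + t *: (0, 1)) - phi w| <= C2 * `|t|.
  pose g s := phi (w + s *: (0, 1)).
  have Dg s : is_derive s (1 : R) g (dy phi (w + s *: (0, 1))).
    exact: (is_derive_line (smooth_is_derive_dy _ sp)).
  have := derive_lip 0 t Dg (fun s => h2 _).
  by rewrite /g scale0r addr0 subr0.
have -> : phi (z + u) - phi z =
    (phi (z + u.1 *: (1, 0) + u.2 *: (0, 1)) - phi (z + u.1 *: (1, 0))) +
    (phi (z + u.1 *: (1, 0)) - phi z).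
  rewrite (_ : z + u.1 *: (1, 0) + u.2 *: (0, 1) = z + u); first by ring.
  case: z u => [z1 z2] [u1 u2]; congr pair.
    by change (z1 + u1 * 1 + u2 * 0 = z1 + u1); ring.
  by change (z2 + u1 * 0 + u2 * 1 = z2 + u2); ring.
apply: le_trans (ler_normD _ _) _.
have := A z u.1; have := B (z + u.1 *: (1, 0)) u.2.
have := normr_ge0 u.1; have := normr_ge0 u.2; nra.
Qed.

(** By the mean value theorem the increment is [t] times the value of [dphi] at an intermediate
    point, which differs from [dphi z] by at most [C] times the modulus of [t]. *)
Lemma derive_taylor (phi dphi : R * R -> R) (v : R * R) :
  (forall z, is_derive z v phi (dphi z)) ->
  (exists2 C, 0 <= C & forall z (t : R), `|dphi (z + t *: v) - dphi z| <= C * `|t|) ->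
  exists2 C, 0 <= C & forall z (t : R),
    `|phi (z + t *: v) - phi z - t * dphi z| <= C * t ^+ 2.
Proof.
move=> Dphi [C C0 HC]; exists C => // z t.
pose g s := phi (z + s *: v); pose dg s := dphi (z + s *: v).
have Dg (s : R) : is_derive s (1 : R) g (dg s) by exact: is_derive_line.
have cg : continuous g.
  by move=> x; apply/differentiable_continuous/derivable1_diffP; case: (Dg x).
have [c ct E] : exists2 c, `|c| <= `|t| & g t - g 0 = dg c * t.
  have cw a b : {within `[a, b], continuous g} by exact: continuous_subspaceT.
  have [t0|t0|<-] := ltgtP 0 t; last by exists 0; rewrite ?subrr ?mulr0.
  - have [c] := MVT t0 (fun x _ => Dg x) (cw _ _).
    rewrite in_itv/= => /andP[c0 ct] E; exists c; last by rewrite E subr0.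
    by rewrite !gtr0_norm// ltW.
  - have [c] := MVT t0 (fun x _ => Dg x) (cw _ _).
    rewrite in_itv/= => /andP[c0 ct] E; exists c.
      by rewrite !ltr0_norm// lerN2 ltW.
    by rewrite -[LHS]opprB E; ring.
have -> : phi (z + t *: v) - phi z - t * dphi z = (dg c - dphi z) * t.
  have -> : phi (z + t *: v) - phi z = g t - g 0 by rewrite /g scale0r addr0.
  by rewrite E; ring.
rewrite normrM -real_normK ?num_real// expr2 mulrA ler_wpM2r//.
by apply: le_trans (HC _ _) _; rewrite ler_wpM2l.
Qed.

Lemma test_taylor_dx phi : test_function setT phi ->
  exists2 C, 0 <= C & forall z (t : R),
    `|phi (z + t *: (1, 0)) - phi z - t * dx phi z| <= C * t ^+ 2.
Proof.
move=> T; apply: derive_taylor.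
  by move=> z; apply: smooth_is_derive_dx; case: T.
have [C C0 HC] := test_lip (test_dx T); exists C => // z t.
by apply: le_trans (HC _ _) _; rewrite /= [t *: 1]mulr1 [t *: 0]mulr0 normr0 addr0.
Qed.

Lemma test_taylor_dy phi : test_function setT phi ->
  exists2 C, 0 <= C & forall z (t : R),
    `|phi (z + t *: (0, 1)) - phi z - t * dy phi z| <= C * t ^+ 2.
Proof.
move=> T; apply: derive_taylor.
  by move=> z; apply: smooth_is_derive_dy; case: T.
have [C C0 HC] := test_lip (test_dy T); exists C => // z t.
by apply: le_trans (HC _ _) _; rewrite /= [t *: 1]mulr1 [t *: 0]mulr0 normr0 add0r.
Qed.

End TestFunctions.

(** * Cocycles on simply connected sets *)

Section Clamp.
Context {R : realType}.

(** The retraction of the line onto the unit interval, written with absolute values so that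
    continuity is immediate. Composition with it extends paths and homotopies given on the unit
    interval or square. *)
Definition clamp (t : R) : R := (1 + `|t| - `|t - 1|) / 2.

Lemma clamp_id t : 0 <= t <= 1 -> clamp t = t.
Proof.
move=> /andP[t0 t1]; rewrite /clamp ger0_norm// ler0_norm; last by lra.
by field.
Qed.

Lemma clamp_le0 t : t <= 0 -> clamp t = 0.
Proof. by move=> t0; rewrite /clamp !ler0_norm//; [field|lra]. Qed.

Lemma clamp_ge1 t : 1 <= t -> clamp t = 1.
Proof. by move=> t1; rewrite /clamp !ger0_norm//; [field|lra|lra]. Qed.

Lemma clamp_itv t : clamp t \in `[0, 1].
Proof.
have [t0|t0] := leP t 0; first by rewrite clamp_le0// in_itv/= lexx ler01.
have [t1|t1] := leP 1 t; first by rewrite clamp_ge1// in_itv/= lexx ler01.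
by rewrite clamp_id ?in_itv/=; rewrite (ltW t0) (ltW t1).
Qed.

Lemma continuous_clamp : continuous clamp.
Proof.
move=> t; have cN (a : R) : `|x - a| @[x --> t] --> `|t - a|.
  have h : x - a @[x --> t] --> t - a by apply: cvgB; [exact: cvg_id|exact: cvg_cst].
  exact: cvg_norm h.
rewrite /clamp; apply: cvgMl; apply: cvgB; last exact: cN.
apply: cvgD; first exact: cvg_cst.
by have := cN 0; rewrite subr0; under eq_fun do rewrite subr0.
Qed.

Lemma continuous_comp_within {X Y Z : topologicalType} (A : set Y) (f : Y -> Z)
    (g : X -> Y) : {within A, continuous f} -> continuous g ->
  (forall x, A (g x)) -> continuous (f \o g).
Proof.
move=> /subspace_continuousP cf cg Ag x W /= /(cf _ (Ag x)).
rewrite /within/= => H; have {}H : nbhs x (fun y => A (g y) -> W (f (g y))) by exact: (cg x _ H).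
by apply: filterS H => y /(_ (Ag y)).
Qed.

(** Compactness in its near-covering form, applied to the radius [e] tending to [0] from the right:
    around each point the radius of continuity is halved, so that nearby points share the same ball
    in [U]. *)
Lemma lebesgue_number {X Y : pseudoMetricType R} (f : X -> Y) (K : set X)
    (U : set Y) : compact K -> continuous f -> open U -> (forall x, K x -> U (f x)) ->
  exists2 e : R, 0 < e & forall x, K x ->
    exists y r, ball y r `<=` U /\ forall x', ball x e x' -> ball y r (f x').
Proof.
move=> /compact_near_coveringP cK cf oU fU.
pose P (e : R) x := exists y (r : R), ball y r `<=` U /\ forall x', ball x e x' -> ball y r (f x').
have H : \forall e \near 0^'+, K `<=` P e.
  apply: cK => x Kx.
  have /nbhs_ballP[r /= r0 rU] : nbhs (f x) U by apply: open_nbhs_nbhs; split => //; exact: fU.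
  have /nbhs_ballP[e /= e0 eP] : nbhs x (f @^-1` ball (f x) r) by apply: cf; exact: nbhsx_ballx.
  exists (ball x (e / 2), [set e' | e' < e / 2]) => /=.
    split; first by apply: nbhsx_ballx; rewrite divr_gt0.
    by apply: nbhs_right_lt; rewrite divr_gt0.
  move=> [x' e'] /= [xx' e'e]; exists (f x), r; split=> // x'' h.
  apply: eP; rewrite [e]splitr; apply: ball_triangle xx' _.
  by apply: le_ball h; exact: ltW.
have [e [h1 h2]] : exists e : R, (K `<=` P e) /\ 0 < e.
  by apply: (@filter_ex _ (0^'+ : set_system R)); apply: filterI => //; exact: nbhs_right_gt.
by exists e.
Qed.

End Clamp.

Section Cocycle.
Context {R : realType} {T : Type} (F : set_system T) {FF : ProperFilter F}.
Variables (Omega : set (R * R)) (J : R * R -> R * R -> T -> R).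
Hypothesis Omega_open : open Omega.
Hypothesis J_add : forall y r, ball y r `<=` Omega ->
  forall a b c, ball y r a -> ball y r b -> ball y r c ->
  \forall t \near F, J a b t + J b c t = J a c t.

Lemma nearS (P Q : T -> Prop) : (\forall t \near F, P t) ->
  (forall t, P t -> Q t) -> \forall t \near F, Q t.
Proof. by move=> FP PQ; exact: (@filterS _ F _ P Q PQ FP). Qed.

Lemma nearS2 (P P' Q : T -> Prop) : (\forall t \near F, P t) ->
  (\forall t \near F, P' t) ->
  (forall t, P t -> P' t -> Q t) -> \forall t \near F, Q t.
Proof. by move=> FP FP' PQ; exact: (@filterS2 _ F _ P P' Q PQ FP FP'). Qed.

Lemma near_forall_ltn (P : nat -> T -> Prop) n :
  (forall k, (k < n)%N -> \forall t \near F, P k t) ->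
  \forall t \near F, forall k, (k < n)%N -> P k t.
Proof.
move=> H; have FF' : Filter F by typeclasses eauto.
have G := @filter_forall T 'I_n (fun i => P i) F FF' (fun i => H i (ltn_ord i)).
by apply: (nearS G) => t h k kn; exact: (h (Ordinal kn)).
Qed.

Lemma cocycle_refl a : Omega a -> \forall t \near F, J a a t = 0.
Proof.
move=> Oa; have /nbhs_ballP[r /= r0 rO] : nbhs a Omega by exact: open_nbhs_nbhs.
have aa : ball a r a by exact: ballxx.
by apply: (nearS (J_add rO aa aa aa)) => t; lra.
Qed.

Lemma cocycle_sym y r a b : ball y r `<=` Omega -> ball y r a -> ball y r b ->
  \forall t \near F, J b a t = - J a b t.
Proof.
move=> yr ya yb.
by apply: (nearS2 (J_add yr ya yb ya) (cocycle_refl (yr _ ya))) => t; lra.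
Qed.

Lemma cocycle_telescope y r (p : nat -> R * R) n : ball y r `<=` Omega ->
  (forall k, (k <= n)%N -> ball y r (p k)) ->
  \forall t \near F, \sum_(0 <= k < n) J (p k) (p k.+1) t = J (p 0%N) (p n) t.
Proof.
move=> yr; elim: n => [|n IH] yp.
  by apply: (nearS (cocycle_refl (yr _ (yp 0%N isT)))) => t ->; rewrite big_geq.
have h : forall k, (k <= n)%N -> ball y r (p k) by move=> k kn; apply: yp; exact: leqW.
apply: (nearS2 (IH h) (J_add yr (yp 0%N isT) (yp n (leqnSn _)) (yp n.+1 (leqnn _)))) => t e <-.
by rewrite big_nat_recr//= e.
Qed.

(** The ball has to contain the whole arc and not only its end points: subdivisions of a fine mesh
    then stay in the same balls. *)
Definition fine_mesh (c : R -> R * R) (N : nat) := (0 < N)%N /\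
  forall k, (k < N)%N -> exists y r, ball y r `<=` Omega /\
    forall s, k%:R / N%:R <= s <= k.+1%:R / N%:R -> ball y r (c s).

Definition mesh_sum (c : R -> R * R) (N : nat) (t : T) : R :=
  \sum_(0 <= k < N) J (c (k%:R / N%:R)) (c (k.+1%:R / N%:R)) t.

Lemma mesh_step_lt (e : R) (k N : nat) (s : R) : (0 < N)%N -> e^-1 < N%:R -> 0 < e ->
  k%:R / N%:R <= s <= k.+1%:R / N%:R -> ball (k%:R / N%:R : R) e s.
Proof.
move=> N0 eN e0 /andP[s1 s2]; rewrite /ball/= distrC ger0_norm ?subr_ge0//.
have NR : 0 < N%:R :> R by rewrite ltr0n.
apply: (@le_lt_trans _ _ N%:R^-1); last by rewrite -[e]invrK ltf_pV2// posrE invr_gt0.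
rewrite lerBlDl; apply: le_trans s2 _.
by rewrite -natr1 mulrDl mul1r.
Qed.

Lemma fine_mesh_near (c : R -> R * R) : continuous c -> (forall t, Omega (c t)) ->
  exists N0, forall N, (N0 <= N)%N -> (0 < N)%N -> fine_mesh c N.
Proof.
move=> cc cO.
have [e e0 eP] := @lebesgue_number R R (R * R)%type c _ Omega (@segment_compact R 0 1)
  cc Omega_open (fun t _ => cO t).
exists (Num.bound e^-1) => N bN N0; split=> // k kN.
have NR : 0 < N%:R :> R by rewrite ltr0n.
have [|y [r [yr h]]] := eP (k%:R / N%:R).
  rewrite /= in_itv/= divr_ge0//= ler_pdivrMr// mul1r ler_nat; exact: ltnW.
exists y, r; split=> // s hs; apply: h; apply: mesh_step_lt => //.
apply: lt_le_trans (archi_boundP _) _; first by rewrite invr_ge0 ltW.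
by rewrite ler_nat.
Qed.

(** Inside each ball the finer sum telescopes to the single increment of the coarser mesh. Meshes of
    different sizes can then be compared through a common multiple. *)
Lemma mesh_sum_refine (c : R -> R * R) (m N : nat) : (0 < m)%N -> fine_mesh c N ->
  \forall t \near F, mesh_sum c (N * m) t = mesh_sum c N t.
Proof.
move=> m0 [N0 fm].
have NR : 0 < N%:R :> R by rewrite ltr0n.
have mR : 0 < m%:R :> R by rewrite ltr0n.
have h k : (k < N)%N -> \forall t \near F,
    \sum_(0 <= j < m) J (c ((k * m + j)%N%:R / (N * m)%N%:R))
        (c ((k * m + j.+1)%N%:R / (N * m)%N%:R)) t =
    J (c (k%:R / N%:R)) (c (k.+1%:R / N%:R)) t.
  move=> kN; have [y [r [yr H]]] := fm k kN.
  have := @cocycle_telescope y r (fun j => c ((k * m + j)%N%:R / (N * m)%N%:R)) m yr.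
  rewrite /= addn0 -mulSnr !natrM -!mulf_div !divff ?gt_eqF// !mulr1; apply => j jm.
  apply: H; rewrite natrD natrM; apply/andP; split.
    by rewrite ler_pdivlMr ?mulr_gt0// mulrA divfK ?gt_eqF// lerDl.
  rewrite ler_pdivrMr ?mulr_gt0// mulrA divfK ?gt_eqF//.
  by rewrite -natr1 mulrDl mul1r lerD2l ler_nat.
apply: (nearS (near_forall_ltn h)) => t H.
rewrite /mesh_sum big_nat_mul; apply: eq_big_nat => k /andP[_ kN].
rewrite -H// -{1}[(k * m)%N]add0n big_addn mulSn addnK.
by apply: eq_big_nat => j _; rewrite [(j + _)%N]addnC addnS.
Qed.

(** On a grid of the square, the cocycle takes the same value along the two ways around each small
    cell. Summed over a row, the terms between consecutive rows telescope to zero because the sides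
    of the homotopy are constant; so all rows have equal sums, and the last row is a constant
    path. *)
Lemma homotopy_mesh (H : R * R -> R * R) (p0 : R * R) : continuous H ->
  (forall z, Omega (H z)) -> (forall s, 0 <= s <= 1 -> H (s, 0) = p0 /\ H (s, 1) = p0) ->
  (forall t, 0 <= t <= 1 -> H (1, t) = p0) ->
  exists N0, forall N, (N0 <= N)%N -> (0 < N)%N ->
    \forall t \near F, mesh_sum (fun s => H (0, s)) N t = 0.
Proof.
move=> cH HO H01 H1.
have Op0 : Omega p0 by rewrite -(H01 0 _).1// lexx ler01.
have cK : compact ([set` `[0 : R, 1]] `*` [set` `[0 : R, 1]]).
  by apply: compact_setX; exact: segment_compact.
have [e e0 eP] := @lebesgue_number R (R * R)%type (R * R)%type H _ Omega cK cH Omega_open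
  (fun z _ => HO z).
exists (Num.bound e^-1) => N bN N0.
have NR : 0 < N%:R :> R by rewrite ltr0n.
have eN : e^-1 < N%:R.
  apply: lt_le_trans (archi_boundP _) _; first by rewrite invr_ge0 ltW.
  by rewrite ler_nat.
pose P i k := H (i%:R / N%:R, k%:R / N%:R).
have inI i : (i <= N)%N -> 0 <= (i%:R / N%:R : R) <= 1.
  by move=> iN; rewrite divr_ge0//= ler_pdivrMr// mul1r ler_nat.
have step_in i : i%:R / N%:R <= (i%:R / N%:R : R) <= i.+1%:R / N%:R.
  by rewrite lexx ler_pM2r ?invr_gt0// ler_nat leqnSn.
have step_in' i : i%:R / N%:R <= (i.+1%:R / N%:R : R) <= i.+1%:R / N%:R.
  by rewrite lexx ler_pM2r ?invr_gt0// ler_nat leqnSn.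
have cell i k : (i < N)%N -> (k < N)%N -> \forall t \near F,
    J (P i k) (P i k.+1) t + J (P i k.+1) (P i.+1 k.+1) t =
    J (P i k) (P i.+1 k) t + J (P i.+1 k) (P i.+1 k.+1) t.
  move=> iN kN.
  have [|y [r [yr h]]] := eP (i%:R / N%:R, k%:R / N%:R).
    by split; rewrite /= in_itv/= inI// ltnW.
  have a00 : ball y r (P i k).
    by apply: h; split; exact: (mesh_step_lt N0 eN e0 (step_in _)).
  have a01 : ball y r (P i k.+1).
    by apply: h; split; [exact: (mesh_step_lt N0 eN e0 (step_in _))|exact: (mesh_step_lt N0 eN e0 (step_in' _))].
  have a10 : ball y r (P i.+1 k).
    by apply: h; split; [exact: (mesh_step_lt N0 eN e0 (step_in' _))|exact: (mesh_step_lt N0 eN e0 (step_in _))].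
  have a11 : ball y r (P i.+1 k.+1).
    by apply: h; split; exact: (mesh_step_lt N0 eN e0 (step_in' _)).
  by apply: (nearS2 (J_add yr a00 a01 a11) (J_add yr a00 a10 a11)) => t -> ->.
have cells := near_forall_ltn (fun i iN => near_forall_ltn (fun k kN => cell i k iN kN)).
apply: (nearS2 cells (cocycle_refl Op0)) => t {}cell J00.
pose row i := \sum_(0 <= k < N) J (P i k) (P i k.+1) t.
have P0 i : (i <= N)%N -> P i 0%N = p0.
  by move=> iN; rewrite /P mul0r; have [] := H01 _ (inI _ iN).
have PN i : (i <= N)%N -> P i N = p0.
  by move=> iN; rewrite /P divff ?gt_eqF//; have [] := H01 _ (inI _ iN).
have rowS i : (i < N)%N -> row i = row i.+1.
  move=> iN; apply/eqP; rewrite -subr_eq0 -sumrB.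
  rewrite (@telescope_sumr_eq _ _ _ (fun k => - J (P i k) (P i.+1 k) t))//.
    by rewrite !P0 ?PN ?J00 ?subrr// ltnW.
  by move=> k /andP[_ kN]; have := cell i iN k kN; lra.
have rowE i : (i <= N)%N -> row i = row 0%N.
  by elim: i => // i IH iN; rewrite -rowS// IH// ltnW.
have -> : mesh_sum (fun s => H (0, s)) N t = row 0%N.
  by apply: eq_bigr => k _; rewrite /P mul0r.
rewrite -(rowE N (leqnn _)); apply: big1_seq => k; rewrite mem_index_iota => /andP[_ kN].
rewrite /P divff ?gt_eqF// !H1 ?inI//; exact: ltnW.
Qed.

Hypothesis Omega_sc : simply_connected Omega.

Lemma ball_segment (y a b : R * R) (r s : R) : ball y r a -> ball y r b ->
  0 <= s <= 1 -> ball y r (a + s *: (b - a)).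
Proof.
move=> /ball_planeE[a1 a2] /ball_planeE[b1 b2] /andP[s0 s1]; apply/ball_planeE.
have H (u v w : R) : `|u - w| < r -> `|v - w| < r -> `|u + s * (v - u) - w| < r.
  have -> : u + s * (v - u) - w = (u - w) + s * ((v - w) - (u - w)) by ring.
  move: (u - w) (v - w) => p q; rewrite !ltr_norml => /andP[? ?] /andP[? ?].
  have [pq|qp] := leP p q.
    have h1 : 0 <= s * (q - p) by rewrite mulr_ge0// subr_ge0.
    have h2 : 0 <= (1 - s) * (q - p) by rewrite mulr_ge0// subr_ge0.
    by apply/andP; split; lra.
  have h1 : 0 <= s * (p - q) by rewrite mulr_ge0// subr_ge0 ltW.
  have h2 : 0 <= (1 - s) * (p - q) by rewrite mulr_ge0// subr_ge0// ltW.
  by apply/andP; split; lra.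
by split; exact: H.
Qed.

(** [A q] is the sum of the cocycle along a chosen path from [p0] to [q]. For [a] and [b] in a
    common ball, the path to [a], the segment to [b] and the reversed path from [b] form a
    contractible loop, on which the sum vanishes. How far along [F] this holds depends on [a] and
    [b]. *)
Theorem cocycle_primitive (p0 : R * R) : Omega p0 ->
  exists A : R * R -> T -> R, forall y r, ball y r `<=` Omega ->
    forall a b, ball y r a -> ball y r b ->
    \forall t \near F, A b t - A a t = J a b t.
Proof.
move=> Op0; have [pc sc] := Omega_sc.
have /choice[c cP] q : exists c : R -> R * R, Omega q ->
    [/\ continuous c, forall t, Omega (c t), c 0 = p0 & c 1 = q].
  have [Oq|nOq] := pselect (Omega q); last by exists (fun=> p0).
  have [c [cc c0 c1 cO]] := pc _ _ Op0 Oq.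
  exists (c \o clamp) => _; split.
  - apply: (continuous_comp_within cc continuous_clamp) => x; exact: clamp_itv.
  - by move=> t; apply: cO; exact: clamp_itv.
  - by rewrite /= clamp_le0.
  - by rewrite /= clamp_ge1.
have /choice[N NP] q : exists N, Omega q -> fine_mesh (c q) N.
  have [Oq|nOq] := pselect (Omega q); last by exists 0%N.
  have [cc cO _ _] := cP q Oq; have [N0 h] := fine_mesh_near cc cO.
  by exists N0.+1 => _; apply: h.
exists (fun q => mesh_sum (c q) (N q)) => y r yr a b ya yb.
have [cca cOa ca0 ca1] := cP a (yr _ ya).
have [ccb cOb cb0 cb1] := cP b (yr _ yb).
(* The loop, one piece on each third of the unit interval, as a single continuous formula: outside
   its own third each clamped parameter is constant, and the end points [c a 1 = a] and [c b 1 = b]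
   make the remaining terms cancel. *)
pose l s := c a (clamp (3 * s)) + (clamp (3 * s - 1) *: (b - a) + (c b (clamp (3 - 3 * s)) - b)).
have l1 s : s <= 3^-1 -> l s = c a (clamp (3 * s)).
  move=> s1; rewrite /l [clamp (3 * s - 1)]clamp_le0; last by lra.
  by rewrite [clamp (3 - _)]clamp_ge1 ?cb1 ?subrr ?scale0r ?addr0//; lra.
have l2 s : 3^-1 <= s <= 2 / 3 -> l s = a + (3 * s - 1) *: (b - a).
  move=> /andP[s1 s2]; rewrite /l clamp_ge1; last by lra.
  rewrite clamp_id; last by lra.
  by rewrite [clamp (3 - _)]clamp_ge1 ?cb1 ?subrr ?addr0 ?ca1//; lra.
have l3 s : 2 / 3 <= s -> l s = c b (clamp (3 - 3 * s)).
  move=> s2; rewrite /l clamp_ge1 ?ca1; last by lra.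
  by rewrite clamp_ge1 ?scale1r; [rewrite addrA subrKC addrC subrK|lra].
have affc (p q : R) : continuous (fun s : R => p + q * s).
  by move=> s; apply: cvgD; [exact: cvg_cst|apply: cvgMr; exact: cvg_id].
have clampc (p q : R) : continuous (fun s : R => clamp (p + q * s)).
  by move=> s; exact: (cvg_comp _ _ (affc p q s) (@continuous_clamp R _)).
have cl : continuous l.
  have -> : l = fun s => c a (clamp (0 + 3 * s)) + (clamp (-1 + 3 * s) *: (b - a) + (c b (clamp (3 + (-3) * s)) - b)).
    by apply/funext => s; rewrite /l add0r [-1 + _]addrC mulNr.
  move=> s; apply: cvgD.
    exact: (cvg_comp _ _ (clampc 0 3 s) (cca _)).
  apply: cvgD; first by apply: cvgZr_tmp; exact: clampc.
  apply: cvgB; last exact: cvg_cst.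
  exact: (cvg_comp _ _ (clampc 3 (-3) s) (ccb _)).
have lO s : Omega (l s).
  have [s1|s1] := leP s 3^-1; first by rewrite l1.
  have [s2|s2] := leP (2 / 3) s; first by rewrite l3.
  rewrite l2; last by rewrite !ltW.
  by apply: yr; apply: ball_segment => //; lra.
have l0 : l 0 = p0 by rewrite l1 ?invr_ge0// mulr0 clamp_le0.
have l01 : l 0 = l 1 by rewrite l0 l3 ?clamp_le0 ?cb0//; lra.
have [h [ch hO h0 h1 hc]] := sc l (continuous_subspaceT cl) (fun t _ => lO t) l01.
pose H (z : R * R) := h (clamp z.1, clamp z.2).
have cH : continuous H.
  apply: (continuous_comp_within ch).
    move=> z; have k1 : clamp x.1 @[x --> z] --> clamp z.1.
      exact: (cvg_comp _ _ (@continuous_fst_plane R z) (@continuous_clamp R _)).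
    have k2 : clamp x.2 @[x --> z] --> clamp z.2.
      exact: (cvg_comp _ _ (@continuous_snd_plane R z) (@continuous_clamp R _)).
    exact: (cvg_pair k1 k2).
  by move=> z; split; exact: clamp_itv.
have HO z : Omega (H z) by apply: hO; exact: clamp_itv.
have [|| N0 NH] := @homotopy_mesh H p0 cH HO.
- move=> s s01; rewrite /H/= [clamp 0]clamp_le0// [clamp 1]clamp_ge1//.
  by rewrite -l0; apply: hc; exact: clamp_itv.
- by move=> t t01; rewrite /H/= [clamp 1]clamp_ge1// h1 ?l0//; exact: clamp_itv.
have [Mb MbP] := fine_mesh_near ccb cOb.
(* A multiple of both [N a] and [N b], so that refinement applies to both paths, and at least [N0]
   and [Mb]. The loop is cut into [3 * M] pieces, so its corners are mesh points. *)
pose M := (N a * N b * (N0 + Mb).+1)%N.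
have [Na0 _] := NP a (yr _ ya); have [Nb0 _] := NP b (yr _ yb).
have M0 : (0 < M)%N by rewrite !muln_gt0 Na0 Nb0.
have hl : \forall t \near F, mesh_sum (fun s => H (0, s)) (3 * M) t = 0.
  apply: NH; last by rewrite muln_gt0.
  rewrite (@leq_trans M)//; last by rewrite leq_pmull.
  by rewrite (@leq_trans (N0 + Mb).+1) ?leqW ?leq_addr// /M leq_pmull// muln_gt0 Na0.
have hA : \forall t \near F, mesh_sum (c a) M t = mesh_sum (c a) (N a) t.
  by rewrite /M -mulnA; apply: mesh_sum_refine; [rewrite muln_gt0 Nb0|exact: NP (yr _ ya)].
have hB : \forall t \near F, mesh_sum (c b) M t = mesh_sum (c b) (N b) t.
  rewrite /M [(N a * _)%N]mulnC -mulnA.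
  by apply: mesh_sum_refine; [rewrite muln_gt0 Na0|exact: NP (yr _ yb)].
have MR : 0 < M%:R :> R by rewrite ltr0n.
have hseg : \forall t \near F, \sum_(0 <= k < M)
    J (a + (k%:R / M%:R) *: (b - a)) (a + (k.+1%:R / M%:R) *: (b - a)) t = J a b t.
  have := @cocycle_telescope y r (fun k => a + (k%:R / M%:R) *: (b - a)) M yr.
  rewrite /= mul0r scale0r addr0 divff ?gt_eqF// scale1r subrKC; apply => k kM.
  apply: ball_segment => //.
  by rewrite divr_ge0//= ler_pdivrMr// mul1r ler_nat.
(* The third piece of the loop runs along [c b] backwards; the sign change under reversal is
   available only within a ball, hence the fine mesh. *)
have hrev : \forall t \near F, forall k, (k < M)%N ->
    J (c b (k.+1%:R / M%:R)) (c b (k%:R / M%:R)) t = - J (c b (k%:R / M%:R)) (c b (k.+1%:R / M%:R)) t.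
  have [_ fM] : fine_mesh (c b) M.
    apply: MbP => //.
    by rewrite (@leq_trans (N0 + Mb).+1) ?leqW ?leq_addl// /M leq_pmull// muln_gt0 Na0.
  apply: near_forall_ltn => k kM; have [y' [r' [yr' hb]]] := fM k kM.
  have kk : k%:R / M%:R <= (k.+1%:R / M%:R : R) by rewrite ler_pM2r ?invr_gt0// ler_nat leqnSn.
  by apply: (cocycle_sym yr'); apply: hb; rewrite lexx kk.
have H0E s : 0 <= s <= 1 -> H (0, s) = l s.
  by move=> s01; rewrite /H/= [clamp 0]clamp_le0// clamp_id// h0.
apply: (nearS2 (filterI hl hseg) (filterI hrev (filterI hA hB))) => t [e1 e2] [e3 [e4 e5]].
rewrite -e4 -e5 -e2.
pose pt k := H (0, k%:R / (3 * M)%:R).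
have ptE k : (k <= 3 * M)%N -> pt k = l (k%:R / M%:R / 3).
  move=> kM; rewrite /pt H0E natrM; last first.
    by rewrite divr_ge0//= ler_pdivrMr ?mulr_gt0// mul1r -natrM ler_nat.
  by rewrite invfM mulrA mulrAC.
have inM k : (k <= M)%N -> 0 <= (k%:R / M%:R : R) <= 1.
  by move=> kM; rewrite divr_ge0//= ler_pdivrMr// mul1r ler_nat.
have pt1 k : (k <= M)%N -> pt k = c a (k%:R / M%:R).
  move=> kM; rewrite ptE; last by rewrite (leq_trans kM)// leq_pmull.
  have kM1 := inM k kM.
  rewrite l1; last by lra.
  by rewrite mulrC divfK// clamp_id.
have pt2 k : (k <= M)%N -> pt (k + M)%N = a + (k%:R / M%:R) *: (b - a).
  move=> kM; rewrite ptE; last by rewrite !mulSn addnA leq_add// ?leq_addr// (leq_trans kM)// leq_addr.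
  have kM1 := inM k kM.
  rewrite natrD mulrDl divff ?gt_eqF// l2; last by lra.
  have -> // : 3 * ((k%:R / M%:R + 1) / 3) - 1 = k%:R / M%:R :> R.
  by move: (k%:R / M%:R) => q; field.
have pt3 k : (k <= M)%N -> pt (k + 2 * M)%N = c b ((M - k)%N%:R / M%:R).
  move=> kM; rewrite ptE; last by rewrite -[3%N]/(1 + 2)%N mulnDl mul1n leq_add2r.
  have kM1 := inM k kM.
  rewrite natrD natrM mulrDl mulfK ?gt_eqF// l3; last by lra.
  rewrite clamp_id; last by lra.
  rewrite natrB// mulrBl divff ?gt_eqF//.
  have -> // : 3 - 3 * ((k%:R / M%:R + 2) / 3) = 1 - k%:R / M%:R :> R.
  by move: (k%:R / M%:R) => q; field.
have : \sum_(0 <= k < 3 * M) J (pt k) (pt k.+1) t = 0 by exact: e1.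
have M12 : (M <= 2 * M)%N by rewrite leq_pmull.
have M23 : (2 * M <= 3 * M)%N by rewrite leq_pmul2r.
rewrite (big_cat_nat (leq0n M) (leq_trans M12 M23))/=.
rewrite (big_cat_nat M12 M23)/=.
have -> : \sum_(0 <= k < M) J (pt k) (pt k.+1) t = mesh_sum (c a) M t.
  by apply: eq_big_nat => k /andP[_ kM]; rewrite !pt1// ltnW.
have -> : \sum_(M <= k < 2 * M) J (pt k) (pt k.+1) t =
    \sum_(0 <= k < M) J (a + (k%:R / M%:R) *: (b - a)) (a + (k.+1%:R / M%:R) *: (b - a)) t.
  rewrite -{1}[M]add0n big_addn mul2n -addnn addnK.
  by apply: eq_big_nat => k /andP[_ kM]; rewrite -addSn !pt2// ltnW.
have -> : \sum_(2 * M <= k < 3 * M) J (pt k) (pt k.+1) t = - mesh_sum (c b) M t.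
  rewrite -{1}[(2 * M)%N]add0n big_addn -mulnBl mul1n big_nat_rev /= add0n.
  rewrite /mesh_sum -sumrN; apply: eq_big_nat => k /andP[_ kM].
  rewrite -addSn !pt3 ?leq_subr//; last by rewrite subnSK// leq_subr.
  by rewrite subnSK// (subKn kM) (subKn (ltnW kM)) e3.
by move=> E; lra.
Qed.

End Cocycle.

(** * Mollified fields and their increments *)

Section Densities.
Context {R : realType}.
Local Notation leb := (@lebesgue_measure R).
Implicit Types (a b : R -> R) (e : R).

Definition bmeas a := measurable_fun setT a /\ exists M, forall x, `|a x| <= M.

Definition density a e := [/\ measurable_fun setT a, forall x, 0 <= a x,
  exists M, forall x, `|a x| <= M, (\int[leb]_x (a x)%:E = 1)%E &
  forall x, e <= `|x| -> a x = 0].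

Lemma density_bmeas a e : density a e -> bmeas a.
Proof. by case. Qed.

Definition kern a b (z w : R * R) : R := a (z.1 - w.1) * b (z.2 - w.2).

Lemma measurable_sub_coord :
  measurable_fun setT (fun p : plane R * plane R => p.1.1 - p.2.1) /\
  measurable_fun setT (fun p : plane R * plane R => p.1.2 - p.2.2).
Proof.
have m1 : measurable_fun setT (fst : plane R * plane R -> plane R) := measurable_fst.
have m2 : measurable_fun setT (snd : plane R * plane R -> plane R) := measurable_snd.
have f1 : measurable_fun setT (fst : plane R -> R) := @measurable_fst _ _ (measurableTypeR R) (measurableTypeR R).
have f2 : measurable_fun setT (snd : plane R -> R) := @measurable_snd _ _ (measurableTypeR R) (measurableTypeR R).
by split; apply: measurable_funB; apply: measurableT_comp.
Qed.

Lemma kern_measurable a b : bmeas a -> bmeas b ->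
  measurable_fun setT (fun p : plane R * plane R => kern a b p.1 p.2).
Proof.
move=> [ma _] [mb _]; have [m1 m2] := measurable_sub_coord.
by apply: measurable_funM; [exact: (measurableT_comp ma m1)|exact: (measurableT_comp mb m2)].
Qed.

Lemma kern_measurable1 a b (w : R * R) : bmeas a -> bmeas b ->
  measurable_fun setT (fun z : plane R => kern a b z w).
Proof.
by move=> ma mb; exact: (measurableT_comp (kern_measurable ma mb) (@pair2_measurable _ _ (plane R) (plane R) w)).
Qed.

Lemma kern_measurable2 a b (z : R * R) : bmeas a -> bmeas b ->
  measurable_fun setT (fun w : plane R => kern a b z w).
Proof.
by move=> ma mb; exact: (measurableT_comp (kern_measurable ma mb) (@pair1_measurable _ _ (plane R) (plane R) z)).
Qed.

Lemma kern_bounded a b : bmeas a -> bmeas b -> exists M, forall z w, `|kern a b z w| <= M.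
Proof.
move=> [_ [M1 h1]] [_ [M2 h2]]; exists (M1 * M2) => z w.
by rewrite normrM ler_pM.
Qed.

Lemma tensor_integral a b : measurable_fun setT a -> (forall x, 0 <= a x) ->
  measurable_fun setT b -> (forall x, 0 <= b x) ->
  (\int[mu2]_z (a z.1 * b z.2)%:E = \int[leb]_x (a x)%:E * \int[leb]_x (b x)%:E)%E.
Proof.
move=> ma a0 mb b0; rewrite mu2_tonelli1; last 2 first.
- apply/measurable_EFinP; apply: measurable_funM.
    exact: (measurableT_comp ma (@measurable_fst _ _ (measurableTypeR R) (measurableTypeR R))).
  exact: (measurableT_comp mb (@measurable_snd _ _ (measurableTypeR R) (measurableTypeR R))).
- by move=> z; rewrite lee_fin mulr_ge0.
rewrite -ge0_integralZr//; last 3 first.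
- exact/measurable_EFinP.
- by move=> x _; rewrite lee_fin.
- by apply: integral_ge0 => x _; rewrite lee_fin.
apply: eq_integral => x _ /=; under eq_integral do rewrite EFinM.
rewrite ge0_integralZl//; [exact/measurable_EFinP|by move=> y _; rewrite lee_fin|by rewrite lee_fin].
Qed.

Lemma density_tensor a b e : density a e -> density b e ->
  (\int[mu2]_z (a z.1 * b z.2)%:E = 1)%E.
Proof.
by move=> [ma a0 _ a1 _] [mb b0 _ b1 _]; rewrite tensor_integral// a1 b1 mule1.
Qed.

Lemma tensor_measurable a b : bmeas a -> bmeas b ->
  measurable_fun setT (fun z : plane R => (a z.1 * b z.2)%:E).
Proof.
move=> [ma _] [mb _]; apply/measurable_EFinP; apply: measurable_funM.
  exact: (measurableT_comp ma (@measurable_fst _ _ (measurableTypeR R) (measurableTypeR R))).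
exact: (measurableT_comp mb (@measurable_snd _ _ (measurableTypeR R) (measurableTypeR R))).
Qed.

Lemma kern_ge0 a b e z w : density a e -> density b e -> 0 <= kern a b z w.
Proof. by move=> [_ a0 _ _ _] [_ b0 _ _ _]; rewrite mulr_ge0. Qed.

Lemma kern_integral1 a b e (w : R * R) : density a e -> density b e ->
  (\int[mu2]_z (kern a b z w)%:E = 1)%E.
Proof.
move=> da db; rewrite -(density_tensor da db).
have mT := tensor_measurable (density_bmeas da) (density_bmeas db).
have T0 (z : plane R) : (0 <= (a z.1 * b z.2)%:E)%E.
  by rewrite lee_fin; have := kern_ge0 z 0 da db; rewrite /kern !subr0.
by rewrite -[RHS](mu2_ge0_integral_shift (- w) mT T0).
Qed.

Lemma kern_integral2 a b e (z : R * R) : density a e -> density b e ->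
  (\int[mu2]_w (kern a b z w)%:E = 1)%E.
Proof.
move=> da db; rewrite -(density_tensor da db).
have mT := tensor_measurable (density_bmeas da) (density_bmeas db).
have T0 (w : plane R) : (0 <= (a w.1 * b w.2)%:E)%E.
  by rewrite lee_fin; have := kern_ge0 w 0 da db; rewrite /kern !subr0.
rewrite -[RHS](mu2_ge0_integral_shift z mT T0).
rewrite -[RHS](mu2_ge0_integral_opp (measurableT_comp mT (measurable_shift_plane z)) (fun w => T0 _)).
by apply: eq_integral => w _; rewrite /kern /= ![- _ + _]addrC.
Qed.

Lemma measurable_integral_param (f : plane R * plane R -> R) :
  measurable_fun setT f ->
  measurable_fun setT (fun z => \int[mu2]_w f (z, w)).
Proof.
move=> mf; have mf' : measurable_fun setT (EFin \o f) by exact/measurable_EFinP.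
apply: (measurableT_comp (@fine_measurable R setT measurableT)) => /=.
have -> : (fun z => \int[mu2]_w (f (z, w))%:E)%E =
    (fun z => \int[mu2]_w ((EFin \o f)^\+ (z, w)) - \int[mu2]_w ((EFin \o f)^\- (z, w)))%E.
  apply/funext => z; rewrite integralE; congr (_ - _)%E; apply: eq_integral => w _;
    by rewrite ?funeposE ?funenegE.
apply: emeasurable_funB; apply: mu2_measurable_tonelli => //.
  exact: measurable_funepos.
exact: measurable_funeneg.
Qed.

End Densities.

(** * Convolution with product kernels *)

Section Convolution.
Context {R : realType}.
Implicit Types (F : R * R -> R) (a b : R -> R) (e : R).

(** Square integrability serves the estimates; integrability allows convolution with bounded kernels
    that do not decay, such as those built from [th]. *)
Definition L12 F := sqint mu2 (F : plane R -> R) /\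
  mu2.-integrable setT (fun z : plane R => (F z)%:E).

Lemma integrable_mul_bounded d (T : measurableType d) (mu : {measure set T -> \bar R})
    (f h : T -> R) (M : R) : mu.-integrable setT (EFin \o f) ->
  measurable_fun setT h -> (forall x, `|h x| <= M) ->
  mu.-integrable setT (fun x => (f x * h x)%:E).
Proof.
move=> fi mh hM; have mf : measurable_fun setT f by exact/measurable_EFinP/(measurable_int mu).
apply: (@le_integrable _ _ _ mu setT measurableT _ (fun x => M%:E * (f x)%:E)%E).
- by apply/measurable_EFinP; exact: measurable_funM.
- move=> x _; rewrite -EFinM !abse_EFin lee_fin !normrM mulrC ler_wpM2r//.
  exact: le_trans (hM x) (ler_norm _).
- exact: integrableZl.
Qed.

Lemma Rint_norm_le (f : plane R -> R) :
  mu2.-integrable setT (fun z => (f z)%:E) ->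
  `|\int[mu2]_z f z| <= \int[mu2]_z `|f z|.
Proof. exact: le_normr_Rintegral. Qed.

Lemma integrable_normr (f : plane R -> R) :
  mu2.-integrable setT (fun z => (f z)%:E) ->
  mu2.-integrable setT (fun z => (`|f z|)%:E).
Proof. exact: integrable_norm. Qed.

Lemma integrable_EFinB (f g : plane R -> R) :
  mu2.-integrable setT (fun z => (f z)%:E) ->
  mu2.-integrable setT (fun z => (g z)%:E) ->
  mu2.-integrable setT (fun z => (f z - g z)%:E).
Proof. by move=> hf hg; have := integrableB measurableT hf hg. Qed.

Lemma integrable_EFinD (f g : plane R -> R) :
  mu2.-integrable setT (fun z => (f z)%:E) ->
  mu2.-integrable setT (fun z => (g z)%:E) ->
  mu2.-integrable setT (fun z => (f z + g z)%:E).
Proof. by move=> hf hg; have := integrableD measurableT hf hg. Qed.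

Lemma integrable_EFinZ (k : R) (f : plane R -> R) :
  mu2.-integrable setT (fun z => (f z)%:E) ->
  mu2.-integrable setT (fun z => (k * f z)%:E).
Proof. by move=> hf; have := integrableZl measurableT k hf. Qed.

Lemma Rint_le (f g : plane R -> R) :
  mu2.-integrable setT (fun z => (f z)%:E) ->
  mu2.-integrable setT (fun z => (g z)%:E) ->
  (forall z, f z <= g z) -> \int[mu2]_z f z <= \int[mu2]_z g z.
Proof. by move=> hf hg fg; apply: le_Rintegral. Qed.

Lemma RintB (f g : plane R -> R) :
  mu2.-integrable setT (fun z => (f z)%:E) ->
  mu2.-integrable setT (fun z => (g z)%:E) ->
  \int[mu2]_z (f z - g z) = \int[mu2]_z f z - \int[mu2]_z g z.
Proof. by move=> hf hg; apply: RintegralB. Qed.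

Lemma RintD (f g : plane R -> R) :
  mu2.-integrable setT (fun z => (f z)%:E) ->
  mu2.-integrable setT (fun z => (g z)%:E) ->
  \int[mu2]_z (f z + g z) = \int[mu2]_z f z + \int[mu2]_z g z.
Proof. by move=> hf hg; apply: RintegralD. Qed.

Lemma RintZ (k : R) (f : plane R -> R) :
  mu2.-integrable setT (fun z => (f z)%:E) ->
  \int[mu2]_z (k * f z) = k * \int[mu2]_z f z.
Proof. by move=> hf; apply: RintegralZl. Qed.

(* Locked: otherwise comparing two values of it unfolds the integral. *)
Definition kconv : (R * R -> R) -> (R -> R) -> (R -> R) -> R * R -> R :=
  locked (fun F a b z => \int[mu2]_w (F w * kern a b z w)).

Lemma kconvE F a b z : kconv F a b z = \int[mu2]_w (F w * kern a b z w).
Proof. by rewrite /kconv -lock. Qed.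

Lemma conv_integrable F a b z : L12 F -> bmeas a -> bmeas b ->
  mu2.-integrable setT (fun w : plane R => (F w * kern a b z w)%:E).
Proof.
move=> [_ iF] ma mb; have [M HM] := kern_bounded ma mb.
exact: integrable_mul_bounded iF (kern_measurable2 z ma mb) (HM z).
Qed.

Lemma sqr_conv_integrable F a b z : L12 F -> bmeas a -> bmeas b ->
  mu2.-integrable setT (fun w : plane R => (F w ^+ 2 * kern a b z w)%:E).
Proof.
move=> [LF _] ma mb; have [M HM] := kern_bounded ma mb.
exact: integrable_mul_bounded (sqint_integrable_sqr LF) (kern_measurable2 z ma mb) (HM z).
Qed.

Let measurable_conv_integrand F a b : L12 F -> bmeas a -> bmeas b ->
  measurable_fun setT (fun p : plane R * plane R => F p.2 * kern a b p.1 p.2).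
Proof.
move=> [[mF _] _] ma mb; apply: measurable_funM; last exact: kern_measurable.
exact: (measurableT_comp mF (@measurable_snd _ _ (plane R) (plane R))).
Qed.

Lemma conv_measurable F a b : L12 F -> bmeas a -> bmeas b ->
  measurable_fun setT (kconv F a b : plane R -> R).
Proof.
move=> LF ma mb; rewrite (_ : kconv F a b = fun z => \int[mu2]_w (F w * kern a b z w)).
  exact: (measurable_integral_param (measurable_conv_integrand LF ma mb)).
by apply/funext => z; exact: kconvE.
Qed.

Lemma kern_integrable2 a b e (z : R * R) : density a e -> density b e ->
  mu2.-integrable setT (fun w : plane R => (kern a b z w)%:E).
Proof.
move=> da db; apply/integrableP; split.
  by apply/measurable_EFinP; exact: (kern_measurable2 z (density_bmeas da) (density_bmeas db)).
under eq_integral do rewrite gee0_abs ?lee_fin ?(kern_ge0 _ _ da db)//.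
by rewrite (kern_integral2 z da db) ltry.
Qed.

Lemma kern_integrable1 a b e (w : R * R) : density a e -> density b e ->
  mu2.-integrable setT (fun z : plane R => (kern a b z w)%:E).
Proof.
move=> da db; apply/integrableP; split.
  by apply/measurable_EFinP; exact: (kern_measurable1 w (density_bmeas da) (density_bmeas db)).
under eq_integral do rewrite gee0_abs ?lee_fin ?(kern_ge0 _ _ da db)//.
by rewrite (kern_integral1 w da db) ltry.
Qed.

(** Jensen's inequality for the probability density [kern a b z], in the form that the variance of
    [F] about its mean [m] is nonnegative. *)
Lemma conv_sqr_le F a b e z : L12 F -> density a e -> density b e ->
  ((kconv F a b z ^+ 2)%:E <= \int[mu2]_w (F w ^+ 2 * kern a b z w)%:E)%E.
Proof.
move=> LF da db; have [ma mb] := (density_bmeas da, density_bmeas db).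
have i2 := sqr_conv_integrable z LF ma mb.
have i1 := conv_integrable z LF ma mb.
have i0 := kern_integrable2 z da db.
rewrite -[leRHS]fineK; last exact: integrable_fin_num i2.
rewrite lee_fin; set m := kconv F a b z.
have r1 : \int[mu2]_w kern a b z w = 1 by rewrite /Rintegral (kern_integral2 z da db).
have : 0 <= \int[mu2]_w (kern a b z w * (F w - m) ^+ 2).
  by apply: Rintegral_ge0 => w _; rewrite mulr_ge0 ?sqr_ge0// (kern_ge0 _ _ da db).
have -> : \int[mu2]_w (kern a b z w * (F w - m) ^+ 2) =
   \int[mu2]_w ((F w ^+ 2 * kern a b z w + (- 2 * m) * (F w * kern a b z w)) + m ^+ 2 * kern a b z w).
  by apply: eq_Rintegral => w _; ring.
have j1 : mu2.-integrable setT (fun w : plane R => ((- 2 * m) * (F w * kern a b z w))%:E).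
  exact: (integrableZl measurableT (- 2 * m) i1).
have j0 : mu2.-integrable setT (fun w : plane R => (m ^+ 2 * kern a b z w)%:E).
  exact: (integrableZl measurableT (m ^+ 2) i0).
rewrite RintegralD//; last exact: (integrableD measurableT i2 j1).
rewrite RintegralD// !RintegralZl// r1 -(kconvE F a b z) -/m /Rintegral.
by move=> h; lra.
Qed.

(** The pointwise Jensen bound is integrated in [z]; after Tonelli's theorem the kernel has mass one
    in [z] as well. *)
Lemma conv_L2_le F a b e : L12 F -> density a e -> density b e ->
  (\int[mu2]_z (kconv F a b z ^+ 2)%:E <= \int[mu2]_w (F w ^+ 2)%:E)%E.
Proof.
move=> LF da db; have [ma mb] := (density_bmeas da, density_bmeas db).
have mc := conv_measurable LF ma mb.
have mF := LF.1.1.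
have mf : measurable_fun setT (fun p : plane R * plane R => (F p.2 ^+ 2 * kern a b p.1 p.2)%:E).
  apply/measurable_EFinP; apply: measurable_funM; last exact: kern_measurable.
  by apply: measurable_funX; exact: (measurableT_comp mF (@measurable_snd _ _ (plane R) (plane R))).
have f0 (p : plane R * plane R) : (0 <= (F p.2 ^+ 2 * kern a b p.1 p.2)%:E)%E.
  by rewrite lee_fin mulr_ge0 ?sqr_ge0// (kern_ge0 _ _ da db).
apply: (@le_trans _ _ (\int[mu2]_z \int[mu2]_w (F w ^+ 2 * kern a b z w)%:E)%E).
  apply: ge0_le_integral => //.
  - by move=> z _; rewrite lee_fin sqr_ge0.
  - by apply/measurable_EFinP; exact: measurable_funX.
  - exact: (mu2_measurable_tonelli mf f0).
  - by move=> z _; exact: conv_sqr_le LF da db.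
rewrite (mu2_fubini_tonelli mf f0) /=.
apply: ge0_le_integral => //.
- by move=> w _; apply: integral_ge0 => z _; exact: (f0 (z, w)).
- pose g p := (F p.1 ^+ 2 * kern a b p.2 p.1)%:E.
  apply: (@mu2_measurable_tonelli R g) => [|p]; last exact: (f0 (p.2, p.1)).
  exact: (measurableT_comp mf (@measurable_swap _ _ (plane R) (plane R))).
- by apply/measurable_EFinP; exact: measurable_funX.
- move=> w _; under eq_integral do rewrite EFinM.
  rewrite ge0_integralZl//.
  + by rewrite (kern_integral1 w da db) mule1.
  + by apply/measurable_EFinP; exact: (kern_measurable1 w ma mb).
  + by move=> z _; rewrite lee_fin (kern_ge0 _ _ da db).
  + by rewrite lee_fin sqr_ge0.
Qed.

Lemma bounded_test_integrable F (phi : R * R -> R) (M : R) :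
  L12 F -> measurable_fun setT (phi : plane R -> R) -> (forall z, `|phi z| <= M) ->
  mu2.-integrable setT (fun z : plane R => (F z * phi z)%:E).
Proof. by move=> [_ iF] mphi phiM; exact: integrable_mul_bounded iF mphi phiM. Qed.

(** Fubini's theorem moves the kernel to [phi], whose weighted average [phit] over a square of half
    side [e] differs from [phi] by at most [2 * C * e]. *)
Lemma conv_test_close F a b e (phi : R * R -> R) (M C : R) :
  L12 F -> density a e -> density b e -> 0 <= e -> 0 <= C ->
  measurable_fun setT (phi : plane R -> R) -> (forall z, `|phi z| <= M) ->
  (forall z u, `|phi (z + u) - phi z| <= C * (`|u.1| + `|u.2|)) ->
  `|\int[mu2]_z (phi z * kconv F a b z) - \int[mu2]_z (F z * phi z)| <=
    2 * C * e * \int[mu2]_z `|F z|.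
Proof.
move=> LF da db e0 C0 mphi phiM phiC.
have [ma mb] := (density_bmeas da, density_bmeas db).
pose f (p : plane R * plane R) := (phi p.1 * (F p.2 * kern a b p.1 p.2))%:E.
have mf : measurable_fun setT f.
  apply/measurable_EFinP; apply: measurable_funM; last exact: measurable_conv_integrand.
  exact: (measurableT_comp mphi (@measurable_fst _ _ (plane R) (plane R))).
have M0 : 0 <= M by apply: le_trans (phiM 0); exact: normr_ge0.
have fi : (@mu2s R \x @mu2s R)%E.-integrable setT f.
  (* With [z] as the inner variable, the integrand is bounded by [M] times the modulus of [F w]
     times a kernel of mass one. *)
  apply/(integrable21ltyP _ _ mf).
  apply: (@le_lt_trans _ _ (\int[mu2]_w (M%:E * `|(F w)%:E|))%E).
    apply: ge0_le_integral => //.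
    - by move=> w _; apply: integral_ge0.
    - pose g p := `|f (p.2, p.1)|%E.
      apply: (@mu2_measurable_tonelli R g) => [|z]; last exact: abse_ge0.
      have mg := measurableT_comp mf (@measurable_swap _ _ (plane R) (plane R)).
      exact: (measurableT_comp (@abse_measurable R setT) mg).
    - by apply: measurable_funeM; apply: (measurableT_comp (@abse_measurable R setT)); exact: measurable_int LF.2.
    move=> w _; apply: (@le_trans _ _ (\int[mu2]_z ((M * `|F w|)%:E * (kern a b z w)%:E))%E).
      apply: ge0_le_integral => //.
      + apply: (measurableT_comp (@abse_measurable R setT)).
        exact: (measurableT_comp mf (@pair2_measurable _ _ (plane R) (plane R) w)).
      + by apply: measurable_funeM; apply/measurable_EFinP; exact: (kern_measurable1 w ma mb).
      + move=> z _; rewrite /f /= -EFinM lee_fin normrM [`|F w * _|]normrM mulrA.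
        by rewrite [`|kern _ _ _ _|]ger0_norm ?(kern_ge0 _ _ da db)// ler_wpM2r ?(kern_ge0 _ _ da db)// ler_wpM2r.
    rewrite ge0_integralZl//.
    + by rewrite (kern_integral1 w da db) mule1.
    + by apply/measurable_EFinP; exact: (kern_measurable1 w ma mb).
    + by move=> z _; rewrite lee_fin (kern_ge0 _ _ da db).
    + by rewrite lee_fin mulr_ge0.
  rewrite ge0_integralZl//; last by apply: (measurableT_comp (@abse_measurable R setT)); exact: measurable_int LF.2.
  by have /integrableP[_ h] := LF.2; rewrite lte_mul_pinfty.
pose phit w := \int[mu2]_z (phi z * kern a b z w).
have phik w : mu2.-integrable setT (fun z : plane R => (phi z * kern a b z w)%:E).
  have := integrable_mul_bounded (kern_integrable1 w da db) mphi phiM.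
  by under eq_fun do rewrite mulrC.
have kint w : \int[mu2]_z kern a b z w = 1 by rewrite /Rintegral (kern_integral1 w da db).
have phitC w : `|phit w - phi w| <= 2 * C * e.
  have -> : phit w - phi w = \int[mu2]_z ((phi z - phi w) * kern a b z w).
    have -> : \int[mu2]_z ((phi z - phi w) * kern a b z w) =
        \int[mu2]_z (phi z * kern a b z w - phi w * kern a b z w).
      by apply: eq_Rintegral => z _; ring.
    rewrite RintB//; last exact: (integrable_EFinZ (phi w) (kern_integrable1 w da db)).
    by rewrite (RintZ (phi w) (kern_integrable1 w da db)) kint mulr1.
  have ii : mu2.-integrable setT (fun z : plane R => ((phi z - phi w) * kern a b z w)%:E).
    have := integrable_EFinB (phik w) (integrable_EFinZ (phi w) (kern_integrable1 w da db)).
    by apply: eq_integrable => // z _; congr EFin; ring.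
  apply: (le_trans (Rint_norm_le ii)).
  have jj := integrable_EFinZ (2 * C * e) (kern_integrable1 w da db).
  apply: (le_trans (Rint_le (integrable_normr ii) jj _)); last first.
    by rewrite (RintZ (2 * C * e) (kern_integrable1 w da db)) kint mulr1.
  move=> z; rewrite normrM (ger0_norm (kern_ge0 _ _ da db)).
  have [z1|z1] := leP e `|z.1 - w.1|.
    by rewrite /kern (_ : a _ = 0) ?mul0r ?mulr0//; case: da => _ _ _ _; apply.
  have [z2|z2] := leP e `|z.2 - w.2|.
    by rewrite /kern (_ : b _ = 0) ?mulr0//; case: db => _ _ _ _; apply.
  apply: ler_wpM2r; first exact: kern_ge0 da db.
  have := phiC w (z - w); rewrite subrKC => /le_trans; apply.
  by rewrite -mulrA mulrCA ler_wpM2l//= mulr_natl mulr2n lerD// ltW.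
have mphit : measurable_fun setT (phit : plane R -> R).
  apply: (measurable_integral_param (f := fun p => phi p.2 * kern a b p.2 p.1)).
  apply: measurable_funM; first exact: (measurableT_comp mphi (@measurable_snd _ _ (plane R) (plane R))).
  exact: (measurableT_comp (kern_measurable ma mb) (@measurable_swap _ _ (plane R) (plane R))).
have -> : \int[mu2]_z (phi z * kconv F a b z) = \int[mu2]_w (F w * phit w).
  rewrite /Rintegral; congr fine.
  transitivity (\int[mu2]_z \int[mu2]_w f (z, w))%E.
    apply: eq_integral => z _; rewrite kconvE -RintegralZl//; last exact: conv_integrable.
    rewrite /Rintegral fineK//; apply: integrable_fin_num => //.
    exact: (integrableZl measurableT (phi z) (conv_integrable z LF ma mb)).
  transitivity (\int[mu2]_w \int[mu2]_z f (z, w))%E; first exact: (Fubini fi).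
  apply: eq_integral => w _; rewrite /phit -(RintZ (F w) (phik w)).
  rewrite /Rintegral fineK; last exact: integrable_fin_num (integrable_EFinZ (F w) (phik w)).
  by apply: eq_integral => z _; rewrite /f /=; congr EFin; ring.
have phitM w : `|phit w| <= M + 2 * C * e.
  rewrite -[phit w](subrK (phi w)) addrC; apply: (le_trans (ler_normD _ _)).
  by rewrite lerD.
have i1 := bounded_test_integrable LF mphit phitM.
have i2 := bounded_test_integrable LF mphi phiM.
rewrite -RintB//; apply: (le_trans (Rint_norm_le (integrable_EFinB i1 i2))).
have i3 := integrable_normr LF.2.
rewrite -(RintZ (2 * C * e) i3); apply: Rint_le.
- exact: (integrable_normr (integrable_EFinB i1 i2)).
- exact: (integrable_EFinZ (2 * C * e) i3).
- by move=> x; rewrite -mulrBr normrM mulrC ler_wpM2r.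
Qed.

End Convolution.

(** * Smoothed steps and their difference quotients *)

Section StepDensities.
Context {R : realType}.
Local Notation leb := (@lebesgue_measure R).
Implicit Types (dl x y u tau : R).

Definition dstep : R -> R := 'D_(1 : R) (@step R).

Lemma is_derive_step x : is_derive x (1 : R) (@step R) (dstep x).
Proof. by apply: DeriveDef => //; exact: ((@Cn_step R 1).2 (1 : R) erefl).1. Qed.

Lemma continuous_dstep : continuous dstep.
Proof. by have [_ [h _]] := (@Cn_step R 1).2 (1 : R) erefl. Qed.

Lemma dstep_ge0 x : 0 <= dstep x.
Proof.
have [dx _] := is_derive_step x.
apply: (limr_ge dx); near=> h.
have h0 : h != 0 by near: h; exact: nbhs_dnbhs_neq.
have E : h *: (1 : R) + x = h + x by congr (_ + _); exact: mulr1.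
rewrite /= E; change (0 <= h^-1 * (step (h + x) - step x)).
have [hp|hn] := ltP 0 h.
  by rewrite mulr_ge0 ?invr_ge0 ?(ltW hp)// subr_ge0; apply: step_homo; lra.
rewrite mulr_le0// ?invr_le0// subr_le0; apply: step_homo; lra.
Unshelve. all: by end_near. Qed.

Lemma dstep_supp x : 1 < `|x| -> dstep x = 0.
Proof.
have zero (c : R) : (\near x, step x = c) -> dstep x = 0.
  by move=> H; rewrite /dstep (near_eq_derive (1 : R) (g := fun=> c))// derive_cst.
rewrite ltr_normr => /orP[x1|x1].
  apply: (zero 1); near=> y; apply: step1; apply: ltW; near: y; exact: lt_nbhsr.
apply: (zero 0); near=> y; apply: step0; apply: ltW; near: y; apply: lt_nbhsl; lra.
Unshelve. all: by end_near. Qed.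

Lemma dstep_bounded : exists M, forall x, `|dstep x| <= M.
Proof.
have cK : compact (dstep @` `[-2, 2]).
  apply: continuous_compact; last exact: segment_compact.
  exact: continuous_subspaceT continuous_dstep.
have [M [_ MP]] := compact_bounded cK.
exists (`|M| + 1) => x; have [x2|x2] := ltP 1 `|x|.
  by rewrite dstep_supp// normr0 addr_ge0.
apply: (MP (`|M| + 1)).
  by apply: le_lt_trans (ler_norm _) _; rewrite ltrDl.
by exists x => //=; rewrite in_itv/=; move: x2; rewrite ler_norml => /andP[? ?]; apply/andP; split; lra.
Qed.

(** [th dl] is a smoothed Heaviside function, and [kd dl] is its derivative, a mollifier of width
    [dl]. *)
Definition th dl x := step (x / dl).
Definition kd dl x := dl^-1 * dstep (x / dl).

Lemma is_derive_th dl x : is_derive x (1 : R) (th dl) (kd dl x).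
Proof.
have := @is_derive_comp_affine R R step (fun x => x / dl) (fun v => v / dl) x 1 (dstep (x / dl)).
rewrite mul1r; apply; last exact: is_derive_step.
by move=> h v z; change ((h * v + z) / dl = h * (v / dl) + z / dl); ring.
Qed.

Lemma Cn_th n dl : Cn [set (1 : R)] n (th dl).
Proof.
apply: (@Cn_comp_affine R R [set (1 : R)] n step (fun x => x / dl) (fun x => x / dl)); last exact: Cn_step.
  by move=> x; apply: cvgMl; exact: cvg_id.
by move=> h v z; change ((h * v + z) / dl = h * (v / dl) + z / dl); ring.
Qed.

Lemma continuous_th dl : continuous (th dl).
Proof. exact: (Cn_continuous (Cn_th 0 dl)). Qed.

Lemma kdE dl : kd dl = 'D_(1 : R) (th dl).
Proof. by apply/funext => x; case: (is_derive_th dl x). Qed.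

Lemma continuous_kd dl : continuous (kd dl).
Proof. by rewrite kdE; have [_ [h _]] := (Cn_th 1 dl).2 (1 : R) erefl. Qed.

Lemma kd_ge0 dl x : 0 < dl -> 0 <= kd dl x.
Proof. by move=> d0; rewrite mulr_ge0 ?invr_ge0 ?(ltW d0)// dstep_ge0. Qed.

Lemma kd_supp dl x : 0 < dl -> dl < `|x| -> kd dl x = 0.
Proof.
move=> d0 dx; rewrite /kd dstep_supp ?mulr0// normrM normfV (gtr0_norm d0).
by rewrite ltr_pdivlMr// mul1r.
Qed.

Lemma th_ge0 dl x : 0 <= th dl x. Proof. exact: step_ge0. Qed.
Lemma th_le1 dl x : th dl x <= 1. Proof. exact: step_le1. Qed.

Lemma th_homo dl x y : 0 < dl -> x <= y -> th dl x <= th dl y.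
Proof. by move=> d0 xy; apply: step_homo; rewrite ler_pM2r ?invr_gt0. Qed.

Lemma th_eq0 dl x : 0 < dl -> x <= - dl -> th dl x = 0.
Proof. by move=> d0 xd; apply: step0; rewrite ler_pdivrMr// mulN1r. Qed.

Lemma th_eq1 dl x : 0 < dl -> dl <= x -> th dl x = 1.
Proof. by move=> d0 xd; apply: step1; rewrite ler_pdivlMr// mul1r. Qed.

Lemma th_bmeas dl : bmeas (th dl).
Proof.
split; last by exists 1 => x; rewrite ger0_norm ?th_ge0 ?th_le1.
by apply: continuous_measurable_fun; exact: continuous_th.
Qed.

Lemma kd_bmeas dl : bmeas (kd dl).
Proof.
split; first by apply: continuous_measurable_fun; exact: continuous_kd.
have [M MP] := dstep_bounded; exists (`|dl^-1| * M) => x.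
by rewrite normrM ler_wpM2l.
Qed.

Lemma th_FTC dl x y : x < y ->
  (\int[leb]_(t in `[x, y]) (kd dl t)%:E = (th dl y - th dl x)%:E)%E.
Proof.
move=> xy; rewrite (@continuous_FTC2 _ (kd dl) (th dl))//.
- by apply: continuous_subspaceT; exact: continuous_kd.
- split.
  + by move=> z _; case: (is_derive_th dl z).
  + by apply: cvg_at_right_filter; exact: continuous_th.
  + by apply: cvg_at_left_filter; exact: continuous_th.
- by move=> z _; rewrite derive1E kdE.
Qed.

(** The support lies in the segment of half width [dl]; the doubled width leaves room for the
    condition of [density] at the bounding distance itself. *)
Lemma kd_density dl : 0 < dl -> density (kd dl) (2 * dl).
Proof.
move=> d0; have [mk bk] := kd_bmeas dl; split=> //.
- by move=> x; exact: kd_ge0.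
- have -> : (\int[leb]_x (kd dl x)%:E = \int[leb]_(x in `[(- (2 * dl))%R, (2 * dl)%R]) (kd dl x)%:E)%E.
    rewrite [RHS]integral_mkcond; apply: eq_integral => x _; rewrite patchE.
    case: ifPn => // /negP nx; rewrite kd_supp//; rewrite inE/= in_itv/= in nx.
    rewrite ltNge; apply/negP; rewrite ler_norml => /andP[h1 h2]; apply: nx.
    by apply/andP; split; lra.
  rewrite th_FTC; last by lra.
  by rewrite th_eq1 ?th_eq0 ?subr0//; lra.
- by move=> x hx; apply: kd_supp => //; lra.
Qed.

(** For nonzero [tau] of either sign, the mean of [kd dl] over the segment between [x] and
    [x + tau], hence again a probability density. *)
Definition quot dl tau x := tau^-1 * (th dl (x + tau) - th dl x).

Lemma quot_ge0 dl tau x : 0 < dl -> 0 <= quot dl tau x.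
Proof.
move=> d0; rewrite /quot; have [tp|tn] := ltP 0 tau.
  by rewrite mulr_ge0 ?invr_ge0 ?(ltW tp)// subr_ge0; apply: th_homo => //; lra.
by rewrite mulr_le0// ?invr_le0// subr_le0; apply: th_homo => //; lra.
Qed.

Lemma quot_bmeas dl tau : bmeas (quot dl tau).
Proof.
split.
  apply: measurable_funM => //; apply: measurable_funB; last exact: (th_bmeas dl).1.
  apply: (measurableT_comp (th_bmeas dl).1).
  by apply: measurable_funD => //.
exists `|tau^-1| => x; rewrite normrM -[leRHS]mulr1 ler_wpM2l//.
have := th_ge0 dl (x + tau); have := th_le1 dl (x + tau).
have := th_ge0 dl x; have := th_le1 dl x.
by rewrite ler_norml => ? ? ? ?; apply/andP; split; lra.
Qed.

(** Written as the mean of the translates of [kd dl] by [s] between [0] and [tau], the quotient has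
    mass one by Tonelli's theorem and translation invariance. *)
Lemma quot_integral_pos dl tau : 0 < dl -> 0 < tau ->
  (\int[leb]_x (quot dl tau x)%:E = 1)%E.
Proof.
move=> d0 t0.
pose g (p : measurableTypeR R * measurableTypeR R) : \bar R :=
  ((tau^-1 * \1_(`[0, tau]) p.2) * kd dl (p.1 + p.2))%:E.
have m1 : measurable_fun setT (fst : measurableTypeR R * measurableTypeR R -> R) := @measurable_fst _ _ (measurableTypeR R) (measurableTypeR R).
have m2 : measurable_fun setT (snd : measurableTypeR R * measurableTypeR R -> R) := @measurable_snd _ _ (measurableTypeR R) (measurableTypeR R).
have mg : measurable_fun setT g.
  apply/measurable_EFinP; apply: measurable_funM.
    apply: measurable_funM => //; apply: (measurableT_comp _ m2).
    exact: measurable_indic.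
  exact: (measurableT_comp (kd_bmeas dl).1 (measurable_funD m1 m2)).
have g0 p : (0 <= g p)%E.
  by rewrite lee_fin; apply: mulr_ge0; [rewrite mulr_ge0// invr_ge0 ltW|exact: kd_ge0].
have mks x : measurable_fun setT (fun s => kd dl (x + s)).
  by apply: (measurableT_comp (kd_bmeas dl).1); exact: measurable_funD.
transitivity (\int[leb]_x \int[leb]_s g (x, s))%E.
  apply: eq_integral => x _.
  transitivity ((tau^-1)%:E * \int[leb]_(s in `[0%R, tau]) (kd dl (x + s))%:E)%E.
    have -> : (\int[leb]_(s in `[0%R, tau]) (kd dl (x + s))%:E = (th dl (x + tau) - th dl x)%:E)%E.
      rewrite -th_FTC; last by lra.
      rewrite integral_mkcond [RHS]integral_mkcond -[RHS](leb_ge0_integral_shift x).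
      + apply: eq_integral => s _; rewrite !patchE [s + x]addrC.
        congr (if _ then _ else _); apply/idP/idP; rewrite !inE/= !in_itv/= => /andP[? ?];
          by apply/andP; split; lra.
      + apply: (measurable_restrictT _ _).1 => //; apply/measurable_EFinP.
        by apply: measurable_funTS; exact: (kd_bmeas dl).1.
      + by move=> s; rewrite patchE; case: ifP => // _; rewrite lee_fin kd_ge0.
    by rewrite -EFinM.
  rewrite -ge0_integralZl//; last 3 first.
  - by apply/measurable_EFinP; apply: measurable_funTS; exact: mks.
  - by move=> s _; rewrite lee_fin kd_ge0.
  - by rewrite lee_fin invr_ge0 ltW.
  rewrite integral_mkcond; apply: eq_integral => s _; rewrite patchE /g /= indicE.
  by case: ifPn => _; rewrite ?mulr1 ?mulr0 ?mul0r// EFinM.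
rewrite (@fubini_tonelli _ _ _ _ _ leb leb g mg g0).
transitivity (\int[leb]_(s in `[0%R, tau]) (tau^-1)%:E)%E.
  rewrite [RHS]integral_mkcond; apply: eq_integral => s _ /=; rewrite patchE.
  transitivity (\int[leb]_x ((tau^-1 * \1_(`[0, tau]) s)%:E * (kd dl (x + s))%:E))%E.
    by apply: eq_integral => x _; rewrite /g EFinM.
  rewrite ge0_integralZl//; last 3 first.
  - apply/measurable_EFinP; apply: (measurableT_comp (kd_bmeas dl).1).
    exact: measurable_funD.
  - by move=> x _; rewrite lee_fin kd_ge0.
  - by rewrite lee_fin mulr_ge0// invr_ge0 ltW.
  have [_ _ _ kd1 _] := kd_density d0.
  have k0 x : (0 <= (kd dl x)%:E)%E by rewrite lee_fin kd_ge0.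
  rewrite (leb_ge0_integral_shift s _ k0) ?kd1 ?mule1; last first.
    by apply/measurable_EFinP; exact: (kd_bmeas dl).1.
  by rewrite indicE; case: ifPn => _; rewrite ?mulr1 ?mulr0.
rewrite integral_cst//= lebesgue_measure_itv/= lte_fin t0 sube0 -EFinM mulVf//.
by rewrite gt_eqF.
Qed.

Lemma quot_density dl tau : 0 < dl -> tau != 0 ->
  density (quot dl tau) (2 * dl + `|tau|).
Proof.
move=> d0 t0; have [mq bq] := quot_bmeas dl tau; split=> //.
- by move=> x; exact: quot_ge0.
- have [tp|tn] := ltP 0 tau; first exact: quot_integral_pos.
  (* The quotient for [tau] is the one for [- tau] translated by [tau]. *)
  have tn0 : 0 < - tau by rewrite oppr_gt0 lt_neqAle t0.
  rewrite -(quot_integral_pos d0 tn0) -[RHS](leb_ge0_integral_shift tau).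
  + by apply: eq_integral => x _; rewrite /quot addrK invrN; congr EFin; ring.
  + by apply/measurable_EFinP; exact: (quot_bmeas dl (- tau)).1.
  + by move=> x; rewrite lee_fin quot_ge0.
- move=> x hx; rewrite /quot.
  have [xp|xn] := ltP 0 x.
    rewrite (gtr0_norm xp) in hx.
    have n1 := ler_norm (- tau); rewrite normrN in n1; have n2 := normr_ge0 tau.
    have h1 : dl <= x + tau by lra.
    have h2 : dl <= x by lra.
    by rewrite (th_eq1 d0 h1) (th_eq1 d0 h2) subrr mulr0.
  rewrite (ler0_norm xn) in hx.
  have n1 := ler_norm tau; have n2 := normr_ge0 tau.
  have h1 : x + tau <= - dl by lra.
  have h2 : x <= - dl by lra.
  by rewrite (th_eq0 d0 h1) (th_eq0 d0 h2) subrr mulr0.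
Qed.

End StepDensities.

(** * Increments of a potential of the mollified field *)

Section Increments.
Context {R : realType}.
Variables (F1 F2 : R * R -> R).
Hypotheses (L1 : L12 F1) (L2 : L12 F2).
Implicit Types (dl tau : R) (z u : R * R).

(** Primitives of the mollified components: [kd] in both factors of the kernel would give the
    mollified field, and [th] in place of one [kd] integrates it in that variable. *)
Definition G1 dl := kconv F1 (th dl) (kd dl).
Definition G2 dl := kconv F2 (kd dl) (th dl).

(* The increment from [z] to [z'] of a potential of the mollified field, along
   a horizontal and then a vertical segment; for increments of both kinds the
   line integral of the mollifier is explicit. *)
Definition Inc dl z z' : R :=
  (G1 dl (z'.1, z.2) - G1 dl z) + (G2 dl z' - G2 dl (z'.1, z.2)).

Let i1 dl z := conv_integrable z L1 (th_bmeas dl) (kd_bmeas dl).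
Let i2 dl z := conv_integrable z L2 (kd_bmeas dl) (th_bmeas dl).

(** A difference of [th] is [tau] times a density, so the increment is [tau] times an average of
    [F1]. *)
Lemma Inc_horizontal dl z tau : tau != 0 ->
  Inc dl z (z.1 + tau, z.2) = tau * kconv F1 (quot dl tau) (kd dl) z.
Proof.
move=> t0; rewrite /Inc /= subrr addr0 /G1 !kconvE -(RintB (i1 dl _) (i1 dl _)).
rewrite -(RintZ tau (conv_integrable z L1 (quot_bmeas dl tau) (kd_bmeas dl))).
apply: eq_Rintegral => w _; rewrite /kern /quot /= [z.1 + tau - w.1]addrAC.
by field.
Qed.

Lemma Inc_vertical dl z tau : tau != 0 ->
  Inc dl z (z.1, z.2 + tau) = tau * kconv F2 (kd dl) (quot dl tau) z.
Proof.
move=> t0; rewrite /Inc /= -surjective_pairing subrr add0r /G2 !kconvE.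
rewrite -(RintB (i2 dl _) (i2 dl _)).
rewrite -(RintZ tau (conv_integrable z L2 (kd_bmeas dl) (quot_bmeas dl tau))).
apply: eq_Rintegral => w _; rewrite /kern /quot /= [z.2 + tau - w.2]addrAC.
by field.
Qed.

Lemma Inc_split dl z z' : Inc dl z z' = Inc dl z (z'.1, z.2) + Inc dl (z'.1, z.2) z'.
Proof. by rewrite /Inc /=; ring. Qed.

Definition field_energy : R := ip mu2 F1 F1 + ip mu2 F2 F2.

(** Convolution with a product of densities does not increase the L^2 norm, so the constant does not
    depend on [dl]. *)
Lemma Inc_L2_horizontal dl tau : 0 < dl ->
  (\int[mu2]_z (Inc dl z (z.1 + tau, z.2) ^+ 2)%:E <= (tau ^+ 2 * ip mu2 F1 F1)%:E)%E.
Proof.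
move=> d0; have [->|t0] := eqVneq tau 0.
  rewrite integral0_eq ?expr0n ?mul0r// => z _.
  by rewrite addr0 /Inc /= -surjective_pairing !subrr addr0 expr0n.
have dq := quot_density d0 t0.
have dk : density (kd dl) (2 * dl + `|tau|).
  have [? ? ? ? h] := kd_density d0; split=> // x hx; apply: h.
  by apply: le_trans hx; rewrite lerDl.
under eq_integral do rewrite Inc_horizontal// exprMn EFinM.
rewrite ge0_integralZl//; last 3 first.
- apply/measurable_EFinP; apply: measurable_funX.
  exact: conv_measurable L1 (quot_bmeas _ _) (kd_bmeas _).
- by move=> z _; rewrite lee_fin sqr_ge0.
- by rewrite lee_fin sqr_ge0.
rewrite [leRHS]EFinM; apply: lee_wpmul2l; first by rewrite lee_fin sqr_ge0.
by rewrite -(sqint_ipE L1.1); exact: conv_L2_le L1 dq dk.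
Qed.

Lemma Inc_L2_vertical dl tau : 0 < dl ->
  (\int[mu2]_z (Inc dl z (z.1, z.2 + tau) ^+ 2)%:E <= (tau ^+ 2 * ip mu2 F2 F2)%:E)%E.
Proof.
move=> d0; have [->|t0] := eqVneq tau 0.
  rewrite integral0_eq ?expr0n ?mul0r// => z _.
  by rewrite addr0 /Inc /= -surjective_pairing !subrr addr0 expr0n.
have dq := quot_density d0 t0.
have dk : density (kd dl) (2 * dl + `|tau|).
  have [? ? ? ? h] := kd_density d0; split=> // x hx; apply: h.
  by apply: le_trans hx; rewrite lerDl.
under eq_integral do rewrite Inc_vertical// exprMn EFinM.
rewrite ge0_integralZl//; last 3 first.
- apply/measurable_EFinP; apply: measurable_funX.
  exact: conv_measurable L2 (kd_bmeas _) (quot_bmeas _ _).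
- by move=> z _; rewrite lee_fin sqr_ge0.
- by rewrite lee_fin sqr_ge0.
rewrite [leRHS]EFinM; apply: lee_wpmul2l; first by rewrite lee_fin sqr_ge0.
by rewrite -(sqint_ipE L2.1); exact: conv_L2_le L2 dk dq.
Qed.

Let mfst : measurable_fun setT (fst : plane R -> R) := @measurable_fst _ _ (measurableTypeR R) (measurableTypeR R).
Let msnd : measurable_fun setT (snd : plane R -> R) := @measurable_snd _ _ (measurableTypeR R) (measurableTypeR R).

Let mG1 dl : measurable_fun setT (G1 dl : plane R -> R).
Proof. exact: conv_measurable L1 (th_bmeas dl) (kd_bmeas dl). Qed.

Let mG2 dl : measurable_fun setT (G2 dl : plane R -> R).
Proof. exact: conv_measurable L2 (kd_bmeas dl) (th_bmeas dl). Qed.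

Lemma measurable_Inc2 dl (p q : plane R -> plane R) : measurable_fun setT p ->
  measurable_fun setT q -> measurable_fun setT (fun z => Inc dl (p z) (q z)).
Proof.
move=> mp mq.
have mm : measurable_fun setT (fun z => ((q z).1, (p z).2) : plane R).
  by apply: measurable_fun_pair; [exact: (measurableT_comp mfst mq)|exact: (measurableT_comp msnd mp)].
by apply: measurable_funD; apply: measurable_funB;
  [exact: (measurableT_comp (mG1 dl) mm)|exact: (measurableT_comp (mG1 dl) mp)
  |exact: (measurableT_comp (mG2 dl) mq)|exact: (measurableT_comp (mG2 dl) mm)].
Qed.

(** The translation is split into a horizontal and a vertical one; the vertical increment is taken
    at a translated point, which does not change its integral. *)
Lemma Inc_L2 dl u : 0 < dl ->
  (\int[mu2]_z (Inc dl z (z + u)%R ^+ 2)%:E <=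
   (2 * (u.1 ^+ 2 + u.2 ^+ 2) * field_energy)%:E)%E.
Proof.
move=> d0.
pose H z := Inc dl z (z.1 + u.1, z.2).
pose K z := Inc dl z (z.1, z.2 + u.2).
have mshift (a b : R) : measurable_fun setT (fun z : plane R => (z.1 + a, z.2 + b) : plane R).
  by apply: measurable_fun_pair; apply: measurable_funD => //.
have mH : measurable_fun setT (H : plane R -> R).
  have m : measurable_fun setT (fun z : plane R => (z.1 + u.1, z.2) : plane R).
    by have := mshift u.1 0; under eq_fun do rewrite addr0.
  exact: (measurable_Inc2 dl (@measurable_id _ (plane R) setT) m).
have mK : measurable_fun setT (K : plane R -> R).
  have m : measurable_fun setT (fun z : plane R => (z.1, z.2 + u.2) : plane R).
    by have := mshift 0 u.2; under eq_fun do rewrite addr0.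
  exact: (measurable_Inc2 dl (@measurable_id _ (plane R) setT) m).
have E z : Inc dl z (z + u) = H z + K (z + (u.1, 0)).
  have -> : z + (u.1, 0) = (z.1 + u.1, z.2).
    by rewrite [LHS]surjective_pairing /= addr0.
  by rewrite Inc_split /H /K /= [z + u]surjective_pairing.
have mH2 : measurable_fun setT (fun z : plane R => (H z ^+ 2)%:E).
  by apply/measurable_EFinP; exact: measurable_funX.
have mK2 : measurable_fun setT (fun z : plane R => (K z ^+ 2)%:E).
  by apply/measurable_EFinP; exact: measurable_funX.
have mK2' := measurableT_comp mK2 (measurable_shift_plane ((u.1, 0) : R * R)).
have H0 z : (0 <= (H z ^+ 2)%:E)%E by rewrite lee_fin sqr_ge0.
have K0 z : (0 <= (K z ^+ 2)%:E)%E by rewrite lee_fin sqr_ge0.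
apply: (@le_trans _ _ (2%:E * (\int[mu2]_z (H z ^+ 2)%:E + \int[mu2]_z (K (z + (u.1, 0))%R ^+ 2)%:E))%E).
  rewrite -ge0_integralD// -ge0_integralZl//; last 2 first.
  - exact: emeasurable_funD.
  - by move=> z _; apply: adde_ge0.
  apply: ge0_le_integral => //.
  - by move=> z _; rewrite lee_fin sqr_ge0.
  - apply/measurable_EFinP; apply: measurable_funX.
    exact: (measurable_Inc2 dl (@measurable_id _ (plane R) setT) (measurable_shift_plane u)).
  - by apply: measurable_funeM; exact: emeasurable_funD.
  - move=> z _; rewrite E -EFinD -EFinM lee_fin.
    by have := sqr_ge0 (H z - K (z + (u.1, 0))); nra.
rewrite (mu2_ge0_integral_shift _ mK2 K0).
have hH := Inc_L2_horizontal u.1 d0; have hK := Inc_L2_vertical u.2 d0.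
apply: (@le_trans _ _ (2%:E * ((u.1 ^+ 2 * ip mu2 F1 F1)%:E + (u.2 ^+ 2 * ip mu2 F2 F2)%:E))%E).
  by rewrite lee_wpmul2l// leeD.
rewrite -EFinD -EFinM lee_fin /field_energy.
have := ip_ge0 mu2 F1; have := ip_ge0 mu2 F2.
have := sqr_ge0 u.1; have := sqr_ge0 u.2; nra.
Qed.

Lemma Cn_step_difference n dl x x' :
  Cn [set (1 : R)] n (fun t => th dl (x' - t) - th dl (x - t)).
Proof.
have C y : Cn [set (1 : R)] n (fun t => th dl (y - t)).
  apply: (@Cn_comp_affine R R [set (1 : R)] n (th dl) (fun t => y - t) -%R); last exact: Cn_th.
    by move=> t; apply: cvgB; [exact: cvg_cst|exact: cvg_id].
  by move=> h v z; change (y - (h * v + z) = h * - v + (y - z)); ring.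
have := CnD (C x') (CnM (Cn_cst _ n (-1)) (C x)).
by under eq_fun do rewrite mulN1r.
Qed.

Lemma is_derive_step_difference dl x x' t :
  is_derive t (1 : R) (fun t => th dl (x' - t) - th dl (x - t)) (- (kd dl (x' - t) - kd dl (x - t))).
Proof.
have D y : is_derive t (1 : R) (th dl \o (fun t => y - t)) (- 1 * kd dl (y - t)).
  apply: (@is_derive_comp_affine R R (th dl) (fun t => y - t) -%R); last exact: is_derive_th.
  by move=> h v z; change (y - (h * v + z) = h * - v + (y - z)); ring.
by apply: (is_derive_eq (is_deriveB (D x') (D x))); rewrite !mulN1r opprB opprK addrC.
Qed.

Lemma step_difference_supp dl c rho x x' t : 0 < dl ->
  `|x - c| <= rho -> `|x' - c| <= rho -> th dl (x' - t) - th dl (x - t) != 0 ->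
  `|t - c| <= rho + dl.
Proof.
move=> d0; rewrite !ler_norml => /andP[x1 x2] /andP[y1 y2] /eqP H.
have [t1|t1] := ltP (c + rho + dl) t.
  by exfalso; apply: H; rewrite !th_eq0 ?subrr//; lra.
have [t2|t2] := ltP t (c - rho - dl).
  by exfalso; apply: H; rewrite !th_eq1 ?subrr//; lra.
by apply/andP; split; lra.
Qed.

Variable Omega : set (R * R).
Hypothesis curl0 : forall psi, test_function Omega psi ->
  \int[mu2]_z (F1 z * dy psi z - F2 z * dx psi z) = 0.

(** The curl condition is tested with the product [psi] of two step differences. Its partial
    derivatives are combinations of the kernels of [G1] and [G2] at the four corners, and its
    support lies within [rho + dl] of [c]. *)
Lemma rectangle_increment dl (c : R * R) (rho r : R) (x x' y y' : R) : 0 < dl ->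
  ball c r `<=` Omega -> rho + dl < r ->
  `|x - c.1| <= rho -> `|x' - c.1| <= rho -> `|y - c.2| <= rho -> `|y' - c.2| <= rho ->
  G1 dl (x', y) - G1 dl (x, y) + (G2 dl (x', y') - G2 dl (x', y)) =
  G2 dl (x, y') - G2 dl (x, y) + (G1 dl (x', y') - G1 dl (x, y')).
Proof.
move=> d0 cO rr hx hx' hy hy'.
pose al t := th dl (x' - t) - th dl (x - t).
pose be t := th dl (y' - t) - th dl (y - t).
pose psi (w : R * R) := al w.1 * be w.2.
have Tpsi : test_function Omega psi.
  have sub : [set z | psi z != 0] `<=`
     `[c.1 - (rho + dl), c.1 + (rho + dl)] `*` `[c.2 - (rho + dl), c.2 + (rho + dl)].
    move=> w /=; rewrite mulf_eq0 negb_or => /andP[w1 w2].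
    have := step_difference_supp d0 hx hx' w1.
    have := step_difference_supp d0 hy hy' w2.
    rewrite !ler_norml => /andP[? ?] /andP[? ?].
    by split; rewrite /= in_itv/=; apply/andP; split; lra.
  have cK : compact (`[c.1 - (rho + dl), c.1 + (rho + dl)] `*` `[c.2 - (rho + dl), c.2 + (rho + dl)]).
    by apply: compact_setX; exact: segment_compact.
  have csub : closure [set z | psi z != 0] `<=`
     `[c.1 - (rho + dl), c.1 + (rho + dl)] `*` `[c.2 - (rho + dl), c.2 + (rho + dl)].
    rewrite closureE => z; apply; split => //.
    by apply: compact_closed => //; exact: norm_hausdorff.
  split.
  - by apply: smooth_tensor => n; exact: Cn_step_difference.
  - by apply: subclosed_compact csub => //; exact: closed_closure.
  - move=> z /csub[]; rewrite /= !in_itv/= => /andP[? ?] /andP[? ?].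
    by apply: cO; apply/ball_planeE; rewrite !ltr_norml; split; apply/andP; split; lra.
have Dx w : dx psi w = - (kd dl (x' - w.1) - kd dl (x - w.1)) * be w.2.
  have [_ h] := is_derive_tensor ((1, 0) : R * R) (is_derive_step_difference dl x x' w.1)
    (is_derive_step_difference dl y y' w.2).
  by rewrite /dx h /= mul1r mul0r addr0.
have Dy w : dy psi w = al w.1 * - (kd dl (y' - w.2) - kd dl (y - w.2)).
  have [_ h] := is_derive_tensor ((0, 1) : R * R) (is_derive_step_difference dl x x' w.1)
    (is_derive_step_difference dl y y' w.2).
  by rewrite /dy h /= mul1r mul0r add0r.
have := curl0 Tpsi.
pose f1 (p q : R) w := F1 w * kern (th dl) (kd dl) (p, q) w.
pose f2 (p q : R) w := F2 w * kern (kd dl) (th dl) (p, q) w.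
have j1 p q : mu2.-integrable setT (fun w : plane R => (f1 p q w)%:E) := i1 dl (p, q).
have j2 p q : mu2.-integrable setT (fun w : plane R => (f2 p q w)%:E) := i2 dl (p, q).
have -> : \int[mu2]_z (F1 z * dy psi z - F2 z * dx psi z) =
   \int[mu2]_w (((f1 x' y w - f1 x y w) - (f1 x' y' w - f1 x y' w)) +
                ((f2 x' y' w - f2 x' y w) - (f2 x y' w - f2 x y w))).
  apply: eq_Rintegral => w _; rewrite Dx Dy /f1 /f2 /kern /al /be /=.
  move: (th dl (x' - w.1)) (th dl (x - w.1)) (th dl (y' - w.2)) (th dl (y - w.2)).
  move: (kd dl (x' - w.1)) (kd dl (x - w.1)) (kd dl (y' - w.2)) (kd dl (y - w.2)).
  by move: (F1 w) (F2 w) => ? ? ? ? ? ? ? ? ? ?; ring.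
have k1 p q p' q' := integrable_EFinB (j1 p q) (j1 p' q').
have k2 p q p' q' := integrable_EFinB (j2 p q) (j2 p' q').
have g1 p q : \int[mu2]_w f1 p q w = G1 dl (p, q) by rewrite /G1 kconvE.
have g2 p q : \int[mu2]_w f2 p q w = G2 dl (p, q) by rewrite /G2 kconvE.
have e1 p q p' q' : \int[mu2]_w (f1 p q w - f1 p' q' w) = G1 dl (p, q) - G1 dl (p', q').
  by rewrite (RintB (j1 p q) (j1 p' q')) !g1.
have e2 p q p' q' : \int[mu2]_w (f2 p q w - f2 p' q' w) = G2 dl (p, q) - G2 dl (p', q').
  by rewrite (RintB (j2 p q) (j2 p' q')) !g2.
rewrite (RintD (integrable_EFinB (k1 x' y x y) (k1 x' y' x y')) (integrable_EFinB (k2 x' y' x' y) (k2 x y' x y))).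
rewrite (RintB (k1 x' y x y) (k1 x' y' x y')) (RintB (k2 x' y' x' y) (k2 x y' x y)) !e1 !e2.
move: (G1 dl (x', y)) (G1 dl (x, y)) (G1 dl (x', y')) (G1 dl (x, y')).
move: (G2 dl (x', y)) (G2 dl (x, y)) (G2 dl (x', y')) (G2 dl (x, y')).
by move=> ? ? ? ? ? ? ? ? ?; lra.
Qed.

(** The concatenated path has in its middle a vertical piece followed by a horizontal one; the
    rectangle identity exchanges them, and the collinear pieces then add up. *)
Lemma Inc_add dl (c : R * R) (rho r : R) z z' z'' : 0 < dl ->
  ball c r `<=` Omega -> rho + dl < r ->
  `|z.1 - c.1| <= rho -> `|z.2 - c.2| <= rho ->
  `|z'.1 - c.1| <= rho -> `|z'.2 - c.2| <= rho ->
  `|z''.1 - c.1| <= rho -> `|z''.2 - c.2| <= rho ->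
  Inc dl z z' + Inc dl z' z'' = Inc dl z z''.
Proof.
move=> d0 cO rr z1 z2 w1 w2 v1 v2.
have := rectangle_increment d0 cO rr w1 v1 z2 w2.
rewrite /Inc -!surjective_pairing.
move: (G1 dl (z'.1, z.2)) (G1 dl z) (G1 dl (z''.1, z'.2)) (G1 dl z') (G1 dl (z''.1, z.2)).
move: (G2 dl z') (G2 dl (z'.1, z.2)) (G2 dl z'') (G2 dl (z''.1, z'.2)) (G2 dl (z''.1, z.2)).
by move=> ? ? ? ? ? ? ? ? ? ? ?; lra.
Qed.

Lemma Inc_add_near (y : R * R) (r : R) : ball y r `<=` Omega ->
  forall a b c, ball y r a -> ball y r b -> ball y r c ->
  \forall dl \near 0^'+, Inc dl a b + Inc dl b c = Inc dl a c.
Proof.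
move=> yO a b c /ball_planeE[a1 a2] /ball_planeE[b1 b2] /ball_planeE[c1 c2].
(* The three points lie within [m < r] of the centre, so [dl < r - m] suffices; this bound depends
   on the points, whence the eventual form. *)
pose m := Num.max (Num.max (Num.max `|a.1 - y.1| `|a.2 - y.2|) (Num.max `|b.1 - y.1| `|b.2 - y.2|))
  (Num.max `|c.1 - y.1| `|c.2 - y.2|).
have mr : 0 < r - m by rewrite subr_gt0 /m !gt_max a1 a2 b1 b2 c1 c2.
near=> dl; apply: (@Inc_add dl y m r) => //; rewrite /m ?le_max ?lexx ?orbT//.
rewrite -ltrBrDl; near: dl; exact: nbhs_right_lt.
Unshelve. all: by end_near. Qed.

End Increments.

(** * Potentials of the mollified fields *)

Section Coherence.
Context {R : realType}.

Lemma near_all_seq {T : Type} (F : set_system T) {FF : Filter F} {I : eqType}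
    (s : seq I) (P : I -> T -> Prop) :
  (forall q, q \in s -> \forall t \near F, P q t) ->
  \forall t \near F, forall q, q \in s -> P q t.
Proof.
elim: s => [|q s IH] H; first by apply: nearW => t q.
have h1 := H q (mem_head _ _).
have h2 : \forall t \near F, forall q', q' \in s -> P q' t.
  by apply: IH => q' qs; apply: H; rewrite in_cons qs orbT.
apply: (@filterS2 _ F FF _ _ _ _ h1 h2) => t a b q'; rewrite in_cons => /orP[/eqP->//|]; exact: b.
Qed.

(** The near-covering form of compactness is applied to finite lists of points of [K], with the
    filter directed by inclusion. *)
Lemma compact_cover_balls (K : set (R * R)) (rho : R * R -> R) : compact K ->
  (forall q, K q -> 0 < rho q) ->
  exists2 s : seq (R * R), forall q, q \in s -> K q &
    forall z, K z -> exists2 q, q \in s & ball q (rho q) z.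
Proof.
move=> cK rho0.
pose F : set_system (seq (R * R)) := [set P | exists2 s0 : seq (R * R),
  forall q, q \in s0 -> K q & forall s : seq (R * R), (forall q, q \in s -> K q) -> {subset s0 <= s} -> P s].
have FF : Filter F.
  split; first by exists [::].
    move=> P Q [s s1 s2] [t t1 t2]; exists (s ++ t) => [q|u u1 u2].
      by rewrite mem_cat => /orP[/s1|/t1].
    split; [apply: s2|apply: t2] => // q qs; apply: u2; rewrite mem_cat qs ?orbT//.
  by move=> P Q PQ [s s1 s2]; exists s => // t t1 t2; apply: PQ; exact: s2.
move/compact_near_coveringP: cK => /(_ _ F (fun s z => exists2 q, q \in s & ball q (rho q) z) FF)[].
  move=> z Kz; exists (ball z (rho z), [set s : seq (R * R) | z \in s]) => /=.
    split; first by apply: nbhsx_ballx; exact: rho0.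
    exists [:: z] => [q|s _]; first by rewrite inE => /eqP ->.
    by apply; rewrite mem_head.
  by move=> [z' s] /= [? ?]; exists z.
by move=> s s1 s2; exists s => //; exact: s2.
Qed.

Variables (F1 F2 : R * R -> R).
Hypotheses (L1 : L12 F1) (L2 : L12 F2).
Variable Omega : set (R * R).
Hypothesis Omega_open : open Omega.
Hypothesis curl0 : forall psi, test_function Omega psi ->
  \int[mu2]_z (F1 z * dy psi z - F2 z * dx psi z) = 0.
Hypothesis Omega_sc : simply_connected Omega.

Local Notation Inc := (Inc F1 F2).

(** At [z] the first centre [q] of the list whose ball contains [z] is used. The primitive from
    [cocycle_primitive] is coherent only pair by pair as [dl] tends to zero and is not known to be
    measurable in [z]; here only its values at the finitely many centres enter. *)
Fixpoint patch_potential (A : R * R -> R) (rho : R * R -> R) (dl : R)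
    (s : seq (R * R)) (z : R * R) : R :=
  if s is q :: s' then
    \1_(ball q (rho q)) z * (A q + Inc dl q z) +
    (1 - \1_(ball q (rho q)) z) * patch_potential A rho dl s' z
  else 0.

Lemma measurable_patch_potential A rho dl s :
  measurable_fun setT (patch_potential A rho dl s : plane R -> R).
Proof.
elim: s => [|q s IH] /=; first exact: measurable_cst.
have mI : measurable_fun setT (\1_(ball q (rho q)) : plane R -> R).
  by apply: measurable_indic; exact: measurable_ball_plane.
apply: measurable_funD; apply: measurable_funM => //.
  apply: measurable_funD => //.
  exact: (measurable_Inc2 L1 L2 dl (@measurable_cst _ _ (plane R) (plane R) setT q) (@measurable_id _ (plane R) setT)).
exact: measurable_funB.
Qed.

Lemma patch_potentialP A rho dl s z : (exists2 q, q \in s & ball q (rho q) z) ->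
  exists q, [/\ q \in s, ball q (rho q) z & patch_potential A rho dl s z = A q + Inc dl q z].
Proof.
elim: s => [|q s IH] [q' //=]; rewrite in_cons => qs qz.
have [qqz|nqz] := pselect (ball q (rho q) z).
  exists q; split => //; first exact: mem_head.
  by rewrite indicE mem_set// mul1r subrr mul0r addr0.
rewrite indicE memNset// mul0r add0r subr0 mul1r.
case/orP: qs => [/eqP qq|qs]; first by move: nqz; rewrite -qq.
have [|p [ps pz E]] := IH; first by exists q'.
by exists p; split => //; rewrite in_cons ps orbT.
Qed.

(** Finitely many identities, between the centres and one point of each overlap, hold together for
    small [dl]; additivity on the balls carries them to all pairs of nearby points of [K]. *)
Lemma coherent_potential (p0 : R * R) (K : set (R * R)) : Omega p0 -> compact K -> K `<=` Omega ->
  exists2 r : R, 0 < r & \forall dl \near 0^'+, exists2 w : R * R -> R,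
    measurable_fun setT (w : plane R -> R) &
    forall z z', K z -> K z' -> ball z r z' -> w z' - w z = Inc dl z z'.
Proof.
move=> Op0 cK KO.
have [A AP] := @cocycle_primitive R R (0^'+) _ Omega (fun a b dl => Inc dl a b)
  Omega_open (Inc_add_near L1 L2 curl0) Omega_sc p0 Op0.
(* Room for what follows: [z'] lies within [2 * rho q] of [q], additivity is used on the ball of
   radius [3 * rho q], and the last [rho q] leaves place for [dl]. *)
have /choice[rho rhoP] q : exists r : R, K q -> 0 < r /\ ball q (4 * r) `<=` Omega.
  have [Kq|nKq] := pselect (K q); last by exists 0.
  have /nbhs_ballP[e /= e0 eO] : nbhs q Omega by apply: open_nbhs_nbhs; split => //; exact: KO.
  exists (e / 4) => _; split; first by rewrite divr_gt0.
  by rewrite mulrC divfK.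
have [s sK Ks] := compact_cover_balls cK (fun q Kq => (rhoP q Kq).1).
have [r r0 rs] : exists2 r : R, 0 < r & forall q, q \in s -> r <= rho q.
  elim: s sK {Ks} => [|q s IH] sK; first by exists 1.
  have [|r r0 rs] := IH; first by move=> q' qs; apply: sK; rewrite in_cons qs orbT.
  have [q0 _] := rhoP q (sK q (mem_head _ _)).
  exists (Num.min r (rho q)); first by rewrite lt_min r0.
  move=> q'; rewrite in_cons => /orP[/eqP->|/rs h]; first by rewrite ge_min lexx orbT.
  by rewrite ge_min h.
exists r => //.
have small : \forall dl \near 0^'+, forall q, q \in s -> dl < rho q.
  apply: near_all_seq => q qs; apply: nbhs_right_lt; exact: (rhoP q (sK q qs)).1.
pose I3 q := ball q (3 * rho q).
have le34 q : q \in s -> I3 q `<=` ball q (4 * rho q).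
  by move=> qs; apply: le_ball; have := (rhoP q (sK q qs)).1; lra.
(* One point in each nonempty overlap is enough to compare the constants of two balls; for an empty
   overlap its value is arbitrary. *)
have [mid midP] : exists mid : R * R -> R * R -> R * R, forall q q',
    I3 q `&` I3 q' !=set0 -> (I3 q `&` I3 q') (mid q q').
  have /choice[f fP] (qq : (R * R) * (R * R)) : exists m, I3 qq.1 `&` I3 qq.2 !=set0 ->
      (I3 qq.1 `&` I3 qq.2) m.
    have [[m Hm]|nH] := pselect (I3 qq.1 `&` I3 qq.2 !=set0); first by exists m.
    by exists 0.
  by exists (fun q q' => f (q, q')) => q q' /(fP (q, q')).
have agree : \forall dl \near 0^'+, forall q, q \in s -> forall q', q' \in s ->
    I3 q `&` I3 q' !=set0 ->
    A q dl + Inc dl q (mid q q') = A q' dl + Inc dl q' (mid q q').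
  apply: near_all_seq => q qs; apply: near_all_seq => q' qs'.
  have [H|nH] := pselect (I3 q `&` I3 q' !=set0); last by apply: nearW => dl.
  have [m1 m2] := midP _ _ H.
  have [q0 qO] := rhoP q (sK q qs); have [q0' qO'] := rhoP q' (sK q' qs').
  have c1 : ball q (4 * rho q) q by apply: ballxx; lra.
  have c2 : ball q' (4 * rho q') q' by apply: ballxx; lra.
  have a1 := AP _ _ qO _ _ c1 (le34 _ qs _ m1).
  have a2 := AP _ _ qO' _ _ c2 (le34 _ qs' _ m2).
  by apply: (@filterS2 _ _ (@at_right_proper_filter R 0) _ _ _ _ a1 a2) => dl e1 e2 _; rewrite -e1 -e2; lra.
near=> dl.
exists (patch_potential (fun q => A q dl) rho dl s).
  exact: measurable_patch_potential.
have d0 : 0 < dl by near: dl; exact: nbhs_right_gt.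
have sm : forall q, q \in s -> dl < rho q by near: dl.
have ag : forall q, q \in s -> forall q', q' \in s -> I3 q `&` I3 q' !=set0 ->
    A q dl + Inc dl q (mid q q') = A q' dl + Inc dl q' (mid q q') by near: dl.
have add q a b c : q \in s -> I3 q a -> I3 q b -> I3 q c -> Inc dl a b + Inc dl b c = Inc dl a c.
  move=> qs /ball_planeE[a1 a2] /ball_planeE[b1 b2] /ball_planeE[c1 c2].
  have [q0 qO] := rhoP q (sK q qs); have q1 := sm q qs.
  apply: (Inc_add L1 L2 curl0 d0 qO (rho := 3 * rho q)); try exact: ltW.
  by lra.
move=> z z' Kz Kz' zz'.
have [q [qs qz ->]] := patch_potentialP (fun q => A q dl) dl (Ks z Kz).
have [q' [qs' qz' ->]] := patch_potentialP (fun q => A q dl) dl (Ks z' Kz').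
have [q0 _] := rhoP q (sK q qs); have [q0' _] := rhoP q' (sK q' qs').
have le13 p : p \in s -> ball p (rho p) `<=` I3 p.
  by move=> ps; apply: le_ball; have := (rhoP p (sK p ps)).1; lra.
have z'q : I3 q z'.
  apply: (@le_ball _ _ _ (rho q + rho q)); first by lra.
  apply: ball_triangle qz _; apply: le_ball zz'; exact: rs.
have ne : I3 q `&` I3 q' !=set0 by exists z'; split => //; exact: le13.
have [m1 m2] := midP _ _ ne; have E := ag q qs q' qs' ne.
have cq : I3 q q by apply: ballxx; lra.
have cq' : I3 q' q' by apply: ballxx; lra.
have e1 := add q q z z' qs cq (le13 _ qs _ qz) z'q.
have e2 := add q q (mid q q') z' qs cq m1 z'q.
have e3 := add q' q' (mid q q') z' qs' cq' m2 (le13 _ qs' _ qz').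
clear - e1 e2 e3 E.
move: (Inc dl z z') (Inc dl q z) (Inc dl q z') (Inc dl q (mid q q')) (Inc dl (mid q q') z') (Inc dl q' z') (Inc dl q' (mid q q')) e1 e2 e3 E => i1 i2 i3 i4 i5 i6 i7; lra.
Unshelve. all: by end_near. Qed.

End Coherence.

Lemma sqr_sum_le {R : realFieldType} (m : nat) (a : nat -> R) :
  (\sum_(i < m) a i) ^+ 2 <= m%:R * \sum_(i < m) a i ^+ 2.
Proof.
elim: m => [|m IH]; first by rewrite !big_ord0 expr0n mulr0.
rewrite !big_ord_recr /= -natr1.
have Q0 : 0 <= \sum_(i < m) a i ^+ 2 by apply: sumr_ge0 => i _; exact: sqr_ge0.
have [->|m0] := eqVneq m 0%N; first by rewrite !big_ord0 !add0r mul1r.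
have {}m0 : (0 : R) < m%:R by rewrite ltr0n lt0n.
move: (\sum_(i < m) a i) (\sum_(i < m) a i ^+ 2) (a m) (m%:R : R) m0 IH Q0 => S Q x k k0 SQ Q0.
have h : 2 * S * x <= S ^+ 2 / k + k * x ^+ 2.
  rewrite -subr_ge0 (_ : _ - _ = k^-1 * (S - k * x) ^+ 2); last by field; rewrite gt_eqF.
  by rewrite mulr_ge0 ?sqr_ge0// invr_ge0 ltW.
have h' : S ^+ 2 / k <= Q by rewrite ler_pdivrMr// mulrC.
nra.
Qed.

(** * Energies of the increments of a potential *)

Section Energy.
Context {R : realType}.
Implicit Types (f g : R * R -> R) (A B : set (R * R)).

Local Notation meas f := (measurable_fun setT (f : plane R -> R)).

Definition E2 f : \bar R := \int[mu2]_z (f z ^+ 2)%:E.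

Definition on A f (z : R * R) : R := \1_A z * f z.

Lemma onT A f z : A z -> on A f z = f z.
Proof. by move=> Az; rewrite /on indicE mem_set// mul1r. Qed.

Lemma onF A f z : ~ A z -> on A f z = 0.
Proof. by move=> Az; rewrite /on indicE memNset// mul0r. Qed.

Lemma measurable_on A f : measurable (A : set (plane R)) -> meas f -> meas (on A f).
Proof. by move=> mA mf; apply: measurable_funM => //; exact: measurable_indic. Qed.

Lemma measurable_E2 f : meas f -> measurable_fun setT (fun z : plane R => (f z ^+ 2)%:E).
Proof. by move=> mf; apply/measurable_EFinP; exact: measurable_funX. Qed.

Lemma E2_dominated {I : Type} (s : seq I) (g : I -> R * R -> R) (c : R) f : 0 <= c ->
  meas f -> (forall i, meas (g i)) ->
  (forall z, f z ^+ 2 <= c * \sum_(i <- s) g i z ^+ 2) ->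
  (E2 f <= c%:E * \sum_(i <- s) E2 (g i))%E.
Proof.
move=> c0 mf mg fg.
have ms : measurable_fun setT (fun z : plane R => (\sum_(i <- s) (g i z ^+ 2)%:E)%E).
  by apply: emeasurable_sum => i; exact: measurable_E2.
have s0 z : (0 <= \sum_(i <- s) (g i z ^+ 2)%:E)%E.
  by apply: sume_ge0 => i _; rewrite lee_fin sqr_ge0.
rewrite /E2 -ge0_integral_sum//; last 2 first.
- by move=> i; exact: measurable_E2.
- by move=> i z _; rewrite lee_fin sqr_ge0.
rewrite -ge0_integralZl//.
apply: ge0_le_integral => //.
- by move=> z _; rewrite lee_fin sqr_ge0.
- exact: measurable_E2.
- exact: measurable_funeM.
- by move=> z _; rewrite sumEFin -EFinM lee_fin.
Qed.

Lemma E2_le f g : meas f -> meas g -> (forall z, f z ^+ 2 <= g z ^+ 2) -> (E2 f <= E2 g)%E.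
Proof.
move=> mf mg fg.
have := @E2_dominated unit [:: tt] (fun=> g) 1 f ler01 mf (fun=> mg).
by rewrite big_seq1 mul1e; apply=> z; rewrite big_seq1 mul1r.
Qed.

Lemma E2_le2 f g h : meas f -> meas g -> meas h ->
  (forall z, f z ^+ 2 <= 2 * (g z ^+ 2 + h z ^+ 2)) -> (E2 f <= 2%:E * (E2 g + E2 h))%E.
Proof.
move=> mf mg mh fg.
have m2 : forall b : bool, meas (if b then g else h) by case.
have := @E2_dominated bool [:: true; false] (fun b => if b then g else h) 2 f (ler0n _ 2) mf m2.
by rewrite !big_cons !big_nil /= adde0; apply => z; rewrite !big_cons !big_nil addr0.
Qed.

Lemma measurable_comp_shift (y : R * R) f : meas f -> meas (fun z => f (z + y)).
Proof. by move=> mf; exact: (measurableT_comp mf (measurable_shift_plane y)). Qed.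

Lemma E2_shift (y : R * R) f : meas f -> E2 (fun z => f (z + y)) = E2 f.
Proof.
move=> mf; rewrite /E2.
rewrite -[RHS](mu2_ge0_integral_shift y (measurable_E2 mf))// => z.
by rewrite lee_fin sqr_ge0.
Qed.

Variables (F1 F2 : R * R -> R).
Hypotheses (L1 : L12 F1) (L2 : L12 F2).
Variables (K : set (R * R)) (w : R * R -> R) (r dl : R).
Hypotheses (mw : meas w) (r0 : 0 < r) (dl0 : 0 < dl).
Hypothesis w_inc : forall z z', K z -> K z' -> ball z r z' -> w z' - w z = Inc F1 F2 dl z z'.

(* The translation by [y] is cut into steps shorter than [r], for which the
   increment of [w] is [Inc]. *)
Lemma potential_increment A (y : R * R) : measurable (A : set (plane R)) ->
  (forall z t, A z -> 0 <= t <= 1 -> K (z + t *: y)) ->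
  (E2 (on A (fun z => w (z + y) - w z)%R) <=
    (2 * (y.1 ^+ 2 + y.2 ^+ 2) * field_energy F1 F2)%:E)%E.
Proof.
move=> mA AK.
pose m := (Num.bound ((`|y.1| + `|y.2|) / r)).+1.
have m0 : (0 : R) < m%:R by rewrite ltr0n.
have ym : (`|y.1| + `|y.2|) / m%:R < r.
  rewrite ltr_pdivrMr// mulrC -ltr_pdivrMr//.
  apply: lt_le_trans (archi_boundP _) _; first by rewrite divr_ge0 ?addr_ge0// ltW.
  by rewrite ler_nat.
pose p i : R * R := (i%:R / m%:R) *: y.
pose u : R * R := m%:R^-1 *: y.
have u1 : u.1 = m%:R^-1 * y.1 by [].
have u2 : u.2 = m%:R^-1 * y.2 by [].
have pS i : p i.+1 = p i + u.
  by rewrite /p /u -natr1 mulrDl mul1r scalerDl.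
have p0 : p 0%N = 0 by rewrite /p mul0r scale0r.
have pm : p m = y by rewrite /p divff ?gt_eqF// scale1r.
pose g i z := on A (fun z => Inc F1 F2 dl (z + p i) (z + p i + u)) z.
have mI i : meas (fun z => Inc F1 F2 dl (z + p i) (z + p i + u)).
  apply: (measurable_Inc2 L1 L2 dl (measurable_shift_plane (p i))).
  exact: (measurableT_comp (measurable_shift_plane u) (measurable_shift_plane (p i))).
have mI0 : meas (fun z => Inc F1 F2 dl z (z + u)).
  exact: (measurable_Inc2 L1 L2 dl (@measurable_id _ (plane R) setT) (measurable_shift_plane u)).
have mg i : meas (g i) by apply: measurable_on.
have bound i : (E2 (g i) <= (2 * ((y.1 ^+ 2 + y.2 ^+ 2) / m%:R ^+ 2) * field_energy F1 F2)%:E)%E.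
  apply: (@le_trans _ _ (E2 (fun z => Inc F1 F2 dl (z + p i) (z + p i + u))%R)).
    apply: E2_le => // z; rewrite /g; have [Az|nAz] := pselect (A z); first by rewrite onT.
    by rewrite onF// expr0n sqr_ge0.
  rewrite (E2_shift (p i) mI0); apply: le_trans (Inc_L2 L1 L2 u dl0) _.
  rewrite lee_fin le_eqVlt; apply/orP; left; apply/eqP.
  by rewrite u1 u2; move: (field_energy _ _) => e; field; rewrite gt_eqF.
(* The Cauchy-Schwarz inequality for [m] terms costs a factor [m], and each term has energy of order
   [m^-2], so the sum of [m] of them gives a bound free of [m]. *)
apply: (@le_trans _ _ (m%:R%:E * \sum_(i <- iota 0 m) E2 (g i))%E).
  apply: E2_dominated => //.
  - by apply: measurable_on => //; apply: measurable_funB => //; exact: measurable_comp_shift.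
  - move=> z; rewrite /g; have [Az|nAz] := pselect (A z); last first.
      rewrite onF// expr0n /= mulr_ge0//.
      by apply: sumr_ge0 => i _; exact: sqr_ge0.
    rewrite onT//.
    have -> : w (z + y) - w z = \sum_(i < m) Inc F1 F2 dl (z + p i) (z + p i + u).
      rewrite (eq_bigr (fun i : 'I_m => w (z + p i.+1) - w (z + p i))).
        by rewrite -(big_mkord xpredT (fun i => w (z + p i.+1) - w (z + p i))) telescope_sumr// pm p0 addr0.
      move=> i _.
      have Kp k : (k <= m)%N -> K (z + p k).
        move=> km; apply: AK => //; rewrite divr_ge0//= ler_pdivrMr// mul1r.
        by rewrite ler_nat.
      have Kp1 : K (z + p i) by apply: Kp; rewrite ltnW.
      have Kp2 : K (z + p i + u) by rewrite -addrA -pS; apply: Kp; exact: ltn_ord.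
      rewrite pS addrA w_inc//.
      apply/ball_planeE; rewrite -[(_ + u).1]/((z + p i).1 + u.1) -[(_ + u).2]/((z + p i).2 + u.2) u1 u2.
      rewrite !(addrAC _ (_^-1 * _)) !subrr !add0r.
      have hk (x : R) : `|m%:R^-1 * x| = `|x| / m%:R.
        by rewrite normrM ger0_norm 1?mulrC// invr_ge0 ltW.
      rewrite !hk; split; apply: le_lt_trans ym; rewrite ler_pM2r ?invr_gt0//.
        by rewrite lerDl.
      by rewrite lerDr.
    apply: le_trans (sqr_sum_le m (fun i => Inc F1 F2 dl (z + p i) (z + p i + u))) _.
    rewrite ler_pM2l// -(big_mkord xpredT (fun i => Inc F1 F2 dl (z + p i) (z + p i + u) ^+ 2)).
    rewrite /index_iota subn0 ler_sum// => i _.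
    by rewrite onT.
apply: (@le_trans _ _ (m%:R%:E * \sum_(i <- iota 0 m) (2 * ((y.1 ^+ 2 + y.2 ^+ 2) / m%:R ^+ 2) * field_energy F1 F2)%:E)%E).
  by rewrite lee_pmul2l ?lte_fin//; apply: lee_sum => i _; exact: bound.
rewrite sumEFin big_const_seq count_predT size_iota iter_addr_0 -EFinM lee_fin.
rewrite -mulr_natl le_eqVlt; apply/orP; left; apply/eqP.
by move: (field_energy _ _) => e; field; rewrite gt_eqF.
Qed.

End Energy.

(** * Transfer and normalization of L^2 bounds by translation *)

Section Poincare.
Context {R : realType}.
Variables (F1 F2 : R * R -> R).
Hypotheses (L1 : L12 F1) (L2 : L12 F2).
Variables (K : set (R * R)) (w : R * R -> R) (r dl : R).
Local Notation meas f := (measurable_fun setT (f : plane R -> R)).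
Hypotheses (mw : meas w) (r0 : 0 < r) (dl0 : 0 < dl).
Hypothesis w_inc : forall z z', K z -> K z' -> ball z r z' -> w z' - w z = Inc F1 F2 dl z z'.

Lemma field_energy_ge0 : 0 <= field_energy F1 F2.
Proof. by rewrite addr_ge0// ip_ge0. Qed.

(** [w z - k] is [w (z + y) - k] minus an increment of bounded energy; the translated term is
    controlled on [B], and the outer factor [2] comes from the square of a difference. *)
Lemma potential_transfer (A B : set (R * R)) (y : R * R) (k M : R) :
  measurable (A : set (plane R)) -> measurable (B : set (plane R)) ->
  (forall z t, A z -> 0 <= t <= 1 -> K (z + t *: y)) ->
  (forall z, A z -> B (z + y)) ->
  (E2 (on B (fun z => w z - k)%R) <= M%:E)%E ->
  (E2 (on A (fun z => w z - k)%R) <=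
    (2 * (M + 2 * (y.1 ^+ 2 + y.2 ^+ 2) * field_energy F1 F2))%:E)%E.
Proof.
move=> mA mB AK AB hM.
have mk : meas (fun z => w z - k) by exact: measurable_funB.
have mBk : meas (on B (fun z => w z - k)) by exact: measurable_on.
have mwy := measurable_comp_shift y mw.
have hi := potential_increment L1 L2 mw r0 dl0 w_inc mA AK.
have h := @E2_le2 R (on A (fun z => w z - k)) (fun z => on B (fun z => w z - k) (z + y))
  (on A (fun z => w (z + y) - w z)).
apply: le_trans (h _ _ _ _) _.
- exact: measurable_on.
- exact: measurable_comp_shift.
- by apply: measurable_on => //; exact: measurable_funB.
- move=> z; have [Az|nAz] := pselect (A z).
    rewrite !onT//; last exact: AB.
    by move: (w z) (w (z + y)) => a b; have := sqr_ge0 ((b - k) + (b - a)); nra.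
  by rewrite onF// expr0n mulr_ge0// addr_ge0 ?sqr_ge0.
rewrite EFinM lee_wpmul2l// EFinD (E2_shift y mBk).
exact: leeD.
Qed.

Lemma mu2_ball_gt0 (q : R * R) (s : R) : 0 < s -> (0 < mu2 (ball q s : set (plane R)))%E.
Proof.
move=> s0.
have -> : (ball q s : set (plane R)) =
   (ball q.1 s : set (measurableTypeR R)) `*` (ball q.2 s : set (measurableTypeR R)).
  by [].
have pos (x : R) : (0 < @lebesgue_measure R (ball x s))%E.
  by rewrite lebesgue_measure_ball ?ltW// lte_fin pmulrn_lgt0.
by rewrite mu2X; [exact: mule_gt0|exact: measurable_ball..].
Qed.

(* The average over [z] in the ball of the energy of [w - w z] is bounded by
   Fubini's theorem and [potential_increment]; [k] is the value of [w] at a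
   point where it does not exceed the average. *)
Lemma potential_normalization (q : R * R) (s V V0 : R) : 0 < s -> ball q s `<=` K ->
  mu2 (ball q s : set (plane R)) = V%:E -> mu2 (ball (0 : R * R) (2 * s) : set (plane R)) = V0%:E ->
  exists k, (E2 (on (ball q s) (fun z => w z - k)%R) <=
    (16 * s ^+ 2 * field_energy F1 F2 * V0 / V + 1)%:E)%E.
Proof.
move=> s0; pose B := ball q s; pose B0 := ball (0 : R * R) (2 * s); pose e := field_energy F1 F2.
rewrite -/B -/B0 -/e => BK muB muB0.
have mB : measurable (B : set (plane R)) by exact: measurable_ball_plane.
have mB0 : measurable (B0 : set (plane R)) by exact: measurable_ball_plane.
have e0 : 0 <= e := field_energy_ge0.
have V_gt0 : 0 < V by rewrite -lte_fin -muB mu2_ball_gt0.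
have V0_ge0 : 0 <= V0 by rewrite -lee_fin -muB0.
pose M := 16 * s ^+ 2 * e * V0 / V + 1; rewrite -/M.
have M0 : 0 <= M by rewrite addr_ge0// divr_ge0 ?mulr_ge0 ?sqr_ge0// ltW.
(* If no constant works, none of the values [w z] does, and integrating the energies over [z] in the
   ball contradicts the bound on the average; the [+ 1] in [M] makes the contradiction strict. *)
apply: contrapT => /forallNP H.
have {}H z : (M%:E < E2 (on B (fun z' => w z' - w z)%R))%E.
  by rewrite ltNge; apply/negP; exact: H.
(* The variables are a base point [z] and a displacement [y]: the value is [(w (y + z) - w z) ^+ 2]
   if both points lie in the ball, and [0] otherwise. *)
pose f (p : plane R * plane R) : \bar R :=
  ((on B (fun z => on B (fun z' => w z' - w z) (p.2 + z)) p.1) ^+ 2)%:E.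
have mB' : meas (\1_B) by exact: measurable_indic.
have m1 : measurable_fun setT (fst : plane R * plane R -> plane R) := measurable_fst.
have m2 : measurable_fun setT (snd : plane R * plane R -> plane R) := measurable_snd.
have m21 : measurable_fun setT (fun p : plane R * plane R => (p.2 + p.1)%R : plane R).
  have f1 := @measurable_fst _ _ (measurableTypeR R) (measurableTypeR R).
  have f2 := @measurable_snd _ _ (measurableTypeR R) (measurableTypeR R).
  apply/measurable_fun_pairP; split; apply: measurable_funD.
  - exact: (measurableT_comp f1 m2).
  - exact: (measurableT_comp f1 m1).
  - exact: (measurableT_comp f2 m2).
  - exact: (measurableT_comp f2 m1).
have mf : measurable_fun setT f.
  apply/measurable_EFinP; apply: measurable_funX; apply: measurable_funM.
    exact: (measurableT_comp mB' m1).
  apply: measurable_funM; first exact: (measurableT_comp mB' m21).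
  by apply: measurable_funB; [exact: (measurableT_comp mw m21)|exact: (measurableT_comp mw m1)].
have f0 p : (0 <= f p)%E by rewrite lee_fin sqr_ge0.
have := mu2_fubini_tonelli mf f0.
set I1 := (X in X = _); set I2 := (X in _ = X).
have lower : ((M * V)%:E <= I1)%E.
  have -> : (M * V)%:E = (\int[mu2]_z (M * \1_B z)%:E)%E.
    under eq_integral do rewrite EFinM.
    rewrite ge0_integralZl//; last by apply/measurable_EFinP.
    by rewrite integral_indic// setIT EFinM -?muB -?muB0.
  apply: ge0_le_integral => //.
  - by move=> z _; rewrite lee_fin mulr_ge0.
  - by apply/measurable_EFinP; exact: (measurable_funM (measurable_cst M) mB').
  - exact: (mu2_measurable_tonelli mf f0).
  move=> z _; have [Bz|nBz] := pselect (B z); last first.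
    by rewrite indicE memNset// mulr0; apply: integral_ge0.
  rewrite indicE mem_set// mulr1; apply: ltW; apply: lt_le_trans (H z) _.
  have mz : meas (on B (fun z' => w z' - w z)).
    by apply: measurable_on => //; exact: measurable_funB.
  rewrite -(E2_shift z mz) le_eqVlt; apply/orP; left; apply/eqP.
  by rewrite /E2; apply: eq_integral => y _; rewrite /f /= [in RHS]onT.
(* Displacements between points of the ball have coordinates of modulus below [2 * s], so
   [2 * (y.1 ^+ 2 + y.2 ^+ 2) <= 16 * s ^+ 2]. *)
have upper : (I2 <= (16 * s ^+ 2 * e * V0)%:E)%E.
  have -> : (16 * s ^+ 2 * e * V0)%:E = (\int[mu2]_z ((16 * s ^+ 2 * e) * \1_B0 z)%:E)%E.
    under eq_integral do rewrite EFinM.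
    rewrite ge0_integralZl//; last 2 first.
    - by apply/measurable_EFinP; exact: measurable_indic.
    - by rewrite lee_fin mulr_ge0// mulr_ge0// sqr_ge0.
    by rewrite integral_indic// setIT EFinM -?muB -?muB0.
  have mf' : measurable_fun setT (fun p : plane R * plane R => f (p.2, p.1)).
    apply: (measurableT_comp mf); exact: measurable_fun_pair.
  apply: ge0_le_integral => //.
  - by move=> y _; exact: integral_ge0.
  - exact: (mu2_measurable_tonelli mf' (fun p => f0 (p.2, p.1))).
  - by apply/measurable_EFinP; apply: measurable_funM => //; exact: measurable_indic.
  move=> y _; pose A := [set z | B z /\ B (z + y)].
  have mA : measurable (A : set (plane R)).
    apply: measurableI => //.
    by have := measurable_shift_plane y measurableT mB; rewrite setTI.
  have fA z : f (z, y) = ((on A (fun z => w (z + y) - w z) z) ^+ 2)%:E.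
    rewrite /f /=; have [Bz|nBz] := pselect (B z); last by rewrite !onF// => -[].
    rewrite onT// addrC; have [Bzy|nBzy] := pselect (B (z + y)); first by rewrite !onT.
    by rewrite !onF// => -[].
  apply: (@le_trans _ _ (E2 (on A (fun z => w (z + y) - w z)%R))).
    by rewrite le_eqVlt; apply/orP; left; apply/eqP; rewrite /E2; apply: eq_integral => z _; exact: fA.
  have [By|nBy] := pselect (B0 y); last first.
    rewrite indicE memNset// mulr0 /E2 integral0_eq// => z _.
    rewrite onF ?expr0n// => -[/ball_planeE[a1 a2] /ball_planeE[b1 b2]]; apply: nBy.
    apply/ball_planeE; split; rewrite subr0.
      by move: a1 b1 => /=; rewrite !ltr_norml => /andP[? ?] /andP[? ?]; apply/andP; lra.
    by move: a2 b2 => /=; rewrite !ltr_norml => /andP[? ?] /andP[? ?]; apply/andP; lra.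
  rewrite indicE mem_set// mulr1.
  have AK z t : A z -> 0 <= t <= 1 -> K (z + t *: y).
    move=> [Az Azy] t01; apply: BK; have := ball_segment Az Azy t01.
    by rewrite [z + y]addrC addrK.
  apply: le_trans (potential_increment L1 L2 mw r0 dl0 w_inc mA AK) _.
  rewrite lee_fin -/e ler_wpM2r//.
  move/ball_planeE: By; rewrite !subr0 => -[].
  move: y.1 y.2 => a b; rewrite !ltr_norml => /andP[? ?] /andP[? ?].
  have h x : - (2 * s) < x -> x < 2 * s -> x ^+ 2 <= 4 * s ^+ 2 by move=> ? ?; nra.
  by have := h a; have := h b; lra.
move=> I12; move: lower; rewrite I12 => lower.
have := le_trans lower upper; rewrite lee_fin /M mulrDl mul1r divfK ?gt_eqF//.
by lra.
Qed.

End Poincare.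

(** * The uniform bound *)

Section Exhaustion.
Context {R : realType}.
Implicit Types (Omega A : set (R * R)) (p q y z : R * R).

(** The points at sup distance at least [1/(j+1)] from the complement. Open balls make this set
    closed, hence compact when [Omega] is bounded. *)
Definition inner Omega (j : nat) : set (R * R) :=
  [set z | ball z (j.+1%:R^-1 : R) `<=` Omega].

Lemma inner_subset Omega j : inner Omega j `<=` Omega.
Proof. by move=> z; apply; apply: ballxx; rewrite invr_gt0. Qed.

Lemma closed_inner Omega j : closed (inner Omega j).
Proof.
rewrite -openC openE => z /= /existsNP[u /not_implyP[/ball_planeE[u1 u2] nu]].
apply/nbhs_ballP.
exists (Num.min (j.+1%:R^-1 - `|u.1 - z.1|) (j.+1%:R^-1 - `|u.2 - z.2|)) => /=.
  by rewrite lt_min !subr_gt0 u1.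
move=> z' /ball_planeE; rewrite !lt_min => -[/andP[a1 _] /andP[_ a2]] H.
apply: nu; apply: H; apply/ball_planeE.
have t (a b c e : R) : `|b - a| < e - `|c - a| -> `|c - b| < e.
  rewrite ltrBrDl => h; apply: le_lt_trans h.
  by rewrite [`|b - a|]distrC; apply: ler_distD.
by split; [apply: t a1|apply: t a2].
Qed.

Lemma measurable_inner Omega j : measurable (inner Omega j : set (plane R)).
Proof. by apply: closed_measurable_plane; exact: closed_inner. Qed.

Lemma inner_near Omega y (r r' : R) : ball y r `<=` Omega -> r' < r ->
  \forall j \near \oo, ball y r' `<=` inner Omega j.
Proof.
move=> yO r'r.
have : \forall j \near \oo, (j.+1%:R^-1 : R) < r - r'.
  by apply: near_infty_natSinv_lt (PosNum _); rewrite subr_gt0.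
apply: filterS => j h z zy u uz; apply: yO.
apply: (@le_ball _ _ _ (r' + j.+1%:R^-1)); first by rewrite -lerBrDl ltW.
exact: ball_triangle zy uz.
Qed.

Lemma bounded_set_ball A : bounded_set A -> exists2 M : R, 0 < M & A `<=` ball (0 : R * R) M.
Proof.
move=> [M [_ HM]]; exists (`|M| + 2); first by rewrite ltr_wpDl.
move=> z Az; have /= h := HM (`|M| + 1) _ z Az.
have {}h : `|z| <= `|M| + 1 by apply: h; rewrite ltr_pwDr// ler_norm.
apply/ball_planeE; rewrite !subr0.
have : `|z.1| <= `|z| /\ `|z.2| <= `|z| by rewrite prod_normE/= !le_max !lexx orbT.
by move=> [h1 h2]; split; [move: h1|move: h2]; lra.
Qed.

Lemma closed_bounded_compact A (M : R) : closed A -> A `<=` ball (0 : R * R) M -> compact A.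
Proof.
move=> cA AM; apply: (@subclosed_compact _ A ([set` `[- M, M]] `*` [set` `[- M, M]])) => //.
  by apply: compact_setX; exact: segment_compact.
move=> z /AM /ball_planeE; rewrite !subr0 => -[/ltW h1 /ltW h2].
by split; rewrite /= in_itv /= -ler_norml.
Qed.

End Exhaustion.

Section UniformBound.
Context {R : realType}.
Variables (F1 F2 : R * R -> R) (Omega : set (R * R)).
Hypotheses (L1 : L12 F1) (L2 : L12 F2).
Variables (w : nat -> R * R -> R) (r dl kap : nat -> R).
Local Notation meas f := (measurable_fun setT (f : plane R -> R)).
Hypotheses (mw : forall j, meas (w j)) (r0 : forall j, 0 < r j) (dl0 : forall j, 0 < dl j).
Hypothesis w_inc : forall j z z', inner Omega j z -> inner Omega j z' ->
  ball z (r j) z' -> w j z' - w j z = Inc F1 F2 (dl j) z z'.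

Definition normalized j (z : R * R) : R := w j z - kap j.

(* Interior and boundary points of [Omega] are treated alike. *)
Definition locally_bounded_energy (q : R * R) := exists s M : R, 0 < s /\
  \forall j \near \oo, (E2 (on (ball q s `&` inner Omega j) (normalized j)) <= M%:E)%E.

Lemma measurable_ball_inner (q : R * R) (s : R) j :
  measurable (ball q s `&` inner Omega j : set (plane R)).
Proof. by apply: measurableI; [exact: measurable_ball_plane|exact: measurable_inner]. Qed.

(** A bound near [p] passes to [q] by [potential_transfer] when the translation by [p - q] keeps
    points of [inner Omega j] near [q] inside it; the radius is the smaller of the two, so that
    these points land where the bound holds. *)
Lemma locally_bounded_transfer (p q : R * R) (s : R) : 0 < s ->
  (forall s', 0 < s' -> s' <= s -> \forall j \near \oo, forall z t, ball q s' z -> inner Omega j z ->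
     0 <= t <= 1 -> inner Omega j (z + t *: (p - q))) ->
  locally_bounded_energy p -> locally_bounded_energy q.
Proof.
move=> s0 H [s1 [M [s10 HM]]].
have m0 : 0 < Num.min s s1 by rewrite lt_min s0.
have m1 : Num.min s s1 <= s by rewrite ge_min lexx.
exists (Num.min s s1), (2 * (M + 2 * ((p - q).1 ^+ 2 + (p - q).2 ^+ 2) * field_energy F1 F2)).
split=> //; have := H _ m0 m1; move: HM; apply: filterS2 => j HM Hj.
apply: (potential_transfer L1 L2 (mw j) (r0 j) (dl0 j) (@w_inc j) _ _ _ _ HM).
- exact: measurable_ball_inner.
- exact: measurable_ball_inner.
- by move=> z t [qz Kz]; exact: Hj.
move=> z [qz Kz]; split.
  move/ball_planeE: qz; rewrite !lt_min => -[/andP[_ a1] /andP[_ a2]].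
  by apply/ball_planeE; split; [move: a1|move: a2] => /=; congr (`|_| < _); ring.
by have := Hj z 1 qz Kz; rewrite scale1r; apply; rewrite ler01 lexx.
Qed.

Lemma locally_bounded_ball (y p q : R * R) (rho : R) : ball y rho `<=` Omega ->
  ball y rho p -> ball y rho q -> locally_bounded_energy p -> locally_bounded_energy q.
Proof.
move=> yO yp yq.
(* A margin of [2 * e] for both points: one [e] for the radius of the neighbourhood, the other for
   the passage from [Omega] to [inner Omega j]. *)
have [e e0 [pe qe]] : exists2 e : R, 0 < e & ball y (rho - 2 * e) p /\ ball y (rho - 2 * e) q.
  move/ball_planeE: yp => [p1 p2]; move/ball_planeE: yq => [q1 q2].
  exists ((rho - Num.max (Num.max `|p.1 - y.1| `|p.2 - y.2|) (Num.max `|q.1 - y.1| `|q.2 - y.2|)) / 4).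
    by rewrite divr_gt0// subr_gt0 !gt_max p1 p2 q1 q2.
  set m := Num.max _ _.
  have : m < rho by rewrite !gt_max p1 p2 q1 q2.
  have : [/\ `|p.1 - y.1| <= m, `|p.2 - y.2| <= m, `|q.1 - y.1| <= m & `|q.2 - y.2| <= m].
    by rewrite !le_max !lexx !orbT.
  move=> [? ? ? ?] ?; split; apply/ball_planeE; lra.
apply: (@locally_bounded_transfer _ _ e) => // s' s0 s'e.
have : rho - e < rho by lra.
move=> /(inner_near yO); apply: filterS => j yj z t qz _ t01; apply: yj.
have hz : ball y (rho - e) z.
  apply: (@le_ball _ _ _ (rho - 2 * e + s')); first by lra.
  exact: ball_triangle qe qz.
have hz' : ball y (rho - e) (z + (p - q)).
  apply: (@le_ball _ _ _ (rho - 2 * e + s')); first by lra.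
  apply: ball_triangle pe _; move/ball_planeE: qz => [a1 a2].
  by apply/ball_planeE; split; [move: a1|move: a2] => /=; congr (`|_| < _); ring.
have := ball_segment hz hz' t01.
by rewrite [z + (p - q)]addrC addrK.
Qed.

(** A Lebesgue number of the path provides finitely many balls in [Omega], each containing two
    consecutive points of a subdivision. *)
Lemma locally_bounded_path (p q : R * R) : open Omega -> simply_connected Omega ->
  Omega p -> Omega q -> locally_bounded_energy p -> locally_bounded_energy q.
Proof.
move=> oO [path _] Op Oq.
have [c [cc c0 c1 cO]] := path p q Op Oq.
pose c' := c \o clamp.
have cc' : continuous c'.
  by apply: (continuous_comp_within cc continuous_clamp) => x; exact: clamp_itv.
have cO' t : Omega (c' t) by apply: cO; exact: clamp_itv.
have c'0 : c' 0 = p by rewrite /c' /= clamp_le0.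
have c'1 : c' 1 = q by rewrite /c' /= clamp_ge1.
have [e e0 He] := @lebesgue_number R R (R * R)%type c' _ Omega (@segment_compact R 0 1) cc' oO
  (fun t _ => cO' t).
have [n n0 en] : exists2 n : nat, (0 : R) < n%:R & n%:R^-1 < e.
  exists (Num.bound e^-1).+1; first by rewrite ltr0n.
  rewrite invf_plt ?posrE ?ltr0n//; apply: lt_le_trans (archi_boundP _) _.
    by rewrite invr_ge0 ltW.
  by rewrite ler_nat.
move=> Bp; have : forall k, (k <= n)%N -> locally_bounded_energy (c' (k%:R / n%:R)).
  elim=> [|k IH] kn; first by rewrite mul0r c'0.
  have [|y [rho [yO yb]]] := He (k%:R / n%:R).
    by rewrite /= in_itv /= divr_ge0//= ler_pdivrMr// mul1r ler_nat ltnW.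
  apply: (locally_bounded_ball yO _ _ (IH (ltnW kn))); apply: yb; first exact: ballxx.
  rewrite -ball_normE /= -mulrBl -opprB -natr1 addrC addKr mulN1r normrN.
  by rewrite gtr0_norm ?invr_gt0.
have E : n%:R / n%:R = 1 :> R by rewrite divff// gt_eqF.
by move=> /(_ n (leqnn n)); rewrite E c'1.
Qed.

End UniformBound.

(** * Lipschitz boundary points and the global bound *)

Section Boundary.
Context {R : realType}.
Variables (F1 F2 : R * R -> R) (Omega : set (R * R)).
Hypotheses (L1 : L12 F1) (L2 : L12 F2).
Variables (w : nat -> R * R -> R) (r dl kap : nat -> R).
Local Notation meas f := (measurable_fun setT (f : plane R -> R)).
Hypotheses (mw : forall j, meas (w j)) (r0 : forall j, 0 < r j) (dl0 : forall j, 0 < dl j).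
Hypothesis w_inc : forall j z z', inner Omega j z -> inner Omega j z' ->
  ball z (r j) z' -> w j z' - w j z = Inc F1 F2 (dl j) z z'.

Lemma enorm_lt (u : R * R) (rho : R) : `|u.1| < rho / 2 -> `|u.2| < rho / 2 -> enorm u < rho.
Proof.
move=> h1 h2; have rho0 : 0 < rho by have := normr_ge0 u.1; lra.
rewrite /enorm -[ltRHS]gtr0_norm// -sqrtr_sqr ltr_sqrt ?exprn_gt0// /dot.
by move: h1 h2; rewrite !ltr_norml => /andP[? ?] /andP[? ?]; nra.
Qed.

(** A strict inequality in the other direction would persist for all points near [p], the graph
    being Lipschitz, whereas points of [Omega] come arbitrarily close to [p]. *)
Lemma lipschitz_graph_le (rho L a b : R) (gamma : R -> R) (p : R * R) : 0 < rho ->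
  a ^+ 2 + b ^+ 2 = 1 -> (forall s s', `|gamma s - gamma s'| <= L * `|s - s'|) ->
  (forall z, enorm (z - p) < rho ->
     (Omega z <-> gamma (a * z.1 + b * z.2) < - b * z.1 + a * z.2)) ->
  closure Omega p -> gamma (a * p.1 + b * p.2) <= - b * p.1 + a * p.2.
Proof.
move=> rho0 ab1 lip gr cp; rewrite leNgt; apply/negP; rewrite -subr_gt0.
set D := _ - _ => D0.
have L0 : 0 < 1 + `|L| by rewrite ltr_pwDl.
(* Within [e] of [p] both coordinates of the chart change by at most [2 * e], so the gap [D] shrinks
   by at most [2 * e * (1 + |L|) <= D / 2]; the bound [rho / 4] keeps the points in the chart. *)
pose e := Num.min (rho / 4) (D / (4 * (1 + `|L|))).
have e0 : 0 < e by rewrite lt_min !divr_gt0// mulr_gt0.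
have e1 : e <= rho / 4 by rewrite ge_min lexx.
have e2 : 4 * (e * (1 + `|L|)) <= D.
  by rewrite mulrCA -ler_pdivlMr ?mulr_gt0// ge_min lexx orbT.
have [z [Oz /ball_planeE[z1 z2]]] := cp _ (nbhsx_ballx p e e0).
have en : enorm (z - p) < rho by apply: enorm_lt => /=; lra.
have /(gr z en) := Oz; have := lip (a * p.1 + b * p.2) (a * z.1 + b * z.2).
have [a1 b1] : `|a| <= 1 /\ `|b| <= 1.
  by rewrite !ler_norml; split; apply/andP; split; nra.
have h (c x y : R) : `|c| <= 1 -> `|x - y| < e -> `|c * y - c * x| <= e.
  move=> c1 xy; rewrite -mulrBr normrM distrC; have := normr_ge0 c; have := normr_ge0 (x - y); nra.
have s1 : `|a * p.1 + b * p.2 - (a * z.1 + b * z.2)| <= 2 * e.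
  have -> : a * p.1 + b * p.2 - (a * z.1 + b * z.2) = (a * p.1 - a * z.1) + (b * p.2 - b * z.2) by ring.
  apply: le_trans (ler_normD _ _) _; have := h a _ _ a1 z1; have := h b _ _ b1 z2; lra.
have t1 : - b * z.1 + a * z.2 <= - b * p.1 + a * p.2 + 2 * e.
  have := h b _ _ b1 z1; have := h a _ _ a1 z2; rewrite !ler_norml => /andP[? ?] /andP[? ?]; lra.
move=> lp gz; have : L * `|a * p.1 + b * p.2 - (a * z.1 + b * z.2)| <= `|L| * (2 * e).
  apply: le_trans (ler_norm _) _; rewrite normrM normr_id; exact: ler_wpM2l.
move: lp; rewrite ler_norml => /andP[_].
move: D0 e2; rewrite /D; move: (gamma _) (gamma _) gz t1 => g1 g2; nra.
Qed.

(* The translation by a small multiple of [(- b, a)], which points inside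
   [Omega], maps a neighbourhood of [p] in [inner Omega j] into [inner Omega j]
   and near an interior point. *)
Lemma locally_bounded_frontier (p : R * R) : lipschitz_boundary Omega -> frontier Omega p ->
  (forall q, Omega q -> locally_bounded_energy Omega w kap q) ->
  locally_bounded_energy Omega w kap p.
Proof.
move=> lipO fp BO; have [rho [L [a [b [gamma [rho0 ab1 lip gr]]]]]] := lipO p fp.
have le := lipschitz_graph_le rho0 ab1 lip gr fp.1.
have [a1 b1] : `|a| <= 1 /\ `|b| <= 1.
  by rewrite !ler_norml; split; apply/andP; split; nra.
(* Of length [rho / 4], so that the translates of points within [rho / 8] of [p] stay in the
   chart. *)
pose y : R * R := (- b * (rho / 4), a * (rho / 4)).
have hy (c : R) : `|c| <= 1 -> `|c * (rho / 4)| <= rho / 4.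
  have q0 : 0 <= rho / 4 by rewrite divr_ge0// ltW.
  by move=> c1; rewrite normrM (ger0_norm q0) ler_piMl.
have y1 : `|y.1| <= rho / 4 by apply: hy; rewrite normrN.
have y2 : `|y.2| <= rho / 4 by apply: hy.
(* Since [a ^+ 2 + b ^+ 2 = 1], adding [t *: y] keeps the coordinate along the graph and raises the
   other one by [t * (rho / 4)]. *)
have up z (t : R) : enorm (z - p) < rho -> enorm (z + t *: y - p) < rho -> 0 <= t ->
    gamma (a * z.1 + b * z.2) + 0 < - b * z.1 + a * z.2 + t * (rho / 4) -> Omega (z + t *: y).
  move=> h1 h2 t0 gz; apply/gr => //.
  have -> : a * (z + t *: y).1 + b * (z + t *: y).2 = a * z.1 + b * z.2.
    change (a * (z.1 + t * (- b * (rho / 4))) + b * (z.2 + t * (a * (rho / 4))) = a * z.1 + b * z.2).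
    by ring.
  have -> : - b * (z + t *: y).1 + a * (z + t *: y).2 = - b * z.1 + a * z.2 + t * (rho / 4).
    change (- b * (z.1 + t * (- b * (rho / 4))) + a * (z.2 + t * (a * (rho / 4))) =
      - b * z.1 + a * z.2 + t * (rho / 4)).
    by rewrite -[in RHS](mul1r (t * (rho / 4))) -ab1; ring.
  by move: gz; rewrite addr0.
have ty (t : R) : 0 <= t <= 1 -> `|t * y.1| <= rho / 4 /\ `|t * y.2| <= rho / 4.
  move=> /andP[t0 t1]; have h (x : R) : `|x| <= rho / 4 -> `|t * x| <= rho / 4.
    by move=> hx; rewrite normrM (ger0_norm t0); apply: le_trans hx; rewrite ler_piMl.
  by split; apply: h.
have near z (t : R) : ball p (rho / 8) z -> 0 <= t <= 1 -> enorm (z + t *: y - p) < rho.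
  move=> /ball_planeE[h1 h2] /ty[t1 t2]; apply: enorm_lt.
    change (`|z.1 + t * y.1 - p.1| < rho / 2).
    have -> : z.1 + t * y.1 - p.1 = (z.1 - p.1) + t * y.1 by ring.
    by apply: le_lt_trans (ler_normD _ _) _; lra.
  change (`|z.2 + t * y.2 - p.2| < rho / 2).
  have -> : z.2 + t * y.2 - p.2 = (z.2 - p.2) + t * y.2 by ring.
  by apply: le_lt_trans (ler_normD _ _) _; lra.
have near0 z : ball p (rho / 8) z -> enorm (z - p) < rho.
  by move=> pz; have := near z 0 pz; rewrite scale0r addr0; apply; rewrite lexx ler01.
have py : Omega (p + y).
  have pp : ball p (rho / 8) p by apply: ballxx; rewrite divr_gt0.
  have := up p 1 (near0 p pp) (near p 1 pp _); rewrite scale1r; apply; rewrite ?lexx ?ler01//.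
  by rewrite addr0 mul1r; apply: le_lt_trans le _; rewrite ltrDl divr_gt0.
have s0 : 0 < rho / 16 by rewrite divr_gt0.
apply: (locally_bounded_transfer L1 L2 mw r0 dl0 w_inc s0 _ (BO _ py)) => s' s'0 s's.
have : \forall j \near \oo, (j.+1%:R^-1 : R) < rho / 16.
  exact: near_infty_natSinv_lt (PosNum s0).
apply: filterS => j hj z t pz iz t01 v /ball_planeE[v1 v2].
move: v1 v2; have -> : p + y - p = y by rewrite addrC addKr.
(* A point [v] of the ball about [z + t *: y] is carried back to [u] in the ball about [z], which
   lies in [Omega], and then raised again; the two radii of at most [rho / 16] keep [u] within
   [rho / 8] of [p]. *)
move=> v1 v2; pose u := v - t *: y.
have -> : v = u + t *: y by rewrite subrK.
have zu : ball z j.+1%:R^-1 u.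
  apply/ball_planeE; split; [move: v1|move: v2].
    change (`|v.1 - (z.1 + t * y.1)| < j.+1%:R^-1 -> `|v.1 - t * y.1 - z.1| < j.+1%:R^-1).
    by rewrite opprD [- z.1 - _]addrC addrA.
  change (`|v.2 - (z.2 + t * y.2)| < j.+1%:R^-1 -> `|v.2 - t * y.2 - z.2| < j.+1%:R^-1).
  by rewrite opprD [- z.2 - _]addrC addrA.
have pu : ball p (rho / 8) u.
  apply: (@le_ball _ _ _ (s' + j.+1%:R^-1)); last exact: ball_triangle pz zu.
  by move: (j.+1%:R^-1) hj => x; lra.
have /andP[t0 t1] := t01.
apply: up => //; [exact: near0|exact: near|].
have /gr : Omega u := iz u zu.
rewrite addr0 => /(_ (near0 _ pu)) h; apply: lt_le_trans h _.
by rewrite lerDl mulr_ge0// divr_ge0// ltW.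
Qed.

(** Finitely many balls with local bounds cover the compact closure of [Omega]; the eventual bounds
    combine because the balls do not depend on [j]. *)
Lemma uniform_energy_bound (p0 : R * R) (M0 : R) : open Omega -> simply_connected Omega ->
  lipschitz_boundary Omega -> Omega `<=` ball (0 : R * R) M0 -> Omega p0 ->
  locally_bounded_energy Omega w kap p0 ->
  exists M, \forall j \near \oo, (E2 (on (inner Omega j) (normalized w kap j)) <= M%:E)%E.
Proof.
move=> oO sc lipO OM Op0 Bp0.
have BO q : Omega q -> locally_bounded_energy Omega w kap q.
  by move=> Oq; exact: (locally_bounded_path L1 L2 mw r0 dl0 w_inc oO sc Op0 Oq Bp0).
have Bc q : closure Omega q -> locally_bounded_energy Omega w kap q.
  move=> cq; have [Oq|nOq] := pselect (Omega q); first exact: BO.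
  by apply: locally_bounded_frontier => //; split=> // /interior_subset.
have cc : compact (closure Omega).
  apply: (@closed_bounded_compact _ _ (M0 + 1)); first exact: closed_closure.
  move=> z cz; have [z' [Oz' zz']] := cz _ (nbhsx_ballx z 1 ltr01).
  exact: ball_triangle (OM _ Oz') (ball_sym zz').
have /choice[rho rhoP] q : exists s : R, closure Omega q -> 0 < s /\ exists M : R,
    \forall j \near \oo, (E2 (on (ball q s `&` inner Omega j) (normalized w kap j)) <= M%:E)%E.
  have [/Bc[s [M [s0 HM]]]|ncq] := pselect (closure Omega q); last by exists 0.
  by exists s => _; split => //; exists M.
have [s sO sC] := compact_cover_balls cc (fun q cq => (rhoP q cq).1).
have mn j : meas (normalized w kap j) by apply: measurable_funB.
pose U (s : seq (R * R)) j : set (R * R) :=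
  [set z | inner Omega j z /\ exists2 q, q \in s & ball q (rho q) z].
have mB q : measurable (ball q (rho q) : set (plane R)) by exact: measurable_ball_plane.
have UE q s' j : U (q :: s') j = (ball q (rho q) `&` inner Omega j) `|` U s' j.
  apply/seteqP; split=> z.
    move=> [iz [q']]; rewrite in_cons => /orP[/eqP->|qs] qz; [by left|right].
    by split => //; exists q'.
  move=> [[qz iz]|[iz [q' qs qz]]]; split=> //; first by exists q => //; exact: mem_head.
  by exists q' => //; rewrite in_cons qs orbT.
have mU s' j : measurable (U s' j : set (plane R)).
  elim: s' => [|q s' IH].
    by rewrite (_ : U [::] j = set0)//; apply/seteqP; split=> z // -[_ []].
  by rewrite UE; apply: measurableU => //; exact: measurable_ball_inner.
have [M HM] : exists M : R, \forall j \near \oo, (E2 (on (U s j) (normalized w kap j)) <= M%:E)%E.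
  elim: s sO {sC} => [|q s' IH] sO.
    exists 0; apply: nearW => j; rewrite /E2 integral0_eq// => z _.
    by rewrite onF ?expr0n// => -[_ []].
  have [|M HM] := IH; first by move=> q' qs; apply: sO; rewrite in_cons qs orbT.
  have [_ [M' HM']] := rhoP q (sO q (mem_head _ _)).
  exists (2 * (M' + M)); move: HM' HM; apply: filterS2 => j HM' HM.
  rewrite EFinM [(M' + M)%:E]EFinD.
  apply: (@le_trans _ _ (2%:E * (E2 (on (ball q (rho q) `&` inner Omega j) (normalized w kap j)) +
    E2 (on (U s' j) (normalized w kap j))))%E); last by apply: lee_wpmul2l => //; exact: leeD.
  apply: E2_le2; try by apply: measurable_on => //; exact: measurable_ball_inner.
  move=> z; have := sqr_ge0 (on (ball q (rho q) `&` inner Omega j) (normalized w kap j) z).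
  have := sqr_ge0 (on (U s' j) (normalized w kap j) z).
  have [h|h] := pselect (U (q :: s') j z); last by rewrite (onF _ h) expr0n /=; nra.
  rewrite (onT _ h); move: h; rewrite UE => -[h|h]; rewrite (onT _ h); nra.
exists M; move: HM; apply: filterS => j.
suff -> : U s j = inner Omega j by [].
apply/seteqP; split=> z; first by case.
by move=> iz; split => //; apply: sC; apply: subset_closure; exact: inner_subset iz.
Qed.

End Boundary.

(** * The limit potential *)

Section WeakDerivative.
Context {R : realType}.
Implicit Types (f F phi : R * R -> R).
Local Notation meas f := (measurable_fun setT (f : plane R -> R)).

(** The modulus is at most the square plus the indicator of the ball, which has finite measure. *)
Lemma integral_norm_bounded_support f (q : R * R) (s V : R) : sqint mu2 (f : plane R -> R) ->
  (forall z, ~ ball q s z -> f z = 0) -> mu2 (ball q s : set (plane R)) = V%:E ->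
  L12 f /\ \int[mu2]_z `|f z| <= ip mu2 f f + V.
Proof.
move=> Lf fB muB; pose B := ball q s.
have mB : measurable (B : set (plane R)) by exact: measurable_ball_plane.
have iB : mu2.-integrable setT (fun z : plane R => (\1_B z)%:E).
  apply/integrableP; split; first by apply/measurable_EFinP; exact: measurable_indic.
  under eq_integral => z _ do rewrite gee0_abs ?lee_fin//.
  by rewrite integral_indic// setIT (_ : mu2 _ = V%:E)// ltry.
have iff : mu2.-integrable setT (fun z : plane R => (f z * f z)%:E).
  exact: sqint_integrableM.
have iS := integrable_EFinD iff iB.
have le z : `|f z| <= f z * f z + \1_B z.
  have [Bz|nBz] := pselect (B z); last by rewrite indicE memNset// fB// normr0 mulr0 addr0.
  rewrite indicE mem_set// -[_%:R]/(1 : R) -expr2 -real_normK ?num_real//; move: `|f z| => x; nra.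
have iF : mu2.-integrable setT (fun z : plane R => (f z)%:E).
  apply: (le_integrable measurableT _ _ iS); first by apply/measurable_EFinP; exact: Lf.1.
  by move=> z _; rewrite !abse_EFin lee_fin (le_trans (le z))// ler_norm.
split; first by split.
apply: le_trans (Rint_le (integrable_normr iF) iS le) _.
rewrite (RintD iff iB) lerD2l /Rintegral integral_indic// setIT.
by rewrite (_ : mu2 _ = V%:E).
Qed.

(** Discrete integration by parts: a translation turns the difference quotient of [phi] against [f]
    into a backward one of [f] against [phi], which is a convolution of [F]. The first error is that
    of the Taylor expansion of [phi], the second comes from the width [e] of the kernel. *)
Lemma weak_derivative_estimate (v : R * R) (phi dphi f F : R * R -> R) (a b : R -> R)
    (e h C C1 M M1 : R) : L12 f -> L12 F -> density a e -> density b e -> 0 <= e -> 0 < h ->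
  meas phi -> (forall z, `|phi z| <= M) -> meas dphi -> (forall z, `|dphi z| <= M1) ->
  0 <= C1 -> (forall z u, `|phi (z + u) - phi z| <= C1 * (`|u.1| + `|u.2|)) ->
  (forall z (t : R), `|phi (z + t *: v) - phi z - t * dphi z| <= C * t ^+ 2) ->
  (forall z, phi z != 0 -> f (z - h *: v) - f z = - h * kconv F a b z) ->
  `|ip mu2 f dphi + \int[mu2]_z (F z * phi z)| <=
    C * h * \int[mu2]_z `|f z| + 2 * C1 * e * \int[mu2]_z `|F z|.
Proof.
move=> Lf LF da db e0 h0 mphi phiM mdphi dphiM C10 lip taylor step.
have mshift := measurable_comp_shift (h *: v) mphi.
have i1 := bounded_test_integrable Lf mdphi dphiM.
have i2 := bounded_test_integrable Lf mphi phiM.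
have i3 := bounded_test_integrable Lf mshift (fun z => phiM (z + h *: v)).
have mf : meas f := Lf.1.1.
have if' : mu2.-integrable setT (fun z : plane R => (f (z - h *: v))%:E).
  have /integrableP[mfi fi] := Lf.2.
  apply/integrableP; split.
    by apply/measurable_EFinP; exact: (measurable_comp_shift (- (h *: v)) mf).
  rewrite (mu2_ge0_integral_shift (- (h *: v)) (f := fun z => `|(f z)%:E|%E))//.
  exact: measurableT_comp.
have i4 := integrable_mul_bounded if' mphi phiM.
have shift : \int[mu2]_z (f z * phi (z + h *: v)) = \int[mu2]_z (f (z - h *: v) * phi z).
  rewrite -(mu2_Rintegral_shift (- (h *: v)) (f := fun z => f z * phi (z + h *: v))); last first.
    exact: measurable_funM.
  by apply: eq_Rintegral => z _; rewrite subrK.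
pose Y := h^-1 * (\int[mu2]_z (f z * phi (z + h *: v)) - \int[mu2]_z (f z * phi z)).
have YZ : Y = - \int[mu2]_z (phi z * kconv F a b z).
  rewrite /Y shift -(RintB i4 i2).
  have -> : \int[mu2]_z (f (z - h *: v) * phi z - f z * phi z) =
      \int[mu2]_z (- h * (phi z * kconv F a b z)).
    apply: eq_Rintegral => z _; have [->|pz] := eqVneq (phi z) 0; first by rewrite !mulr0 mul0r mulr0 subr0.
    by rewrite -mulrBl step// mulrAC -mulrA.
  rewrite RintZ; first by rewrite mulrA mulrN mulVf ?gt_eqF// mulN1r.
  rewrite (_ : (fun z : plane R => _) =
      (fun z => ((- h)^-1 * (f (z - h *: v) * phi z - f z * phi z))%:E)).
    exact: integrable_EFinZ (integrable_EFinB i4 i2).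
  apply/funext => z; congr EFin.
  have [->|pz] := eqVneq (phi z) 0; first by rewrite !mulr0 mul0r subr0 mulr0.
  by rewrite -mulrBl step//; field; rewrite gt_eqF.
have XY : `|ip mu2 f dphi - Y| <= C * h * \int[mu2]_z `|f z|.
  have iY := integrable_EFinZ h^-1 (integrable_EFinB i3 i2).
  rewrite /Y -(RintB i3 i2) -(RintZ h^-1 (integrable_EFinB i3 i2)) /ip -(RintB i1 iY).
  apply: le_trans (Rint_norm_le (integrable_EFinB i1 iY)) _.
  rewrite -(RintZ (C * h) (integrable_normr Lf.2)).
  apply: Rint_le.
  - exact: integrable_normr (integrable_EFinB i1 iY).
  - exact: integrable_EFinZ (integrable_normr Lf.2).
  move=> z; have -> : f z * dphi z - h^-1 * (f z * phi (z + h *: v) - f z * phi z) =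
      f z * (- h^-1 * (phi (z + h *: v) - phi z - h * dphi z)) by field; rewrite gt_eqF.
  have hh : `|h^-1| = h^-1 by rewrite gtr0_norm ?invr_gt0.
  rewrite normrM mulrC ler_wpM2r// normrM normrN hh.
  rewrite mulrC ler_pdivrMr// -mulrA -expr2; exact: taylor.
have close := conv_test_close LF da db e0 C10 mphi phiM lip.
have -> : ip mu2 f dphi + \int[mu2]_z (F z * phi z) =
    (ip mu2 f dphi - Y) - (\int[mu2]_z (phi z * kconv F a b z) - \int[mu2]_z (F z * phi z)).
  by rewrite YZ; move: (ip _ _ _) (Rintegral _ _ _) (Rintegral _ _ _) => x y z; ring.
by apply: le_trans (ler_normB _ _) _; exact: lerD.
Qed.

End WeakDerivative.

Section Potential.
Context {R : realType}.
Implicit Types (F phi : R * R -> R).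
Local Notation meas f := (measurable_fun setT (f : plane R -> R)).

Lemma measurable_test D phi : test_function D phi -> meas phi.
Proof. by case=> sphi _ _; apply: continuous_measurable_plane; exact: smooth_continuous. Qed.

Lemma test_sqint D phi : test_function D phi -> sqint mu2 (phi : plane R -> R).
Proof.
move=> T; have [C C0 HC] := test_bounded T; have [_ cp _] := T.
have mphi := measurable_test T.
have [M M0 SM] := bounded_set_ball (compact_bounded cp).
have mB : measurable (ball (0 : R * R) M : set (plane R)) by exact: measurable_ball_plane.
split=> //; apply: (@le_lt_trans _ _ (\int[mu2]_z ((C ^+ 2) * \1_(ball (0 : R * R) M) z)%:E)%E).
  apply: ge0_le_integral => //.
  - by move=> z _; rewrite lee_fin sqr_ge0.
  - exact: measurable_E2.
  - apply/measurable_EFinP; apply: measurable_funM => //; exact: measurable_indic.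
  move=> z _; rewrite lee_fin; have [->|pz] := eqVneq (phi z) 0.
    by rewrite expr0n mulr_ge0// sqr_ge0.
  rewrite indicE mem_set; last by apply: SM; apply: subset_closure.
  by rewrite mulr1 -[leLHS]real_normK ?num_real// ler_sqr ?nnegrE.
under eq_integral do rewrite EFinM.
rewrite ge0_integralZl//; last 2 first.
- by apply/measurable_EFinP; exact: measurable_indic.
- by rewrite lee_fin sqr_ge0.
rewrite integral_indic// setIT lte_mul_pinfty ?lee_fin ?sqr_ge0//.
exact: mu2_ball_lty.
Qed.

Lemma density_le (a : R -> R) (e e' : R) : e <= e' -> density a e -> density a e'.
Proof. by move=> ee [? ? ? ? h]; split=> // x hx; apply: h; exact: le_trans hx. Qed.

Lemma cvg_opp_lim (x : nat -> R) (l c K : R) : x n @[n --> \oo] --> l ->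
  (\forall n \near \oo, `|x n + c| <= K * n.+1%:R^-1) -> l = - c.
Proof.
move=> xl xc; have h : K * n.+1%:R^-1 @[n --> \oo] --> (0 : R).
  by rewrite -[X in _ --> X](mulr0 K); apply: cvgMr; exact: cvg_harmonic.
have xc0 : x n + c @[n --> \oo] --> (0 : R).
  apply/norm_cvg0P; apply: (squeeze_cvgr _ (cvg_cst 0) h).
  by move: xc; apply: filterS => n ->; rewrite normr_ge0.
have xlc : x n + c @[n --> \oo] --> l + c by apply: cvgD => //; exact: cvg_cst.
have := cvg_lim (@Rhausdorff R) xc0; rewrite (cvg_lim (@Rhausdorff R) xlc).
by move=> E; rewrite -[l](addrK c) E sub0r.
Qed.

Lemma weak_derivative_limit (v : R * R) (phi dphi F : R * R -> R) (u : nat -> R * R -> R)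
    (a b : nat -> R -> R) (e h : nat -> R) (C K l : R) : L12 F ->
  test_function setT phi -> test_function setT dphi ->
  (forall z (t : R), `|phi (z + t *: v) - phi z - t * dphi z| <= C * t ^+ 2) ->
  (forall n, L12 (u n)) -> (forall n, \int[mu2]_z `|u n z| <= K) ->
  (forall n, density (a n) (e n)) -> (forall n, density (b n) (e n)) ->
  (forall n, 0 <= e n <= 3 * n.+1%:R^-1) -> (forall n, 0 < h n <= n.+1%:R^-1) ->
  (\forall n \near \oo, forall z, phi z != 0 ->
     u n (z - h n *: v) - u n z = - h n * kconv F (a n) (b n) z) ->
  ip mu2 (u n) dphi @[n --> \oo] --> l -> l = - \int[mu2]_z (F z * phi z).
Proof.
move=> LF T T' taylor Lu uK da db eP hP step cvl.
have [M M0 phiM] := test_bounded T; have [M1 M10 dphiM] := test_bounded T'.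
have [C1 C10 lip] := test_lip T.
have C0 : 0 <= C by have := taylor 0 1; rewrite expr1n mulr1; apply: le_trans; exact: normr_ge0.
(* With [h n <= 1/(n+1)] and [e n <= 3/(n+1)] both errors are of order [1/(n+1)]; the [6] is
   [2 * 3]. *)
apply: (cvg_opp_lim (K := C * K + 6 * C1 * \int[mu2]_z `|F z|) cvl).
move: step; apply: filterS => n step.
have /andP[e0 e1] := eP n; have /andP[h0 h1] := hP n.
apply: le_trans (weak_derivative_estimate (Lu n) LF (da n) (db n) e0 h0
  (measurable_test T) phiM (measurable_test T') dphiM C10 lip taylor step) _.
have I0 : 0 <= \int[mu2]_z `|F z| by apply: Rintegral_ge0.
have J0 : 0 <= \int[mu2]_z `|u n z| by apply: Rintegral_ge0.
have := uK n; move: (\int[mu2]_z `|F z|) (\int[mu2]_z `|u n z|) I0 J0 e0 e1 h0 h1 => I J I0 J0.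
move: (n.+1%:R^-1) (h n) (e n) => t x y y0 y1 x0 x1 JK.
rewrite [leRHS]mulrDl; apply: lerD.
  rewrite mulrAC -!mulrA [K * t]mulrC; apply: ler_wpM2l => //; rewrite [J * x]mulrC.
  by apply: ler_pM => //; exact: ltW.
rewrite [leRHS](_ : _ = 2 * C1 * (3 * t) * I); last by ring.
by apply: ler_wpM2r => //; apply: ler_wpM2l => //; exact: mulr_ge0.
Qed.

Variables (F1 F2 : R * R -> R) (Omega : set (R * R)) (p0 : R * R) (M0 : R).
Hypotheses (L1 : L12 F1) (L2 : L12 F2) (oO : open Omega) (sc : simply_connected Omega).
Hypotheses (lipO : lipschitz_boundary Omega) (OM : Omega `<=` ball (0 : R * R) M0) (Op0 : Omega p0).
Hypothesis curl0 : forall psi, test_function Omega psi ->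
  \int[mu2]_z (F1 z * dy psi z - F2 z * dx psi z) = 0.

Lemma compact_inner j : compact (inner Omega j).
Proof.
apply: (@closed_bounded_compact _ _ M0); first exact: closed_inner.
by move=> z /inner_subset /OM.
Qed.

Lemma approximate_potentials : exists (w : nat -> R * R -> R) (r dl : nat -> R),
  [/\ forall j, meas (w j), forall j, 0 < r j, forall j, 0 < dl j <= j.+1%:R^-1 &
      forall j z z', inner Omega j z -> inner Omega j z' ->
        ball z (r j) z' -> w j z' - w j z = Inc F1 F2 (dl j) z z'].
Proof.
have /choice[t tP] j : exists t : (R * R -> R) * (R * R), [/\ meas t.1, 0 < t.2.1,
    0 < t.2.2 <= j.+1%:R^-1 & forall z z', inner Omega j z -> inner Omega j z' ->
        ball z t.2.1 z' -> t.1 z' - t.1 z = Inc F1 F2 t.2.2 z z'].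
  have [r r0 H] := coherent_potential L1 L2 oO curl0 sc Op0 (@compact_inner j) (@inner_subset _ _ j).
  have j0 : (0 : R) < j.+1%:R^-1 by rewrite invr_gt0.
  have [dl [[d0 d1] [w mw wP]]] : exists dl : R, (0 < dl /\ dl < j.+1%:R^-1) /\
      exists2 w : R * R -> R, meas w & forall z z', inner Omega j z -> inner Omega j z' ->
        ball z r z' -> w z' - w z = Inc F1 F2 dl z z'.
    apply: (@filter_ex _ (0^'+ : set_system R)); apply: filterI => //.
    by apply: filterI; [exact: nbhs_right_gt|exact: nbhs_right_lt].
  by exists (w, (r, dl)); split=> //=; rewrite d0 ltW.
exists (fun j => (t j).1), (fun j => (t j).2.1), (fun j => (t j).2.2).
by split=> j; have [] := tP j.
Qed.

Theorem potential_exists : exists2 v : R * R -> R, sqint mu2 (v : plane R -> R) &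
  forall phi, test_function Omega phi ->
    (\int[mu2]_z (v z * dx phi z) = - \int[mu2]_z (F1 z * phi z)) /\
    (\int[mu2]_z (v z * dy phi z) = - \int[mu2]_z (F2 z * phi z)).
Proof.
have [w [r [dl [mw r0 dlP winc]]]] := approximate_potentials.
have dl0 j : 0 < dl j by case/andP: (dlP j).
(* The doubled radius makes the ball of radius [s] lie in [inner Omega j] for all large [j]. *)
have [s s0 sO] : exists2 s : R, 0 < s & ball p0 (2 * s) `<=` Omega.
  have /nbhs_ballP[s /= s0 sO] : nbhs p0 Omega by apply: open_nbhs_nbhs.
  by exists (s / 2); [rewrite divr_gt0|rewrite mulrC divfK].
have fin q (x : R) : exists V : R, mu2 (ball q x : set (plane R)) = V%:E.
  exists (fine (mu2 (ball q x : set (plane R)))).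
  by rewrite fineK// ge0_fin_numE// mu2_ball_lty.
have [V muB] := fin p0 s; have [V0 muB0] := fin 0 (2 * s).
have [W muW] := fin 0 M0.
pose M1 := 16 * s ^+ 2 * field_energy F1 F2 * V0 / V + 1.
(* For small [j] the ball may leave [inner Omega j]; [0] is then a default value. *)
have /choice[kap kapP] j : exists k, ball p0 s `<=` inner Omega j ->
    (E2 (on (ball p0 s) (fun z => w j z - k)%R) <= M1%:E)%E.
  have [H|nH] := pselect (ball p0 s `<=` inner Omega j); last by exists 0.
  have [k kP] := potential_normalization L1 L2 (mw j) (r0 j) (dl0 j) (winc j) s0 H muB muB0.
  by exists k.
have mn j : meas (normalized w kap j) by apply: measurable_funB.
have Bp0 : locally_bounded_energy Omega w kap p0.
  exists s, M1; split=> //.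
  have : s < 2 * s by lra.
  move=> /(inner_near sO); apply: filterS => j H; apply: le_trans (kapP j H).
  apply: E2_le.
  - by apply: measurable_on => //; exact: measurable_ball_inner.
  - by apply: measurable_on; [exact: measurable_ball_plane|exact: (mn j)].
  move=> z; have [h|h] := pselect ((ball p0 s `&` inner Omega j) z).
    by rewrite (onT _ h) onT//; exact: h.1.
  by rewrite (onF _ h) expr0n sqr_ge0.
have [M [j0 _ HM]] := uniform_energy_bound L1 L2 mw r0 dl0 winc oO sc lipO OM Op0 Bp0.
pose f j := on (inner Omega j) (normalized w kap j).
have mf j : meas (f j) by apply: measurable_on => //; exact: measurable_inner.
have Lf j : (j0 <= j)%N -> sqint mu2 (f j : plane R -> R).
  by move=> jj; split=> //; apply: le_lt_trans (HM j jj) _; exact: ltry.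
have ipf j : (j0 <= j)%N -> ip mu2 (f j) (f j) <= M.
  by move=> jj; rewrite -lee_fin -sqint_ipE; [exact: HM|exact: Lf].
(* The bounds hold only from [j0] on, whence the shift of the index. *)
have [sigma [v Lv [sinc cv]]] := sqint_weak_compactness
  (fun n => Lf (n + j0)%N (leq_addl n j0)) (fun n => ipf (n + j0)%N (leq_addl n j0)).
exists v => // phi T.
pose J n := (sigma n + j0)%N.
have sn n : (n <= sigma n)%N.
  by elim: n => // n IH; apply: leq_ltn_trans IH _; exact: sinc.
have Jn n : (n <= J n)%N by apply: leq_trans (sn n) _; exact: leq_addr.
have Jinv n : ((J n).+1%:R^-1 : R) <= n.+1%:R^-1.
  by rewrite lef_pV2 ?posrE// ler_nat ltnS.
(* Less than [r (J n)], so that the increment of the potential is [Inc], and less than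
   [1/(J n + 1)], so that the translate of a point of the support stays in [inner Omega (J n)] for
   large [n]. *)
pose h n := Num.min (r (J n)) (J n).+1%:R^-1 / 2.
have m0 n : 0 < Num.min (r (J n)) (J n).+1%:R^-1 by rewrite lt_min r0 /= invr_gt0 ltr0Sn.
have h0 n : 0 < h n by rewrite divr_gt0.
have hr n : h n < r (J n).
  apply: (@lt_le_trans _ _ (Num.min (r (J n)) (J n).+1%:R^-1)); last by rewrite ge_min lexx.
  by rewrite /h; have := m0 n; move: (Num.min _ _) => x; lra.
have hJ n : h n < (J n).+1%:R^-1.
  apply: (@lt_le_trans _ _ (Num.min (r (J n)) (J n).+1%:R^-1)); last by rewrite ge_min lexx orbT.
  by rewrite /h; have := m0 n; move: (Num.min _ _) => x; lra.
have hP n : 0 < h n <= n.+1%:R^-1 by rewrite h0 (le_trans (ltW (hJ n))).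
(* The width of the difference quotient of [th], used as a common width for both factors of the
   kernel. *)
pose e n := 2 * dl (J n) + h n.
have eP n : 0 <= e n <= 3 * n.+1%:R^-1.
  have /andP[d1 d2] := dlP (J n); have /andP[h1 h2] := hP n; have := Jinv n.
  rewrite /e; move: (_^-1) d2 (_^-1) h2 => x d2 y h2 xy.
  by apply/andP; split; lra.
have supp j z : ~ ball (0 : R * R) M0 z -> f j z = 0.
  by move=> nz; rewrite /f onF// => /inner_subset/OM.
have Lu n := integral_norm_bounded_support (Lf (J n) (leq_addl _ _)) (supp (J n)) muW.
have uK n : \int[mu2]_z `|f (J n) z| <= M + W.
  by apply: le_trans (Lu n).2 _; rewrite lerD2r; apply: ipf; exact: leq_addl.
have T1 : test_function setT phi by apply: testS T.
have [C1 _ ty1] := test_taylor_dx T1; have [C2 _ ty2] := test_taylor_dy T1.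
(* The translation is by [- h n] because the estimate uses backward differences of the potential. *)
have dq n : density (quot (dl (J n)) (- h n)) (e n).
  have -> : e n = 2 * dl (J n) + `|- h n| by rewrite normrN gtr0_norm.
  by apply: quot_density; rewrite ?oppr_eq0 ?gt_eqF.
have dk n : density (kd (dl (J n))) (e n).
  by apply: density_le (kd_density (dl0 _)); rewrite /e lerDl ltW.
(* By a Lebesgue number [rho] of the support of [phi] in [Omega], for large [n] both [z] and its
   translate lie in [inner Omega (J n)], where the increments of [w] are known; the constants [kap]
   cancel. *)
have step (v' : R * R) (g : nat -> R * R -> R) : `|v'.1| <= 1 -> `|v'.2| <= 1 ->
    (forall n z, Inc F1 F2 (dl (J n)) z (z - h n *: v') = - h n * g n z) ->
    \forall n \near \oo, forall z, phi z != 0 -> f (J n) (z - h n *: v') - f (J n) z = - h n * g n z.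
  move=> v1 v2 Hg; have [_ cS SO] := T.
  have cid : continuous (id : R * R -> R * R) by move=> z; exact: cvg_id.
  have [rho rho0 rhoP] := @lebesgue_number R (R * R)%type (R * R)%type id _ Omega cS cid oO SO.
  have : \forall n \near \oo, (n.+1%:R^-1 : R) < rho / 2.
    have r2 : 0 < rho / 2 by rewrite divr_gt0.
    exact: near_infty_natSinv_lt (PosNum r2).
  apply: filterS => n hn z pz.
  have Jr : (J n).+1%:R^-1 < rho / 2 by exact: le_lt_trans (Jinv n) hn.
  have Sz : closure [set z | phi z != 0] z by apply: subset_closure.
  have [y [x [yO yz]]] := rhoP z Sz.
  have zO : ball z rho `<=` Omega by move=> z' /yz /yO.
  have hv (x' : R) : `|x'| <= 1 -> `|h n * x'| <= h n.
    by move=> x1; rewrite normrM gtr0_norm// ler_piMr// ltW.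
  have bz (x' : R) : h n < x' -> ball z x' (z - h n *: v').
    move=> hx; apply/ball_planeE; split.
      change (`|z.1 - h n * v'.1 - z.1| < x').
      by rewrite addrAC subrr add0r normrN; apply: le_lt_trans (hv _ v1) hx.
    change (`|z.2 - h n * v'.2 - z.2| < x').
    by rewrite addrAC subrr add0r normrN; apply: le_lt_trans (hv _ v2) hx.
  have i1 : inner Omega (J n) z.
    move=> z' zz'; apply: zO; apply: le_ball zz'; apply: ltW; apply: lt_trans Jr _.
    by rewrite ltr_pdivrMr// ltr_pMr// ltr1n.
  have i2 : inner Omega (J n) (z - h n *: v').
    move=> z' zz'; apply: zO; apply: (@le_ball _ _ _ ((J n).+1%:R^-1 + (J n).+1%:R^-1)).
      by apply: ltW; rewrite [rho]splitr ltrD.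
    exact: ball_triangle (bz _ (hJ n)) zz'.
  rewrite /f (onT _ i1) (onT _ i2) /normalized -Hg -winc//; first by rewrite opprB addrA subrK.
  exact: bz.
split.
  apply: (weak_derivative_limit (v := (1, 0)) L1 T1 (test_dx T1) ty1 (fun n => (Lu n).1) uK dq dk eP hP).
    apply: step; rewrite /= ?normr1 ?normr0// => n z.
    have -> : z - h n *: (1, 0) = (z.1 - h n, z.2).
      change ((z.1 - h n * 1, z.2 - h n * 0) = (z.1 - h n, z.2)).
      by rewrite mulr1 mulr0 subr0.
    by apply: (@Inc_horizontal R F1 F2 L1); rewrite oppr_eq0 gt_eqF.
  exact: cv (test_sqint (test_dx T1)).
apply: (weak_derivative_limit (v := (0, 1)) L2 T1 (test_dy T1) ty2 (fun n => (Lu n).1) uK dk dq eP hP).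
  apply: step; rewrite /= ?normr1 ?normr0// => n z.
  have -> : z - h n *: (0, 1) = (z.1, z.2 - h n).
    change ((z.1 - h n * 0, z.2 - h n * 1) = (z.1, z.2 - h n)).
    by rewrite mulr1 mulr0 subr0.
  by apply: (@Inc_vertical R F1 F2 L2); rewrite oppr_eq0 gt_eqF.
exact: cv (test_sqint (test_dy T1)).
Qed.

End Potential.

(** * Removable points *)

Section RemovablePoint.
Context {R : realType}.
Implicit Types (F phi : R * R -> R) (p z : R * R).
Local Notation meas f := (measurable_fun setT (f : plane R -> R)).

Let pointX p : ([set p] : set (plane R)) =
  ([set p.1] : set (measurableTypeR R)) `*` ([set p.2] : set (measurableTypeR R)).
Proof. by apply/seteqP; split=> [z ->//|[z1 z2] [/= -> ->]]; rewrite -surjective_pairing. Qed.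

Lemma measurable_point p : measurable ([set p] : set (plane R)).
Proof. by rewrite pointX; apply: measurableX; exact: measurable_set1. Qed.

Lemma mu2_point p : mu2 ([set p] : set (plane R)) = 0%E.
Proof. by rewrite pointX mu2X// !lebesgue_measure_set1 mule0. Qed.

(** Dominated convergence: the balls shrink to [p], and a point is a null set. *)
Lemma energy_on_small_balls F p : sqint mu2 (F : plane R -> R) ->
  E2 (on (ball p k.+1%:R^-1) F) @[k --> \oo] --> 0%E.
Proof.
move=> LF.
have mB k : measurable (ball p (k.+1%:R^-1 : R) : set (plane R)) by exact: measurable_ball_plane.
have := @dominated_convergence _ (plane R) R mu2 setT measurableT
  (fun k z => (on (ball p k.+1%:R^-1) F z ^+ 2)%:E) (fun=> 0%E) (fun z => (F z ^+ 2)%:E).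
case.
- by move=> k; apply: measurable_E2; apply: measurable_on => //; exact: LF.1.
- exact: measurable_cst.
- exists [set p]; split; [exact: measurable_point|exact: mu2_point|].
  move=> z /= nz; apply: contrapT => zp; apply: nz => _.
  have e0 : 0 < Num.max `|z.1 - p.1| `|z.2 - p.2|.
    rewrite lt_max !normr_gt0 !subr_eq0 -negb_and; apply/negP => /andP[/eqP h1 /eqP h2].
    by apply: zp; rewrite [z]surjective_pairing h1 h2 -surjective_pairing.
  apply: cvg_near_cst; have := near_infty_natSinv_lt (PosNum e0); apply: filterS => k /=.
  rewrite lt_max => /orP h; rewrite onF ?expr0n// => /ball_planeE[h1 h2].
  by case: h => h; [move: h1|move: h2]; rewrite ltNge (ltW h).
- exact: sqint_integrable_sqr.
- apply: aeW => z k _; rewrite gee0_abs ?lee_fin ?sqr_ge0//.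
  have [h|h] := pselect (ball p (k.+1%:R^-1 : R) z); first by rewrite (onT _ h).
  by rewrite (onF _ h) expr0n sqr_ge0.
by move=> _ _; rewrite integral0.
Qed.

(** A plateau made of two opposite steps of width [eta] at [c - 2 * eta] and [c + 2 * eta]: it is
    [1] up to distance [eta] from [c] and [0] from distance [3 * eta] on. As a step difference it
    has known smoothness and derivative. *)
Definition cutoff (c eta : R) (t : R) : R :=
  th eta (c + 2 * eta - t) - th eta (c - 2 * eta - t).

Lemma cutoff1 c eta t : 0 < eta -> `|t - c| <= eta -> cutoff c eta t = 1.
Proof.
move=> e0; rewrite ler_norml => /andP[? ?]; rewrite /cutoff th_eq1; [|by []|by lra].
by rewrite th_eq0 ?subr0//; lra.
Qed.

Lemma cutoff0 c eta t : 0 < eta -> 3 * eta <= `|t - c| -> cutoff c eta t = 0.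
Proof.
move=> e0; rewrite ler_normr => /orP[] h; rewrite /cutoff.
  by rewrite !th_eq0 ?subrr//; lra.
by rewrite !th_eq1 ?subrr//; lra.
Qed.

Lemma cutoff_le1 c eta t : 0 < eta -> `|cutoff c eta t| <= 1.
Proof.
move=> e0; have := th_ge0 eta (c + 2 * eta - t); have := th_le1 eta (c + 2 * eta - t).
have := th_ge0 eta (c - 2 * eta - t); have := th_le1 eta (c - 2 * eta - t).
by rewrite ler_norml /cutoff => ? ? ? ?; apply/andP; split; lra.
Qed.

Definition square_cutoff p (eta : R) z : R := cutoff p.1 eta z.1 * cutoff p.2 eta z.2.

Lemma smooth_square_cutoff p eta : smooth (square_cutoff p eta).
Proof. by apply: smooth_tensor => n; exact: Cn_step_difference. Qed.

Lemma square_cutoff1 p eta z : 0 < eta -> ball p eta z -> square_cutoff p eta z = 1.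
Proof.
move=> e0 /ball_planeE[/ltW h1 /ltW h2].
by rewrite /square_cutoff !cutoff1// mulr1.
Qed.

Lemma square_cutoff0 p eta z : 0 < eta -> ~ ball p (3 * eta) z -> square_cutoff p eta z = 0.
Proof.
move=> e0 nb; rewrite /square_cutoff.
have [h1|h1] := leP (3 * eta) `|z.1 - p.1|; first by rewrite cutoff0 ?mul0r.
have [h2|h2] := leP (3 * eta) `|z.2 - p.2|; first by rewrite [X in _ * X]cutoff0 ?mulr0.
by exfalso; apply: nb; apply/ball_planeE.
Qed.

Lemma square_cutoff_le1 p eta z : 0 < eta -> `|square_cutoff p eta z| <= 1.
Proof. by move=> e0; rewrite normrM mulr_ile1// cutoff_le1. Qed.

Lemma square_cutoff_derive : exists2 M : R, 0 <= M & forall p eta z, 0 < eta ->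
  `|dx (square_cutoff p eta) z| <= M / eta /\ `|dy (square_cutoff p eta) z| <= M / eta.
Proof.
have [M HM] := @dstep_bounded R.
have M0 : 0 <= M by apply: le_trans (HM 0).
exists (2 * M) => [|p eta z e0]; first exact: mulr_ge0.
have hk x : `|kd eta x| <= M / eta.
  by rewrite normrM gtr0_norm ?invr_gt0// mulrC ler_wpM2r// invr_ge0 ltW.
have hd x' x : `|- (kd eta x' - kd eta x)| <= 2 * M / eta.
  rewrite normrN; apply: le_trans (ler_normB _ _) _.
  by rewrite -mulrA mulr_natl mulr2n lerD.
have D v := is_derive_tensor v (is_derive_step_difference eta (p.1 - 2 * eta) (p.1 + 2 * eta) z.1)
  (is_derive_step_difference eta (p.2 - 2 * eta) (p.2 + 2 * eta) z.2).
pose dc c t := - (kd eta (c + 2 * eta - t) - kd eta (c - 2 * eta - t)).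
split.
  have -> : dx (square_cutoff p eta) z = dc p.1 z.1 * cutoff p.2 eta z.2.
    by have [_ E] := D ((1, 0) : R * R); rewrite (E : dx (square_cutoff p eta) z = _) mul1r mul0r addr0.
  by rewrite normrM -[leRHS]mulr1; apply: ler_pM => //; [exact: hd|exact: cutoff_le1].
have -> : dy (square_cutoff p eta) z = cutoff p.1 eta z.1 * dc p.2 z.2.
  by have [_ E] := D ((0, 1) : R * R); rewrite (E : dy (square_cutoff p eta) z = _) mul1r mul0r add0r.
by rewrite normrM -[leRHS]mul1r; apply: ler_pM => //; [exact: cutoff_le1|exact: hd].
Qed.

End RemovablePoint.

Lemma sqrB_le {R : realDomainType} (x y p q : R) : x ^+ 2 <= p -> y ^+ 2 <= q ->
  (x - y) ^+ 2 <= 2 * (p + q).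
Proof. by move=> xp yq; have := sqr_ge0 (x + y); nra. Qed.

Section RemovablePoints.
Context {R : realType}.
Implicit Types (F phi psi : R * R -> R) (p z : R * R).
Local Notation meas f := (measurable_fun setT (f : plane R -> R)).

Lemma mu2_ball p (r : R) : 0 <= r -> mu2 (ball p r : set (plane R)) = ((2 * r) ^+ 2)%:E.
Proof.
move=> r0.
have -> : (ball p r : set (plane R)) =
   (ball p.1 r : set (measurableTypeR R)) `*` (ball p.2 r : set (measurableTypeR R)).
  by [].
rewrite mu2X; [|exact: measurable_ball..].
by rewrite !lebesgue_measure_ball// -EFinM; congr EFin; ring.
Qed.

Definition pairing F1 F2 psi : R := \int[mu2]_z (F1 z * dy psi z - F2 z * dx psi z).

Lemma pairingE D F1 F2 psi : sqint mu2 (F1 : plane R -> R) -> sqint mu2 (F2 : plane R -> R) ->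
  test_function D psi -> pairing F1 F2 psi = ip mu2 F1 (dy psi) - ip mu2 F2 (dx psi).
Proof.
move=> L1 L2 T; have i1 := sqint_integrableM L1 (test_sqint (test_dy T)).
have i2 := sqint_integrableM L2 (test_sqint (test_dx T)).
by rewrite /pairing (RintB i1 i2).
Qed.

Let derivable_smooth phi z v : smooth phi -> v = (1, 0) \/ v = (0, 1) -> derivable phi z v.
Proof. by move=> s; have [_ H] := s [::]; case=> ->; [exact: (H z).1|exact: (H z).2]. Qed.

Lemma deriveD_smooth phi psi z v : smooth phi -> smooth psi -> v = (1, 0) \/ v = (0, 1) ->
  'D_v (fun z => phi z + psi z) z = 'D_v phi z + 'D_v psi z.
Proof.
move=> s1 s2 vv.
exact: (deriveD (@derivable_smooth _ z _ s1 vv) (@derivable_smooth _ z _ s2 vv)).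
Qed.

Lemma deriveM_smooth phi psi z v : smooth phi -> smooth psi -> v = (1, 0) \/ v = (0, 1) ->
  'D_v (fun z => phi z * psi z) z = 'D_v phi z * psi z + phi z * 'D_v psi z.
Proof.
move=> s1 s2 vv.
have E := deriveM (@derivable_smooth _ z _ s1 vv) (@derivable_smooth _ z _ s2 vv).
by rewrite [LHS]E addrC; congr (_ + _); exact: mulrC.
Qed.

Lemma pairingD D F1 F2 phi psi : sqint mu2 (F1 : plane R -> R) ->
  sqint mu2 (F2 : plane R -> R) -> test_function D phi -> test_function D psi ->
  pairing F1 F2 (fun z => phi z + psi z) = pairing F1 F2 phi + pairing F1 F2 psi.
Proof.
move=> L1 L2 T T'; have [[s1 _ _] [s2 _ _]] := (T, T').
have i1 := sqint_integrableM L1 (test_sqint (test_dy T)).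
have i2 := sqint_integrableM L2 (test_sqint (test_dx T)).
have i1' := sqint_integrableM L1 (test_sqint (test_dy T')).
have i2' := sqint_integrableM L2 (test_sqint (test_dx T')).
rewrite /pairing -(RintD (integrable_EFinB i1 i2) (integrable_EFinB i1' i2')).
apply: eq_Rintegral => z _; rewrite /dx /dy (deriveD_smooth z s1 s2 (or_introl erefl)).
by rewrite (deriveD_smooth z s1 s2 (or_intror erefl)); ring.
Qed.

(** Scale invariance in the plane: the derivatives of the cut-off function are of order [1 / eta] on
    a square of area of order [eta ^+ 2], so their energy is bounded independently of [eta]. *)
Lemma cutoff_energy D phi p : test_function D phi -> exists K : R, forall eta, 0 < eta <= 1 ->
  forall g, meas g -> (forall z, ~ ball p (4 * eta) z -> g z = 0) ->
    ((forall z, g z = dx phi z * square_cutoff p eta z + phi z * dx (square_cutoff p eta) z) \/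
     (forall z, g z = dy phi z * square_cutoff p eta z + phi z * dy (square_cutoff p eta) z)) ->
  (E2 g <= K%:E)%E.
Proof.
move=> T; have [M M0 HM] := test_bounded T; have [M1 M10 HM1] := test_bounded (test_dx T).
have [M2 M20 HM2] := test_bounded (test_dy T); have [N N0 HN] := @square_cutoff_derive R.
have [L [L0 LM1 LM2]] : exists L, [/\ 0 <= L, M1 + M * N <= L & M2 + M * N <= L].
  have MN : 0 <= M * N by exact: mulr_ge0.
  by exists (M1 + M2 + M * N); split; lra.
(* The square of the bound [L / eta] times the area of a square of side [8 * eta]. *)
exists (L ^+ 2 * 8 ^+ 2) => eta /andP[e0 e1] g mg supp gE.
have ei : 1 <= eta^-1 by rewrite invf_cp1.
have gL z : `|g z| <= L / eta.
  have cl := square_cutoff_le1 p z e0; have [Dx Dy] := HN p eta z e0.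
  have h (a b c d A : R) : `|a| <= A -> `|b| <= 1 -> `|c| <= M -> `|d| <= N / eta -> 0 <= A ->
      `|a * b + c * d| <= A / eta + M * N / eta.
    move=> ha hb hc hd A0; apply: le_trans (ler_normD _ _) _; rewrite !normrM; apply: lerD.
      by apply: ler_pM => //; exact: le_trans ei.
    by rewrite -mulrA; apply: ler_pM.
  have pe : 0 <= eta^-1 by rewrite invr_ge0 ltW.
  have le A : A + M * N <= L -> A / eta + M * N / eta <= L / eta.
    by move=> AL; rewrite -mulrDl ler_wpM2r.
  case: gE => E; rewrite E.
    have b1 := h (dx phi z) (square_cutoff p eta z) (phi z) (dx (square_cutoff p eta) z) M1 (HM1 z) cl (HM z) Dx M10.
    exact: (le_trans b1 (le M1 LM1)).
  have b2 := h (dy phi z) (square_cutoff p eta z) (phi z) (dy (square_cutoff p eta) z) M2 (HM2 z) cl (HM z) Dy M20.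
  exact: (le_trans b2 (le M2 LM2)).
have mB : measurable (ball p (4 * eta) : set (plane R)) by exact: measurable_ball_plane.
have e4 : 0 <= 4 * eta by rewrite mulr_ge0// ltW.
apply: (@le_trans _ _ (\int[mu2]_z (((L / eta) ^+ 2) * \1_(ball p (4 * eta)) z)%:E)%E).
  apply: ge0_le_integral => //.
  - by move=> z _; rewrite lee_fin sqr_ge0.
  - exact: measurable_E2.
  - apply/measurable_EFinP; apply: measurable_funM => //; exact: measurable_indic.
  move=> z _; rewrite lee_fin; have [Bz|nBz] := pselect (ball p (4 * eta) z); last first.
    by rewrite supp// expr0n mulr_ge0// sqr_ge0.
  rewrite indicE mem_set// mulr1 -[leLHS]real_normK ?num_real// ler_sqr ?nnegrE//.
  by apply: le_trans (gL z).
under eq_integral do rewrite EFinM.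
rewrite ge0_integralZl//; last 2 first.
- by apply/measurable_EFinP; exact: measurable_indic.
- by rewrite lee_fin sqr_ge0.
rewrite integral_indic// setIT (_ : mu2 _ = ((2 * (4 * eta)) ^+ 2)%:E); last exact: mu2_ball.
rewrite -EFinM lee_fin le_eqVlt; apply/orP; left; apply/eqP.
by move: e0 => /lt0r_neq0 e0; field.
Qed.

Lemma sqint_on F (A : set (R * R)) : measurable (A : set (plane R)) ->
  sqint mu2 (F : plane R -> R) -> sqint mu2 (on A F : plane R -> R).
Proof.
move=> mA LF; have mo := measurable_on mA LF.1.
split=> //; apply: le_lt_trans LF.2; apply: (E2_le mo LF.1) => z.
have [h|h] := pselect (A z); first by rewrite (onT _ h).
by rewrite (onF _ h) expr0n sqr_ge0.
Qed.

(* In the plane points have zero capacity: the cutoffs around [p] stay bounded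
   in H^1, while the energy of the field near [p] tends to zero. *)
Lemma removable_point F1 F2 (U : set (R * R)) p : sqint mu2 (F1 : plane R -> R) ->
  sqint mu2 (F2 : plane R -> R) ->
  (forall psi, test_function (U `\ p) psi -> pairing F1 F2 psi = 0) ->
  forall phi, test_function U phi -> pairing F1 F2 phi = 0.
Proof.
move=> L1 L2 H phi T; have [sphi _ _] := T.
have [K HK] := cutoff_energy p T.
(* So that [4 * eta k] is the radius [1/(k+1)] of [energy_on_small_balls]. *)
pose eta k : R := k.+1%:R^-1 / 4.
have ek k : 0 < eta k <= 1.
  rewrite divr_gt0 ?invr_gt0//= ler_pdivrMr// mul1r.
  by apply: (@le_trans _ _ 1); rewrite ?invf_le1 ?ler1n.
have e4 k : 4 * eta k = k.+1%:R^-1 by rewrite mulrC divfK.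
pose chi k := square_cutoff p (eta k).
have schi k : smooth (chi k) by exact: smooth_square_cutoff.
pose psi k z := phi z * chi k z.
have Tpsi k : test_function U (psi k) := testM T (schi k).
pose rest k z := phi z * (1 - chi k z).
have srest k : smooth (fun z => 1 - chi k z).
  apply/smoothP => n; apply: CnD; first exact: Cn_cst.
  rewrite (_ : (fun z => _) = (fun z => (-1) * chi k z)); last by apply/funext => z; rewrite mulN1r.
  by apply: CnM; [exact: Cn_cst|exact: (smoothP _).1 (schi k) n].
have Trest k : test_function U (rest k) := testM T (srest k).
(* [chi k] is [1] near [p], so [rest k] vanishes in a neighbourhood of [p] and the hypothesis
   applies to it. *)
have Trest' k : test_function (U `\ p) (rest k).
  have [s c cl] := Trest k; split => // z cz; split; first exact: cl.
  move=> zp; move: cz; rewrite zp => cp; have /andP[e0 _] := ek k.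
  have [z' [/eqP rz pz]] := cp _ (nbhsx_ballx p _ e0); apply: rz.
  by rewrite /rest /chi square_cutoff1// subrr mulr0.
have E k : pairing F1 F2 phi = pairing F1 F2 (psi k).
  rewrite -[RHS]addr0 -(H _ (Trest' k)) -(pairingD L1 L2 (Tpsi k) (Trest k)).
  by congr pairing; apply/funext => z; rewrite /psi /rest -mulrDr addrC subrK mulr1.
pose B k : set (R * R) := ball p (k.+1%:R^-1 : R).
have mB k : measurable (B k : set (plane R)) by exact: measurable_ball_plane.
(* Derivatives vanish off the closed support; [psi k] is zero outside the ball of radius
   [3 * eta k], and the fourth [eta k] covers the closure. *)
have supp k v z : ~ B k z -> 'D_v (psi k) z = 0.
  move=> nB; apply/eqP; apply: contrapT => /negP Dz; apply: nB.
  have /andP[e0 _] := ek k.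
  have [z' [/= pz zz']] := derive_supp Dz (nbhsx_ballx z _ e0).
  have pz' : ball p (3 * eta k) z'.
    by apply: contrapT => nb; move/eqP: pz; apply; rewrite /psi /chi square_cutoff0// mulr0.
  rewrite /B -e4; apply: (@le_ball _ _ _ (3 * eta k + eta k)); first by lra.
  exact: ball_triangle pz' (ball_sym zz').
have bx k : ip mu2 (dx (psi k)) (dx (psi k)) <= K.
  have Td := test_dx (Tpsi k).
  rewrite -lee_fin -(sqint_ipE (test_sqint Td)); apply: (HK _ (ek k)).
  - exact: measurable_test Td.
  - by move=> z; rewrite e4; exact: supp.
  - by left => z; exact: (deriveM_smooth z sphi (schi k) (or_introl erefl)).
have by' k : ip mu2 (dy (psi k)) (dy (psi k)) <= K.
  have Td := test_dy (Tpsi k).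
  rewrite -lee_fin -(sqint_ipE (test_sqint Td)); apply: (HK _ (ek k)).
  - exact: measurable_test Td.
  - by move=> z; rewrite e4; exact: supp.
  - by right => z; exact: (deriveM_smooth z sphi (schi k) (or_intror erefl)).
have K0 : 0 <= K by apply: le_trans (bx 0%N); exact: ip_ge0.
have loc F g k : (forall z, ~ B k z -> g z = 0) -> ip mu2 F g = ip mu2 (on (B k) F) g.
  move=> hg; apply: eq_Rintegral => z _; have [h|h] := pselect (B k z); first by rewrite onT.
  by rewrite hg// !mulr0.
pose e1 k := ip mu2 (on (B k) F1) (on (B k) F1).
pose e2 k := ip mu2 (on (B k) F2) (on (B k) F2).
have small k : pairing F1 F2 phi ^+ 2 <= 2 * K * (e1 k + e2 k).
  rewrite (E k) (pairingE L1 L2 (Tpsi k)).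
  rewrite (loc F1 (dy (psi k)) k (supp k _)) (loc F2 (dx (psi k)) k (supp k _)).
  have c1 := ip_cauchy_schwarz (sqint_on (mB k) L1) (test_sqint (test_dy (Tpsi k))).
  have c2 := ip_cauchy_schwarz (sqint_on (mB k) L2) (test_sqint (test_dx (Tpsi k))).
  have p1 : 0 <= e1 k := ip_ge0 _ _; have p2 : 0 <= e2 k := ip_ge0 _ _.
  have {}c1 := le_trans c1 (ler_wpM2l p1 (by' k)).
  have {}c2 := le_trans c2 (ler_wpM2l p2 (bx k)).
  have -> : 2 * K * (e1 k + e2 k) = 2 * (e1 k * K + e2 k * K) by rewrite -mulrDl mulrAC mulrA.
  exact (sqrB_le c1 c2).
have cE F : sqint mu2 (F : plane R -> R) ->
    ip mu2 (on (B k) F) (on (B k) F) @[k --> \oo] --> (0 : R).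
  move=> LF; have h := @energy_on_small_balls R F p LF.
  rewrite (_ : (fun k => ip mu2 _ _) = fine \o (fun k => E2 (on (ball p k.+1%:R^-1) F))).
    exact: fine_cvg h.
  by apply/funext => k /=; rewrite /E2 (sqint_ipE (sqint_on (mB k) LF)).
have c0 : 2 * K * (e1 k + e2 k) @[k --> \oo] --> (0 : R).
  rewrite -[X in _ --> X](mulr0 (2 * K)); apply: cvgMr.
  by rewrite -[X in _ --> X](addr0 0); apply: cvgD; exact: cE.
have := limr_ge (cvgP _ c0) (nearW _ small); rewrite (cvg_lim (@Rhausdorff R) c0).
by move=> x0; apply/eqP; rewrite -sqrf_eq0 eq_le x0 sqr_ge0.
Qed.

End RemovablePoints.

(** * Truncated fields *)

Section Restriction.
Context {R : realType}.
Implicit Types (D Omega : set (R * R)) (v phi psi : R * R -> R) (f g : R * R -> R * R).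
Local Notation meas f := (measurable_fun setT (f : plane R -> R)).
Local Notation mset D := (measurable (D : set (plane R))).

Lemma onE D v : on D v = v \_ D.
Proof.
by apply/funext => z; rewrite /on /patch indicE; case: (z \in D); rewrite ?mul1r ?mul0r.
Qed.

Lemma Rintegral_on D (v : plane R -> R) : \int[mu2]_(z in D) v z = \int[mu2]_z on D v z.
Proof. by rewrite Rintegral_mkcond onE. Qed.

Lemma L2E D v : mset D -> L2 D v <-> sqint mu2 (on D v : plane R -> R).
Proof.
move=> mD; have E : (\int[mu2]_(z in D) ((v z) ^+ 2)%:E = \int[mu2]_z (on D v z ^+ 2)%:E)%E.
  rewrite integral_mkcond; apply: eq_integral => z _; rewrite /patch.
  by rewrite /on indicE; case: (z \in D); rewrite ?mul1r ?mul0r ?expr0n.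
split=> -[m i]; split.
- by rewrite onE; exact/(measurable_restrictT _ mD).
- by rewrite -E.
- by apply/(measurable_restrictT _ mD); rewrite -onE.
- by rewrite E.
Qed.

Lemma L2vec_sqint D f : mset D -> L2vec D f ->
  sqint mu2 (on D (fun z => (f z).1) : plane R -> R) /\
  sqint mu2 (on D (fun z => (f z).2) : plane R -> R).
Proof. by move=> mD [h1 h2]; split; apply/(L2E _ mD). Qed.

Lemma integral_dot D f g : mset D -> L2vec D f -> L2vec D g ->
  \int[mu2]_(z in D) dot (f z) (g z) =
    ip mu2 (on D (fun z => (f z).1)) (on D (fun z => (g z).1)) +
    ip mu2 (on D (fun z => (f z).2)) (on D (fun z => (g z).2)).
Proof.
move=> mD /(L2vec_sqint mD)[f1 f2] /(L2vec_sqint mD)[g1 g2].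
rewrite Rintegral_on /ip -(RintD (sqint_integrableM f1 g1) (sqint_integrableM f2 g2)).
apply: eq_Rintegral => z _; have [h|h] := pselect (D z); first by rewrite !onT.
by rewrite !onF// !mul0r addr0.
Qed.

Lemma curl_pairing_on D f psi :
  curl_pairing D f psi = pairing (on D (fun z => (f z).1)) (on D (fun z => (f z).2)) psi.
Proof.
rewrite /curl_pairing Rintegral_on; apply: eq_Rintegral => z _.
have [h|h] := pselect (D z); first by rewrite !onT.
by rewrite !onF// !mul0r subr0.
Qed.

Lemma ip_ae (u v h : plane R -> R) : sqint mu2 u -> sqint mu2 v -> sqint mu2 h ->
  {ae mu2, forall z, u z = v z} -> ip mu2 u h = ip mu2 v h.
Proof.
move=> Lu Lv Lh E; congr fine; apply: ae_eq_integral => //.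
- by apply/measurable_EFinP; apply: measurable_funM; [exact: Lu.1|exact: Lh.1].
- by apply/measurable_EFinP; apply: measurable_funM; [exact: Lv.1|exact: Lh.1].
by apply: filterS E => z -> _.
Qed.

Lemma subsequence_ge (sigma : nat -> nat) : (forall m n, (m < n)%N -> (sigma m < sigma n)%N) ->
  forall n, (n <= sigma n)%N.
Proof. by move=> h; elim=> // n IH; apply: leq_ltn_trans IH _; exact: h. Qed.

Lemma cvg_subsequence (sigma : nat -> nat) (x : nat -> R) (l : R) :
  (forall m n, (m < n)%N -> (sigma m < sigma n)%N) -> x n @[n --> \oo] --> l ->
  x (sigma n) @[n --> \oo] --> l.
Proof.
move=> h xl; apply: (cvg_comp _ _ _ xl) => A [m _ mA]; exists m => // n mn.
by apply: mA; exact: leq_trans mn (subsequence_ge h n).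
Qed.

Definition weak_ip (u : nat -> R * R -> R) (l : R * R -> R) :=
  forall h, sqint mu2 (h : plane R -> R) -> ip mu2 (u n) h @[n --> \oo] --> ip mu2 l h.

Lemma ip_on D u h : ip mu2 (on D u) h = ip mu2 u (on D h).
Proof. by apply: eq_Rintegral => z _; rewrite /on; ring. Qed.

(** The second extraction is made along the first. The limits may be multiplied by the indicator of
    [D] because the sequences are supported in [D] and [on D] is symmetric for [ip]. *)
Lemma weak_limit_pair D (u v : nat -> R * R -> R) (M : R) : mset D ->
  (forall n, sqint mu2 (u n : plane R -> R)) -> (forall n, sqint mu2 (v n : plane R -> R)) ->
  (forall n, on D (u n) = u n) -> (forall n, on D (v n) = v n) ->
  (forall n, ip mu2 (u n) (u n) <= M) -> (forall n, ip mu2 (v n) (v n) <= M) ->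
  exists (sigma : nat -> nat) (a b : R * R -> R),
    [/\ forall m n, (m < n)%N -> (sigma m < sigma n)%N,
        sqint mu2 (on D a : plane R -> R), sqint mu2 (on D b : plane R -> R),
        weak_ip (u \o sigma) (on D a) & weak_ip (v \o sigma) (on D b)].
Proof.
move=> mD Lu Lv Du Dv uM vM.
have [s1 [a La [i1 ca]]] := sqint_weak_compactness Lu uM.
have [s2 [b Lb [i2 cb]]] := sqint_weak_compactness (fun n => Lv (s1 n)) (fun n => vM (s1 n)).
exists (s1 \o s2), a, b; split.
- by move=> m n mn; apply: i1; exact: i2.
- exact: sqint_on.
- exact: sqint_on.
- move=> h Lh; rewrite ip_on; have := cvg_subsequence i2 (ca _ (sqint_on mD Lh)).
  by apply: cvg_trans; apply: near_eq_cvg; apply: nearW => n; rewrite -ip_on Du.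
- move=> h Lh; rewrite ip_on; have := cb _ (sqint_on mD Lh).
  by apply: cvg_trans; apply: near_eq_cvg; apply: nearW => n; rewrite -ip_on Dv.
Qed.

End Restriction.

(** * Curl-free limits as the holes shrink *)

Section Holes.
Context {R : realType}.
Implicit Types (D Omega : set (R * R)) (phi psi : R * R -> R).

Lemma removable_points (F1 F2 : R * R -> R) Omega (s : seq (R * R)) :
  sqint mu2 (F1 : plane R -> R) -> sqint mu2 (F2 : plane R -> R) ->
  (forall psi, test_function (Omega `\` [set` s]) psi -> pairing F1 F2 psi = 0) ->
  forall psi, test_function Omega psi -> pairing F1 F2 psi = 0.
Proof.
move=> L1 L2; elim: s => [|q s IH] H.
  by move=> psi T; apply: H; apply: testS T => z Oz; split.
apply: IH; apply: (removable_point (p := q) L1 L2) => psi T; apply: H.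
apply: testS T => z [[Oz nz] zq]; split => //; rewrite /= in_cons => /orP[/eqP//|].
exact: nz.
Qed.

Lemma enorm_ge (u : R * R) : `|u.1| <= enorm u /\ `|u.2| <= enorm u.
Proof.
by split; rewrite /enorm -sqrtr_sqr ler_wsqrtr// /dot -!expr2 ?lerDl ?lerDr sqr_ge0.
Qed.

Lemma continuous_enorm : continuous (@enorm R).
Proof.
move=> z; rewrite /enorm /dot.
have c1 := @continuous_fst_plane R z; have c2 := @continuous_snd_plane R z.
have h : x.1 * x.1 + x.2 * x.2 @[x --> z] --> z.1 * z.1 + z.2 * z.2.
  by apply: cvgD; apply: cvgM.
exact: (cvg_comp _ _ h (@sqrt_continuous R _)).
Qed.

Lemma closed_eball (p : R * R) (e : R) : closed (eball p e).
Proof.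
have c : continuous ((fun z => enorm (z - p)) : R * R -> R).
  move=> z; have c1 := @continuous_comp _ _ _ (fun z : R * R => z - p) (@enorm R) z; apply: c1; last exact: continuous_enorm.
  by apply: cvgB; [exact: cvg_id|exact: cvg_cst].
by have := preimage_closed (fun z _ => c z) (@closed_le _ e).
Qed.

Variables (N : nat) (d : 'I_N -> R * R).

Lemma measurable_perforated Omega (e : R) : open Omega ->
  measurable (perforated Omega d e : set (plane R)).
Proof.
move=> oO; apply: measurableD; first exact: open_measurable_plane.
apply: fin_bigcup_measurable; first exact: finite_finset.
by move=> i _; apply: closed_measurable_plane; exact: closed_eball.
Qed.

Lemma perforated_sub Omega (e : R) : perforated Omega d e `<=` Omega.
Proof. by move=> z []. Qed.

(** The support of [psi] is closed and misses the points [d i], hence also small balls around these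
    finitely many points. *)
Lemma test_perforated_near Omega psi (e : nat -> R) : e n @[n --> \oo] --> (0 : R) ->
  test_function (Omega `\` [set` [seq d i | i <- enum 'I_N]]) psi ->
  \forall n \near \oo, test_function (perforated Omega d (e n)) psi.
Proof.
move=> e0 [s c cl].
have H i : \forall n \near \oo, forall z, closure [set z | psi z != 0] z -> ~ eball (d i) (e n) z.
  have oC : open (~` closure [set z | psi z != 0]) by apply: closed_openC; exact: closed_closure.
  have /nbhs_ballP[r /= r0 rP] : nbhs (d i) (~` closure [set z | psi z != 0]).
    apply: open_nbhs_nbhs; split=> // /cl[_]; apply.
    by rewrite /=; apply/mapP; exists i; rewrite ?mem_enum.
  have : \forall n \near \oo, e n < r by apply: (cvgr_lt _ e0).
  apply: filterS => n en z cz ze; apply: (rP z) => //.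
  have [h1 h2] := enorm_ge (z - d i).
  by apply/ball_planeE; split; [apply: le_lt_trans h1 _|apply: le_lt_trans h2 _]; exact: le_lt_trans ze en.
have {}H : \forall n \near \oo, forall i z, closure [set z | psi z != 0] z -> ~ eball (d i) (e n) z.
  exact: filter_forall.
apply: filterS H => n Hn; split=> // z cz; split; first by have [] := cl z cz.
by move=> [i _]; exact: Hn.
Qed.

Lemma weak_limit_curl_free Omega (u v : nat -> R * R -> R) (a b : R * R -> R) (e : nat -> R) :
  (forall n, sqint mu2 (u n : plane R -> R)) -> (forall n, sqint mu2 (v n : plane R -> R)) ->
  sqint mu2 (a : plane R -> R) -> sqint mu2 (b : plane R -> R) ->
  weak_ip u a -> weak_ip v b -> e n @[n --> \oo] --> (0 : R) ->
  (forall n psi, test_function (perforated Omega d (e n)) psi -> pairing (u n) (v n) psi = 0) ->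
  forall psi, test_function Omega psi -> pairing a b psi = 0.
Proof.
move=> Lu Lv La Lb ua vb e0 H; apply: (removable_points (s := [seq d i | i <- enum 'I_N]) La Lb).
move=> psi T; rewrite (pairingE La Lb T).
have c : ip mu2 (u n) (dy psi) - ip mu2 (v n) (dx psi) @[n --> \oo] -->
    ip mu2 a (dy psi) - ip mu2 b (dx psi).
  by apply: cvgB; [apply: ua; exact: test_sqint (test_dy T)|apply: vb; exact: test_sqint (test_dx T)].
have z : ip mu2 (u n) (dy psi) - ip mu2 (v n) (dx psi) @[n --> \oo] --> (0 : R).
  apply: cvg_near_cst; have := test_perforated_near e0 T; apply: filterS => n Tn.
  by rewrite -(pairingE (Lu n) (Lv n) T); exact: H.
by rewrite -(cvg_lim (@Rhausdorff R) c) (cvg_lim (@Rhausdorff R) z).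
Qed.

End Holes.

Lemma quadratic_coercive {R : realFieldType} (C K r : R) : 0 < C -> 0 < K -> r ^+ 2 < C * K ->
  exists2 c, 0 < c & forall a b, c * (a ^+ 2 + b ^+ 2) <= 2^-1 * (C * a ^+ 2 + K * b ^+ 2 + 2 * r * (a * b)).
Proof.
move=> C0 K0 rCK; have S0 : 0 < C + K by rewrite addr_gt0.
(* What is needed is [r ^+ 2 / 4 <= (C / 2 - c) * (K / 2 - c)] with a positive first factor. On
   expansion the loss is [c * (C + K) / 2], and this [c] makes it half of the available gap
   [(C * K - r ^+ 2) / 4]. *)
pose c := (C * K - r ^+ 2) / (4 * (C + K)).
have cS : c * (C + K) = (C * K - r ^+ 2) / 4.
  by rewrite /c; field; rewrite gt_eqF.
have c0 : 0 < c by rewrite divr_gt0 ?subr_gt0// mulr_gt0.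
exists c => // a b; clearbody c.
have r2 := sqr_ge0 r.
have pC : 0 < C / 2 - c.
  have : c * (C + K) < C / 2 * (C + K) by rewrite cS; nra.
  by rewrite ltr_pM2r// => h; rewrite subr_gt0.
have pq : r ^+ 2 / 4 <= (C / 2 - c) * (K / 2 - c).
  have -> : (C / 2 - c) * (K / 2 - c) = C * K / 4 - c * (C + K) / 2 + c ^+ 2 by field.
  by rewrite cS; have := sqr_ge0 c; nra.
(* Multiplication by [C / 2 - c] allows the square to be completed. *)
rewrite -subr_ge0 -(pmulr_rge0 _ pC).
have -> : (C / 2 - c) * (2^-1 * (C * a ^+ 2 + K * b ^+ 2 + 2 * r * (a * b)) - c * (a ^+ 2 + b ^+ 2)) =
  ((C / 2 - c) * a + r / 2 * b) ^+ 2 + ((C / 2 - c) * (K / 2 - c) - r ^+ 2 / 4) * b ^+ 2 by field.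
by rewrite addr_ge0 ?sqr_ge0// mulr_ge0 ?sqr_ge0// subr_ge0.
Qed.

(** * From bounded energy to weak limits and potentials *)

Section Energies.
Context {R : realType}.
Variables (Omega : set (R * R)) (N : nat) (d : 'I_N -> R * R).
Hypothesis oO : open Omega.
Implicit Types (f g V W : R * R -> R * R).
Local Notation meas f := (measurable_fun setT (f : plane R -> R)).
Local Notation perf e := (perforated Omega d e).

Definition component (i : bool) (V : R * R -> R * R) (z : R * R) : R :=
  if i then (V z).1 else (V z).2.

Definition trunc i e V : R * R -> R := on (perf e) (component i V).

Lemma trunc_on i e V : on Omega (trunc i e V) = trunc i e V.
Proof.
apply/funext => z; have [h|h] := pselect (Omega z); first by rewrite onT.
by rewrite onF// /trunc onF// => /perforated_sub.
Qed.

Lemma trunc_sqint i e V : L2vec Omega V -> sqint mu2 (trunc i e V : plane R -> R).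
Proof.
move=> LV; have [h1 h2] := L2vec_sqint (open_measurable_plane oO) LV.
have -> : trunc i e V = on (perf e) (on Omega (component i V)).
  apply/funext => z; have [h|h] := pselect (perf e z); last by rewrite /trunc !onF.
  by rewrite /trunc !(onT _ h) onT//; exact: perforated_sub h.
by apply: sqint_on; [exact: measurable_perforated|case: i].
Qed.

(** A finite value of [J0] selects its first branch, hence admissibility; coercivity is applied to
    the two coordinates of the fields separately. *)
Lemma J0_bound (bu bw : 'I_N -> R) (C K r c e C0 : R) V W : 0 < c ->
  (forall a b, c * (a ^+ 2 + b ^+ 2) <= 2^-1 * (C * a ^+ 2 + K * b ^+ 2 + 2 * r * (a * b))) ->
  L2vec Omega V -> L2vec Omega W -> (J0 Omega d bu bw C K r e V W <= C0%:E)%E ->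
  admissible Omega d bu bw e V W /\
  forall i, ip mu2 (trunc i e V) (trunc i e V) <= C0 / c /\
            ip mu2 (trunc i e W) (trunc i e W) <= C0 / c.
Proof.
move=> c0 cP LV LW; rewrite /J0; case: ifPn; last by rewrite leNgt ltry.
move=> /asboolP adm JC; split=> // i.
have [Ti Si] := (trunc_sqint i e LV, trunc_sqint i e LW).
pose q a b := 2^-1 * (C * a ^+ 2 + K * b ^+ 2 + 2 * r * (a * b)).
have q0 a b : 0 <= q a b.
  by apply: le_trans (cP a b); apply: mulr_ge0; [exact: ltW|rewrite addr_ge0 ?sqr_ge0].
pose Q z := q (trunc true e V z) (trunc true e W z) + q (trunc false e V z) (trunc false e W z).
have mT j : meas (trunc j e V) := (trunc_sqint j e LV).1.
have mS j : meas (trunc j e W) := (trunc_sqint j e LW).1.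
have mq j : meas (fun z => q (trunc j e V z) (trunc j e W z)).
  apply: measurable_funM => //; apply: measurable_funD.
    by apply: measurable_funD; apply: measurable_funM => //; exact: measurable_funX.
  by apply: measurable_funM => //; exact: measurable_funM.
have mQ : measurable_fun setT (fun z : plane R => (Q z)%:E).
  by apply/measurable_EFinP; exact: measurable_funD.
have {}JC : (\int[mu2]_z (Q z)%:E <= C0%:E)%E.
  apply: le_trans JC; rewrite [leRHS]integral_mkcond le_eqVlt; apply/orP; left; apply/eqP.
  apply: eq_integral => z _; rewrite /Q /patch; case: ifPn => [/set_mem h|/negP nh].
    by rewrite /trunc !(onT _ h) /q /dot /component; congr EFin; ring.
  have {}nh : ~ perf e z by move=> h; apply: nh; exact/mem_set.
  by rewrite /trunc !(onF _ nh) /q expr0n /= !mulr0 !addr0 mulr0 addr0.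
have step (u : R * R -> R) : sqint mu2 (u : plane R -> R) -> (forall z, c * u z ^+ 2 <= Q z) ->
    ip mu2 u u <= C0 / c.
  move=> Lu uQ; rewrite ler_pdivlMr// mulrC -lee_fin EFinM -(sqint_ipE Lu).
  apply: le_trans JC; rewrite -ge0_integralZl//; last 3 first.
  - exact: measurable_E2 Lu.1.
  - by move=> z _; rewrite lee_fin sqr_ge0.
  - by rewrite lee_fin ltW.
  apply: ge0_le_integral => //.
  - by move=> z _; rewrite -EFinM lee_fin; apply: mulr_ge0; [exact: ltW|exact: sqr_ge0].
  - apply: measurable_funeM; exact: measurable_E2 Lu.1.
  - by move=> z _; rewrite -EFinM lee_fin.
have lo a b : c * a ^+ 2 <= q a b /\ c * b ^+ 2 <= q a b.
  have := cP a b; rewrite -/(q a b) mulrDr; have := mulr_ge0 (ltW c0) (sqr_ge0 a).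
  by have := mulr_ge0 (ltW c0) (sqr_ge0 b); move: (q a b) => x; split; lra.
split; apply: step => // z; rewrite /Q; have [h1 h2] := lo (trunc true e V z) (trunc true e W z);
  have [h3 h4] := lo (trunc false e V z) (trunc false e W z);
  have := q0 (trunc true e V z) (trunc true e W z);
  have := q0 (trunc false e V z) (trunc false e W z);
  move: (q _ _) (q _ _) h1 h2 h3 h4 => x y; case: i {Ti Si} => ? ? ? ?; lra.
Qed.

Lemma ae_imply (P Q : R * R -> Prop) : (forall z, P z -> Q z) ->
  {ae (@mu2 R), forall z, P z} -> {ae (@mu2 R), forall z, Q z}.
Proof. by move=> PQ; apply: negligibleS => z /= nq p; apply: nq; exact: PQ. Qed.

(** The condition is an integral, so it survives multiplication by a constant and a change on a null
    set. *)
Lemma scaled_curl_free e s f V : L2vec Omega V -> L2vec (perf e) f -> curl_free (perf e) f ->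
  {ae mu2, forall z, perf e z -> V z = s *: f z} ->
  forall psi, test_function (perf e) psi -> pairing (trunc true e V) (trunc false e V) psi = 0.
Proof.
move=> LV Lf cf E psi T; have mP := measurable_perforated (N := N) d e oO.
have [f1 f2] := L2vec_sqint mP Lf.
(* Adding the zero function puts the multiple into the shape [a * f + g] of [sqint_lin] and
   [ip_lin]. *)
have h1 : sqint mu2 (fun z : plane R => s * on (perf e) (fun z => (f z).1) z + 0).
  by apply: sqint_lin => //; exact: sqint0.
have h2 : sqint mu2 (fun z : plane R => s * on (perf e) (fun z => (f z).2) z + 0).
  by apply: sqint_lin => //; exact: sqint0.
have [Tx Ty] := (test_sqint (test_dx T), test_sqint (test_dy T)).
have i0 h : ip mu2 (fun=> 0) (h : plane R -> R) = 0.
  by rewrite /ip /Rintegral; under eq_integral do rewrite mul0r; rewrite integral0.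
have scale i (u : R * R -> R) (h : R * R -> R) :
    sqint mu2 (fun z : plane R => s * u z + 0) -> sqint mu2 (u : plane R -> R) ->
    sqint mu2 (h : plane R -> R) -> {ae (@mu2 R), forall z, trunc i e V z = s * u z + 0} ->
    ip mu2 (trunc i e V) h = s * ip mu2 u h.
  move=> Lsu Lu Lh Eu; apply: (etrans (ip_ae (trunc_sqint i e LV) Lsu Lh Eu)).
  apply: (etrans (ip_lin s Lu (sqint0 mu2) Lh)).
  by rewrite (i0 h) addr0.
rewrite (pairingE (trunc_sqint true e LV) (trunc_sqint false e LV) T).
rewrite (scale true _ _ h1 f1 Ty); last first.
  apply: (ae_imply _ E) => z {}E; rewrite addr0 /trunc /component; have [h|h] := pselect (perf e z).
    by rewrite !(onT _ h) E.
  by rewrite !(onF _ h) mulr0.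
rewrite (scale false _ _ h2 f2 Tx); last first.
  apply: (ae_imply _ E) => z {}E; rewrite addr0 /trunc /component; have [h|h] := pselect (perf e z).
    by rewrite !(onT _ h) E.
  by rewrite !(onF _ h) mulr0.
have c0 := cf psi T; rewrite curl_pairing_on (pairingE f1 f2 T) in c0.
by rewrite -mulrBr c0 mulr0.
Qed.

Lemma weak_cvg_trunc (e : nat -> R) (V : nat -> R * R -> R * R) (a b : R * R -> R) :
  (forall n, L2vec Omega (V n)) ->
  sqint mu2 (on Omega a : plane R -> R) -> sqint mu2 (on Omega b : plane R -> R) ->
  weak_ip (fun n => trunc true (e n) (V n)) (on Omega a) ->
  weak_ip (fun n => trunc false (e n) (V n)) (on Omega b) ->
  weak_cvg_L2 Omega (fun n z => \1_(perf (e n)) z *: V n z) (fun z => (a z, b z)).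
Proof.
move=> LV La Lb ca cb; have mO := open_measurable_plane oO.
have t1 n : (fun z => (\1_(perf (e n)) z *: V n z).1) = trunc true (e n) (V n) by [].
have t2 n : (fun z => (\1_(perf (e n)) z *: V n z).2) = trunc false (e n) (V n) by [].
have L n : L2vec Omega (fun z => \1_(perf (e n)) z *: V n z).
  by split; apply/(L2E _ mO); rewrite ?t1 ?t2 trunc_on; exact: trunc_sqint.
have Lab : L2vec Omega (fun z => (a z, b z)) by split; apply/(L2E _ mO).
split=> // g Lg; have [g1 g2] := L2vec_sqint mO Lg.
rewrite (integral_dot mO Lab Lg).
rewrite (_ : (fun n => _) = (fun n => ip mu2 (trunc true (e n) (V n)) (on Omega (fun z => (g z).1)) +
    ip mu2 (trunc false (e n) (V n)) (on Omega (fun z => (g z).2)))).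
  by apply: cvgD; [exact: ca|exact: cb].
by apply/funext => n; rewrite (integral_dot mO (L n) Lg) t1 t2 !trunc_on.
Qed.

(** The potential is given on the whole plane; derivatives of test functions vanish off [Omega], so
    the integrals over the plane and over [Omega] agree. *)
Lemma H1_of_potential (v a b : R * R -> R) : sqint mu2 (v : plane R -> R) ->
  sqint mu2 (on Omega a : plane R -> R) -> sqint mu2 (on Omega b : plane R -> R) ->
  (forall phi, test_function Omega phi ->
    (\int[mu2]_z (v z * dx phi z) = - \int[mu2]_z (on Omega a z * phi z)) /\
    (\int[mu2]_z (v z * dy phi z) = - \int[mu2]_z (on Omega b z * phi z))) ->
  H1_with_gradient Omega v (fun z => (a z, b z)).
Proof.
move=> Lv La Lb H; have mO := open_measurable_plane oO.
split; [exact/(L2E _ mO)/sqint_on|by split; apply/(L2E _ mO)|move=> phi T].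
have supp (u h : R * R -> R) : (forall z, ~ Omega z -> h z = 0) ->
    \int[mu2]_(z in Omega) (u z * h z) = \int[mu2]_z (u z * h z).
  move=> h0; rewrite Rintegral_on; apply: eq_Rintegral => z _.
  by have [zO|zO] := pselect (Omega z); [rewrite onT|rewrite onF// h0// mulr0].
have restr (u h : R * R -> R) :
    \int[mu2]_(z in Omega) (u z * h z) = \int[mu2]_z (on Omega u z * h z).
  rewrite Rintegral_on; apply: eq_Rintegral => z _.
  by have [zO|zO] := pselect (Omega z); [rewrite !onT|rewrite !onF// mul0r].
have [h1 h2] := H phi T; split.
  by rewrite (supp v (dx phi) (fun z => test_supp (test_dx T) (z := z))) h1 -restr.
by rewrite (supp v (dy phi) (fun z => test_supp (test_dy T) (z := z))) h2 -restr.
Qed.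

Hypotheses (sc : simply_connected Omega) (lipO : lipschitz_boundary Omega).

Lemma limit_potential (p0 : R * R) (M0 : R) (a b : R * R -> R) :
  Omega `<=` ball (0 : R * R) M0 -> Omega p0 ->
  sqint mu2 (on Omega a : plane R -> R) -> sqint mu2 (on Omega b : plane R -> R) ->
  (forall psi, test_function Omega psi -> pairing (on Omega a) (on Omega b) psi = 0) ->
  exists v, H1_with_gradient Omega v (fun z => (a z, b z)).
Proof.
move=> OM Op0 La Lb H.
have muM : mu2 (ball (0 : R * R) M0 : set (plane R)) =
    (fine (mu2 (ball (0 : R * R) M0 : set (plane R))))%:E.
  by rewrite fineK// ge0_fin_numE// mu2_ball_lty.
have off (u : R * R -> R) z : ~ ball (0 : R * R) M0 z -> on Omega u z = 0.
  by move=> nz; rewrite onF// => /OM.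
have [L1 _] := integral_norm_bounded_support La (off a) muM.
have [L2' _] := integral_norm_bounded_support Lb (off b) muM.
have [v Lv vP] := potential_exists L1 L2' oO sc lipO OM Op0 H.
by exists v; exact: H1_of_potential.
Qed.

End Energies.

(** * Weak limits of the truncated fields are gradients *)

Theorem theorem1p1 (R : realType) (Omega : set (R * R)) (N : nat)
    (d : 'I_N -> R * R) (bu bw : 'I_N -> R) (C Rc K e0 C0 : R)
    (U W : R -> R * R -> R * R)
    (Omega_bounded : bounded_set Omega) (Omega_open : open Omega)
    (Omega_sc : simply_connected Omega)
    (Omega_lip : lipschitz_boundary Omega)
    (N_ge1 : (1 <= N)%N) (d_in : forall i, Omega (d i))
    (d_inj : injective d)
    (C_gt0 : 0 < C) (K_gt0 : 0 < K) (CK : Rc ^+ 2 < C * K)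
    (e0_gt0 : 0 < e0) (e0_lt1 : e0 < 1)
    (balls_disj : forall i j, i != j ->
       eball (d i) e0 `&` eball (d j) e0 = set0)
    (balls_in : forall i, eball (d i) e0 `<=` Omega)
    (UW_L2 : forall e, 0 < e < e0 -> L2vec Omega (U e) /\ L2vec Omega (W e))
    (J_bounded : (ereal_sup
        [set J0 Omega d bu bw C K Rc e (U e) (W e) | e in [set e | (0 < e < e0)%R]]
        <= C0%:E)%E) :
  forall eps : nat -> R, (forall n, 0 < eps n < e0) ->
    eps n @[n --> \oo] --> (0 : R) ->
  exists (vu vw : R * R -> R) (gu gw : R * R -> R * R) (sigma : nat -> nat),
    [/\ H1_with_gradient Omega vu gu, H1_with_gradient Omega vw gw,
        forall m n, (m < n)%N -> (sigma m < sigma n)%N,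
        weak_cvg_L2 Omega (fun n z =>
          \1_(perforated Omega d (eps (sigma n))) z *: U (eps (sigma n)) z) gu &
        weak_cvg_L2 Omega (fun n z =>
          \1_(perforated Omega d (eps (sigma n))) z *: W (eps (sigma n)) z) gw].
Proof.
move=> eps epsP eps0.
(* The first core provides the base point in [Omega] for the potentials. *)
have p0 : Omega (d (Ordinal N_ge1)) by exact: d_in.
have [M0 _ OM] := bounded_set_ball Omega_bounded.
have [c c0 cP] := quadratic_coercive C_gt0 K_gt0 CK.
have LU n : L2vec Omega (U (eps n)) by case: (UW_L2 _ (epsP n)).
have LW n : L2vec Omega (W (eps n)) by case: (UW_L2 _ (epsP n)).
have J n : (J0 Omega d bu bw C K Rc (eps n) (U (eps n)) (W (eps n)) <= C0%:E)%E.
  by apply: le_trans J_bounded; apply: ereal_sup_ubound; exists (eps n) => //; exact: epsP.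
have adm n := (J0_bound Omega_open c0 cP (LU n) (LW n) (J n)).1.
have bnd n := (J0_bound Omega_open c0 cP (LU n) (LW n) (J n)).2.
have curlU n psi : test_function (perforated Omega d (eps n)) psi ->
    pairing (trunc Omega d true (eps n) (U (eps n))) (trunc Omega d false (eps n) (U (eps n))) psi = 0.
  have [ft [gt [[Lf _ cf _ _] E]]] := adm n.
  have E' : {ae (@mu2 R), forall z, perforated Omega d (eps n) z ->
      U (eps n) z = (`|ln (eps n)| `^ (- 2^-1)) *: ft z}.
    by apply: (ae_imply _ E) => z h /h[].
  exact: (scaled_curl_free Omega_open (LU n) Lf cf E').
have curlW n psi : test_function (perforated Omega d (eps n)) psi ->
    pairing (trunc Omega d true (eps n) (W (eps n))) (trunc Omega d false (eps n) (W (eps n))) psi = 0.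
  have [ft [gt [[_ Lg _ cg _] E]]] := adm n.
  have E' : {ae (@mu2 R), forall z, perforated Omega d (eps n) z ->
      W (eps n) z = (`|ln (eps n)| `^ (- 2^-1)) *: gt z}.
    by apply: (ae_imply _ E) => z h /h[].
  exact: (scaled_curl_free Omega_open (LW n) Lg cg E').
have mO := open_measurable_plane Omega_open.
pose u i n := trunc Omega d i (eps n) (U (eps n)).
pose w i n := trunc Omega d i (eps n) (W (eps n)).
have Lu i n : sqint mu2 (u i n : plane R -> R) := trunc_sqint d Omega_open i (eps n) (LU n).
have Lw i n : sqint mu2 (w i n : plane R -> R) := trunc_sqint d Omega_open i (eps n) (LW n).
have [s1 [a1 [a2 [inc1 La1 La2 ca1 ca2]]]] := weak_limit_pair mO (Lu true) (Lu false)
  (fun n => trunc_on Omega d true (eps n) (U (eps n))) (fun n => trunc_on Omega d false (eps n) (U (eps n)))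
  (fun n => (bnd n true).1) (fun n => (bnd n false).1).
(* The extraction for [W] is made along the one for [U], so both families converge along the
   composite [sigma]. *)
have [s2 [b1 [b2 [inc2 Lb1 Lb2 cb1 cb2]]]] := weak_limit_pair mO
  (fun n => Lw true (s1 n)) (fun n => Lw false (s1 n))
  (fun n => trunc_on Omega d true (eps (s1 n)) (W (eps (s1 n))))
  (fun n => trunc_on Omega d false (eps (s1 n)) (W (eps (s1 n))))
  (fun n => (bnd (s1 n) true).2) (fun n => (bnd (s1 n) false).2).
pose sigma n := s1 (s2 n).
have inc m n : (m < n)%N -> (sigma m < sigma n)%N by move=> mn; apply: inc1; exact: inc2.
have e0' : eps (sigma n) @[n --> \oo] --> (0 : R) by exact: (cvg_subsequence inc eps0).
have cu1 : weak_ip (fun n => u true (sigma n)) (on Omega a1).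
  by move=> h Lh; exact: (cvg_subsequence inc2 (ca1 h Lh)).
have cu2 : weak_ip (fun n => u false (sigma n)) (on Omega a2).
  by move=> h Lh; exact: (cvg_subsequence inc2 (ca2 h Lh)).
have curla := weak_limit_curl_free (fun n => Lu true (sigma n)) (fun n => Lu false (sigma n))
  La1 La2 cu1 cu2 e0' (fun n => curlU (sigma n)).
have curlb := weak_limit_curl_free (fun n => Lw true (sigma n)) (fun n => Lw false (sigma n))
  Lb1 Lb2 cb1 cb2 e0' (fun n => curlW (sigma n)).
have [vu Hu] := limit_potential Omega_open Omega_sc Omega_lip OM p0 La1 La2 curla.
have [vw Hw] := limit_potential Omega_open Omega_sc Omega_lip OM p0 Lb1 Lb2 curlb.
exists vu, vw, (fun z => (a1 z, a2 z)), (fun z => (b1 z, b2 z)), sigma; split => //.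
  exact: (weak_cvg_trunc (e := fun n => eps (sigma n)) Omega_open (fun n => LU (sigma n)) La1 La2 cu1 cu2).
exact: (weak_cvg_trunc (e := fun n => eps (sigma n)) Omega_open (fun n => LW (sigma n)) Lb1 Lb2 cb1 cb2).
Qed.
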